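(* Every odd Real primary Hopf surface is equivariantly diffeomorphic to $(S^1\times S^3,\mu)$, where $\mu$ is the involution $\mu(\zeta,Z)=(-\zeta,\bar Z)$.
   Context: $S^1\subset\mathbb{C}$ and $S^3\subset\mathbb{C}^2$ are the unit spheres, and $\bar Z$ is the componentwise complex conjugate of $Z\in S^3$. $W=\mathbb{C}^2\setminus\{0\}$. A primary Hopf surface is a compact complex surface with universal cover biholomorphic to $W$ and fundamental group isomorphic to $\mathbb{Z}$; it is then a quotient $W/\langle f\rangle$ for some $f\in\mathrm{Aut}_h(W)$. A Real structure on $H$ is an anti-holomorphic involution $\sigma$, and a Real primary Hopf surface is a pair $(H,\sigma)$. It is odd if $\sigma$ has a lift $\hat\sigma:W\to W$ with $\hat\sigma^2=f$, where $H=W/\langle f\rangle$. Equivariant diffeomorphism $(M,s)\to(N,t)$ between manifolds with involutions: a diffeomorphism $h:M\to N$ with $h\circ s=t\circ h$. *)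

(* Defs.v *)
From HB Require Import structures.
From mathcomp Require Import all_boot all_order all_algebra.
From mathcomp Require Import complex.
From mathcomp Require Import all_classical all_reals all_analysis.

Set Implicit Arguments.
Unset Strict Implicit.
Unset Printing Implicit Defensive.

Import Order.TTheory GRing.Theory Num.Theory.
Import numFieldNormedType.Exports.

Local Open Scope classical_set_scope.
Local Open Scope ring_scope.
Local Open Scope complex_scope.

Definition regularity (K : numFieldType) :=
  forall E F : normedModType K, set E -> (E -> F) -> Prop.

Fixpoint iter_derive (K : numFieldType) (E F : normedModType K)
    (vs : seq E) (g : E -> F) : E -> F :=
  if vs is v :: vs' then 'D_v (iter_derive vs' g) else g.

(* For finite-dimensional E and open D this is the class C^oo: every iterated
   directional derivative exists and is (Frechet) differentiable on D. *)
Definition smooth_on (R : realType) : regularity R :=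
  fun E F D g => forall (vs : seq E) (x : E),
    D x -> differentiable (iter_derive vs g) x.

(* C^n as a normed space over C = R[i]; the norm is the sup norm. *)
Definition Cn (R : realType) (n : nat) : normedModType R[i] := 'rV[R[i]]_n.

(* Differentiability over the field R[i], i.e. the differential is C-linear. *)
Definition holomorphic_on (R : realType) : regularity R[i] :=
  fun E F D g => forall x : E, D x -> differentiable g x.

Definition conj_row (R : realType) (n : nat) (z : Cn R n) : Cn R n :=
  map_mx (@conjc R) z.

Definition antiholomorphic_on (R : realType) (m n : nat)
    (D : set (Cn R m)) (g : Cn R m -> Cn R n) : Prop :=
  holomorphic_on D (@conj_row R n \o g).

(* [chart_fun] is only meaningful on [chart_dom]. *)
Record chart (T : topologicalType) (E : Type) := Chart {
  chart_dom : set T;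
  chart_fun : T -> E
}.

Definition is_chart (T E : topologicalType) (c : chart T E) : Prop :=
  let U := chart_dom c in
  let V := chart_fun c @` chart_dom c in
  [/\ open U, open V, {within U, continuous (chart_fun c)} &
      exists g : E -> T, {within V, continuous g} /\
        (forall x, U x -> g (chart_fun c x) = x)].

(* For every pair of charts, [h] restricted to [D] reads in these charts as a
   map [g] which is regular on the relevant subset of the model space. *)
Definition in_charts_on (T T' : topologicalType) (E F : Type)
    (P : set E -> (E -> F) -> Prop)
    (A : set (chart T E)) (B : set (chart T' F)) (D : set T) (h : T -> T') :=
  forall a b, A a -> B b ->
    let O := D `&` chart_dom a `&` h @^-1` chart_dom b in
    exists g : E -> F, P (chart_fun a @` O) g /\
      forall x, O x -> g (chart_fun a x) = chart_fun b (h x).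

Definition is_atlas (K : numFieldType) (P : regularity K) (T : topologicalType)
    (E : normedModType K) (A : set (chart T E)) : Prop :=
  [/\ forall c, A c -> is_chart c,
      forall x, exists2 c, A c & chart_dom c x &
      in_charts_on (P E E) A A setT idfun].

Definition regular_on (T T' : topologicalType) (E F : Type)
    (P : set E -> (E -> F) -> Prop)
    (A : set (chart T E)) (B : set (chart T' F)) (D : set T) (h : T -> T') :=
  {within D, continuous h} /\ in_charts_on P A B D h.

(* [h] restricts to an isomorphism of the open set [U] onto the open set [V]. *)
Definition iso_on (K : numFieldType) (P : regularity K)
    (T T' : topologicalType) (E F : normedModType K)
    (A : set (chart T E)) (B : set (chart T' F))
    (U : set T) (V : set T') (h : T -> T') : Prop :=
  exists k : T' -> T,
    [/\ (forall x, U x -> V (h x) /\ k (h x) = x),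
        (forall y, V y -> U (k y) /\ h (k y) = y),
        regular_on (P E F) A B U h & regular_on (P F E) B A V k].

Section Loops.
Variables (R : realType) (T : topologicalType).

(* Only the values on [0, 1] matter. *)
Definition loop_at (x : T) (l : R -> T) : Prop :=
  [/\ {within `[0, 1], continuous l}, l 0 = x & l 1 = x].

Definition loop_cat (l l' : R -> T) : R -> T :=
  fun t => if t <= 2^-1 then l (2 * t) else l' (2 * t - 1).

Definition loop_homotopic (x : T) (l l' : R -> T) : Prop :=
  exists F : R * R -> T,
    [/\ {within `[0, 1] `*` `[0, 1], continuous F},
        (forall t, 0 <= t <= 1 -> F (t, 0) = l t /\ F (t, 1) = l' t) &
        (forall s, 0 <= s <= 1 -> F (0, s) = x /\ F (1, s) = x)].

Definition path_connected : Prop :=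
  forall x y : T, exists l : R -> T,
    [/\ {within `[0, 1], continuous l}, l 0 = x & l 1 = y].

Definition simply_connected : Prop :=
  path_connected /\
  forall (x : T) (l : R -> T), loop_at x l -> loop_homotopic x l (cst x).

(* [d] induces a group isomorphism from pi_1(T, x) to Z. *)
Definition pi1_isomorphic_Z : Prop :=
  path_connected /\
  forall x : T, exists d : (R -> T) -> int,
    [/\ (forall l l', loop_at x l -> loop_at x l' ->
           (loop_homotopic x l l' <-> d l = d l')),
        (forall l l', loop_at x l -> loop_at x l' ->
           d (loop_cat l l') = d l + d l') &
        (forall k : int, exists2 l, loop_at x l & d l = k)].

End Loops.

Record complex_surface (R : realType) := ComplexSurface {
  surf_space :> topologicalType;
  surf_atlas : set (chart surf_space (Cn R 2));
  surf_hausdorff : hausdorff_space surf_space;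
  surf_second_countable : @second_countable surf_space;
  surf_is_atlas : is_atlas (@holomorphic_on R) surf_atlas
}.

Arguments surf_atlas {R} c.

(* The open subset C^2 minus 0 of C^2, with the subspace topology. *)
Definition W (R : realType) : topologicalType :=
  set_type [set z : Cn R 2 | z != 0].

Definition W_atlas (R : realType) : set (chart (W R) (Cn R 2)) :=
  [set Chart setT (set_val : W R -> Cn R 2)].
Arguments W_atlas : clear implicits.

(* Each evenly covered [V] has preimage the disjoint union of the open [U i],
   and [p] maps every [U i] biholomorphically onto [V]. *)
Definition holomorphic_covering (R : realType) (T T' : topologicalType)
    (A : set (chart T (Cn R 2))) (B : set (chart T' (Cn R 2)))
    (p : T -> T') : Prop :=
  (forall y, exists x, p x = y) /\
  forall y : T', exists V : set T', [/\ open V, V y &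
    exists (I : Type) (U : I -> set T),
      [/\ forall i, open (U i),
          trivIset setT U,
          \bigcup_i U i = p @^-1` V &
          forall i, iso_on (@holomorphic_on R) A B (U i) V p]].

Definition primary_Hopf_surface (R : realType) (H : complex_surface R) : Prop :=
  [/\ compact [set: H],
      (exists (X : complex_surface R) (p : X -> H) (b : X -> W R),
         [/\ simply_connected R X,
             holomorphic_covering (surf_atlas X) (surf_atlas H) p &
             iso_on (@holomorphic_on R) (surf_atlas X) (W_atlas R)
               setT setT b]) &
      pi1_isomorphic_Z R H].

Definition Real_structure (R : realType) (H : complex_surface R)
    (sigma : H -> H) : Prop :=
  regular_on (@antiholomorphic_on R 2 2) (surf_atlas H) (surf_atlas H)
    setT sigma /\
  forall x, sigma (sigma x) = x.

Definition Aut_h_W (R : realType) (f : W R -> W R) : Prop :=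
  iso_on (@holomorphic_on R) (W_atlas R) (W_atlas R) setT setT f.

(* [p] exhibits [H] as the quotient of [W] by the cyclic group generated by the
   bijection [f]: it is a holomorphic covering whose fibres are the orbits. *)
Definition quotient_of_W (R : realType) (H : complex_surface R)
    (f : W R -> W R) (p : W R -> H) : Prop :=
  holomorphic_covering (W_atlas R) (surf_atlas H) p /\
  forall z w, p z = p w <-> exists n, iter n f z = w \/ iter n f w = z.

Definition odd_Real (R : realType) (H : complex_surface R) (sigma : H -> H) :
    Prop :=
  exists (f : W R -> W R) (p : W R -> H) (s : W R -> W R),
    [/\ Aut_h_W f,
        quotient_of_W f p,
        continuous s /\ (forall z, p (s z) = sigma (p z)) &
        forall z, s (s z) = f z].

(* (z_1, ..., z_n) |-> (Re z_1, ..., Re z_n, Im z_1, ..., Im z_n) *)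
Definition real_coords (R : realType) (n : nat) (z : Cn R n) :
    'rV[R]_(n + n) :=
  row_mx (map_mx (@complex.Re R) z) (map_mx (@complex.Im R) z).

Definition smooth_atlas (R : realType) (H : complex_surface R) :
    set (chart H 'rV[R]_(2 + 2)) :=
  [set Chart (chart_dom c) (@real_coords R 2 \o chart_fun c)
     | c in surf_atlas H].
Arguments smooth_atlas {R} H.

(* The unit sphere of C^n; the circle is [sphere R 1], in C^1. *)
Definition unit_sphere (R : realType) (n : nat) : set (Cn R n) :=
  [set z | \sum_j `|z 0 j| ^+ 2 = 1].

Definition sphere (R : realType) (n : nat) : topologicalType :=
  set_type (@unit_sphere R n).

(* The open hemisphere where the k-th real coordinate has sign (-1)^s, projected
   along that coordinate. *)
Definition hemisphere_chart (R : realType) (n : nat) (s : bool)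
    (k : 'I_(n + n)) : chart (sphere R n) 'rV[R]_(n + n).-1 :=
  Chart [set z | 0 < (-1) ^+ s * real_coords (set_val z) 0 k]
        (fun z => col' k (real_coords (set_val z))).

Definition sphere_atlas (R : realType) (n : nat) :
    set (chart (sphere R n) 'rV[R]_(n + n).-1) :=
  [set c | exists s k, c = @hemisphere_chart R n s k].
Arguments sphere_atlas : clear implicits.

Definition prod_chart (T T' : topologicalType) (E F : Type)
    (a : chart T E) (b : chart T' F) : chart (T * T')%type (E * F)%type :=
  Chart (chart_dom a `*` chart_dom b)
        (fun x => (chart_fun a x.1, chart_fun b x.2)).

Definition prod_atlas (T T' : topologicalType) (E F : Type)
    (A : set (chart T E)) (B : set (chart T' F)) :
    set (chart (T * T')%type (E * F)%type) :=
  [set c | exists a b, [/\ A a, B b & c = prod_chart a b]].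

Definition equivariantly_diffeomorphic (R : realType)
    (M N : topologicalType) (E F : normedModType R)
    (A : set (chart M E)) (B : set (chart N F))
    (s : M -> M) (t : N -> N) : Prop :=
  exists h : M -> N,
    iso_on (@smooth_on R) A B setT setT h /\ forall x, h (s x) = t (h x).

Lemma sphereN (R : realType) (n : nat) (z : Cn R n) :
  unit_sphere z -> unit_sphere (- z).
Proof.
rewrite /unit_sphere /= => <-; apply: eq_bigr => j _; by rewrite mxE normrN.
Qed.

Lemma sphere_conj (R : realType) (n : nat) (z : Cn R n) :
  unit_sphere z -> unit_sphere (conj_row z).
Proof.
rewrite /unit_sphere /= => <-; apply: eq_bigr => j _; rewrite mxE; case: (z 0 j) => a b.
by rewrite !normc_def /= sqrrN.
Qed.

Definition sphere_opp (R : realType) (n : nat) (z : sphere R n) : sphere R n :=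
  exist _ (- set_val z) (mem_set (sphereN (set_valP z))).

Definition sphere_bar (R : realType) (n : nat) (z : sphere R n) : sphere R n :=
  exist _ (conj_row (set_val z)) (mem_set (sphere_conj (set_valP z))).

Definition mu (R : realType) (x : (sphere R 1 * sphere R 2)%type) :
    (sphere R 1 * sphere R 2)%type :=
  (sphere_opp x.1, sphere_bar x.2).
Arguments mu : clear implicits.

(* Main.v *)
(** A lift [S] of the Real structure to C^2 minus 0 is antiholomorphic and [S \o S]
    generates the deck group.  By Hartogs' theorem [S] extends over 0, which it
    fixes; freeness and proper discontinuity of the deck group, together with
    compactness of the quotient, force [S] or its inverse to attract everything
    to 0.  Two such maps that agree near 0, or near infinity, are conjugate
    through the stabilising sequence [t^-n \o s^n].  Interpolating with a cut-off
    function, an attracting map is therefore conjugate, on the punctured space, to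
    any invertible linear contraction to which it is Lipschitz-close near 0: first
    to its differential at 0, then along a path of antilinear contractions to half
    of complex conjugation.  A segment from the differential to a rotated
    conjugation stays invertible for a suitable rotation because a complex 2 x 2
    matrix has at most two eigenvalues.  Finally Z |-> (exp(- i pi log_2 |Z|), Z / |Z|)
    turns half of the conjugation into [mu].  Smoothness of holomorphic maps is
    derived from the Goursat lemma for closed 1-forms and the mean value property
    on circles. *)
From HB Require Import structures.
Require Import Defs.
From mathcomp Require Import all_boot all_order all_algebra.
From mathcomp Require Import complex ring lra.
From mathcomp Require Import all_classical all_reals all_analysis.

Set Implicit Arguments.
Unset Strict Implicit.
Unset Printing Implicit Defensive.

Import Order.TTheory GRing.Theory Num.Theory.
Import numFieldNormedType.Exports.

Local Open Scope classical_set_scope.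
Local Open Scope ring_scope.
Local Open Scope complex_scope.

(** * C^k calculus *)

(** The obstacle is that linear contractions with different eigenvalues are never conjugate by a
    diffeomorphism across 0. Conjugacies therefore live on the punctured space only, and there the
    sequence t^-n s^n raises no question of convergence: it is stationary near each point.
    Resonances and normal forms never enter. The threshold of the perturbation step depends only on
    a norm bound [C] and an exponent [k], which is what allows finitely many small steps along a
    path. The conjugacy is built for the lift [S] and not for the deck generator [S \o S]: a
    conjugacy of [S] descends to the quotient and is equivariant there. Half of conjugation lowers
    log_2 |Z| by 1, so it turns exp(- i pi log_2 |Z|) into its opposite, whereas its square,
    division by 4, leaves this phase unchanged. Holomorphy is differentiability over [R[i]] and
    smoothness is over [R], so two normed structures with different scalars are involved. Everything
    is moved to real coordinates, where multiplication by i is an operator [J]. *)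

Section Differential.
Variable K : numFieldType.
Implicit Types E F : normedModType K.

Lemma diff_smallo E F (f : E -> F) x e : differentiable f x -> 0 < e ->
  \forall h \near 0, `|f (h + x) - f x - 'd f x h| <= e * `|h|.
Proof.
move=> df e0.
have /eqaddoP/(_ e e0) /= := diff_locally df.
by apply: filterS => h /=; rewrite opprD addrA.
Qed.

Lemma diff_eps_delta E F (f : E -> F) x e : differentiable f x -> 0 < e ->
  exists2 d : K, 0 < d & forall y, `|y - x| < d -> `|f y - f x - 'd f x (y - x)| <= e * `|y - x|.
Proof.
move=> df e0; have /nbhs_ballP[d /= d0 H] := diff_smallo df e0.
exists d => // y yx; have := H (y - x); rewrite -ball_normE /= sub0r normrN subrK.
exact.
Qed.

Lemma diff_intro E F (f : E -> F) x (l : {linear E -> F}) : continuous l ->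
  (forall e, 0 < e -> \forall h \near 0, `|f (h + x) - f x - l h| <= e * `|h|) ->
  is_diff x f l.
Proof.
move=> cl H.
have fo : f \o shift x = cst (f x) + l +o_ 0 id.
  apply/eqaddoP => e e0 /=; have := H _ e0.
  apply: filterS => h /=. by rewrite /= opprD addrA.
have dE := diff_unique cl fo.
apply: DiffDef => //.
by apply/diff_locallyP; rewrite dE; split.
Qed.

Lemma near_eq_diff E F (f g : E -> F) x : (\near x, f x = g x) -> differentiable f x ->
  is_diff x g ('d f x).
Proof.
move=> fg df.
have e0 : \forall h \near (0:E), f (h + x) = g (h + x).
  by move: fg; rewrite (near_shift 0 x) /= subr0.
apply: (@diff_intro _ _ g x ('d f x)); first exact: diff_continuous.
move=> e e1; near=> h.
rewrite -(near e0 h)// -(nbhs_singleton fg)//.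
near: h; exact: diff_smallo.
Unshelve. all: by end_near. Qed.
End Differential.

(* [C^k] through the tangent map, so that the chain rule is composition of
   tangent maps. *)
Fixpoint Ck (R : realType) (k : nat) {struct k} : forall E F : normedModType R, set E -> (E -> F) -> Prop :=
  match k with
  | 0 => fun E F D f => forall x, D x -> differentiable f x
  | k'.+1 => fun E F D f => (forall x, D x -> differentiable f x) /\
      @Ck R k' (E * E)%type F [set z : (E * E)%type | D z.1]
         (fun z : (E * E)%type => 'd f (z.1) z.2)
  end.

Definition Csmooth (R : realType) (E F : normedModType R) (D : set E) (f : E -> F) :=
  forall k, Ck k D f.

Section CkTheory.
Variable R : realType.
Implicit Types E F G : normedModType R.

Lemma Ck_differentiable k E F (D : set E) (f : E -> F) x :
  Ck k D f -> D x -> differentiable f x.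
Proof. by case: k => [|k]; [move=> h|case=> h _]; apply: h. Qed.

Lemma open_fst E F (D : set E) : open D -> open [set z : (E * F)%type | D z.1].
Proof. by move=> oD; apply: (@open_comp _ _ fst) => // x _; exact: cvg_fst. Qed.

Lemma open_snd E F (D : set F) : open D -> open [set z : (E * F)%type | D z.2].
Proof. by move=> oD; apply: (@open_comp _ _ snd) => // x _; exact: cvg_snd. Qed.

Lemma Ck_ext k E F (D : set E) (f g : E -> F) : open D ->
  (forall x, D x -> f x = g x) -> Ck k D f -> Ck k D g.
Proof.
elim: k E D f g => [|k IH] E D f g oD fg; last case=> df Cf.
  move=> df x Dx; have [] := @near_eq_diff _ _ _ f g x _ (df _ Dx) => //.
  by apply: filterS (open_nbhs_nbhs (conj oD Dx)).
have H x : D x -> is_diff x g ('d f x).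
  move=> Dx; apply: near_eq_diff; last exact: df.
  by apply: filterS (open_nbhs_nbhs (conj oD Dx)).
split; first by move=> x /H[].
apply: IH Cf; first exact: open_fst.
by move=> [x v] /= Dx; have [_ ->] := H x Dx.
Qed.

Lemma Ck_sub k E F (D D' : set E) (f : E -> F) : D' `<=` D -> Ck k D f -> Ck k D' f.
Proof.
elim: k E D D' f => [|k IH] E D D' f s; first by move=> h x /s; apply: h.
case=> h C; split; first by move=> x /s; apply: h.
by apply: IH C => z /= /s.
Qed.

Lemma CkS k E F (D : set E) (f : E -> F) : Ck k.+1 D f -> Ck k D f.
Proof.
by elim: k E D f => [|k IH] E D f; [case|case=> df /IH C; split].
Qed.

Lemma Ck_linear k E F (D : set E) (f : E -> F) : linear f -> continuous f -> Ck k D f.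
Proof.
elim: k E D f => [|k IH] E D f lf cf.
  pose L : {linear E -> F} := HB.pack f (GRing.isLinear.Build R E F *:%R f lf).
  by move=> x _; exact: (@linear_differentiable _ _ _ L).
pose L : {linear E -> F} := HB.pack f (GRing.isLinear.Build R E F *:%R f lf).
split; first by move=> x _; exact: (@linear_differentiable _ _ _ L).
rewrite (_ : (fun z => _) = f \o snd); last first.
  by apply/funext => -[x v] /=; rewrite (@diff_lin _ _ _ L).
apply: IH; first by move=> a u v /=; rewrite lf.
by move=> z; apply: continuous_comp; [exact: cvg_snd|exact: cf].
Qed.

Lemma Ck_cst k E F (D : set E) (c : F) : Ck k D (cst c).
Proof.
elim: k E D c => [|k IH] E D c; first by move=> x _; exact: differentiable_cst.
split; first by move=> x _; exact: differentiable_cst.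
rewrite (_ : (fun z => _) = cst 0); first exact: IH.
by apply/funext => -[x v] /=; rewrite diff_cst.
Qed.

Lemma Ck_pair k E F G (D : set E) (f : E -> F) (g : E -> G) :
  Ck k D f -> Ck k D g -> open D -> Ck k D (fun x => (f x, g x)).
Proof.
elim: k E D f g => [|k IH] E D f g.
  by move=> df dg oD x Dx; apply: differentiable_pair; [exact: df|exact: dg].
move=> [df Cf] [dg Cg] oD; split.
  by move=> x Dx; apply: differentiable_pair; [exact: df|exact: dg].
have := IH _ _ _ _ Cf Cg (open_fst oD).
apply: Ck_ext; first exact: open_fst.
by move=> [x v] /= Dx; rewrite diff_pair //; [exact: df|exact: dg].
Qed.

Lemma Ck_fst k E F (D : set (E * F)%type) : Ck k D fst.
Proof. by apply: Ck_linear => // z; exact: cvg_fst. Qed.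

Lemma Ck_snd k E F (D : set (E * F)%type) : Ck k D snd.
Proof. by apply: Ck_linear => // z; exact: cvg_snd. Qed.

Lemma Ck_id k E (D : set E) : Ck k D id.
Proof. by apply: Ck_linear => // z; exact: cvg_id. Qed.

Lemma Ck_comp k E F G (D : set E) (D' : set F) (f : E -> F) (g : F -> G) :
  open D -> (forall x, D x -> D' (f x)) ->
  Ck k D f -> Ck k D' g -> Ck k D (g \o f).
Proof.
elim: k E F G D D' f g => [|k IH] E F G D D' f g oD fD.
  by move=> df dg x Dx; apply: differentiable_comp; [exact: df|exact/dg/fD].
move=> Cf Cg; have [df Tf] := Cf; have [dg Tg] := Cg; split.
  by move=> x Dx; apply: differentiable_comp; [exact: df|exact/dg/fD].
(* The tangent map of [f]; its base component is needed at order [k] only, hence [CkS]. *)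
have H : Ck k [set z : (E * E)%type | D z.1]
   (fun z : (E * E)%type => (f z.1, 'd f (z.1) z.2)).
  apply: Ck_pair => //; last exact: open_fst.
  apply: (IH _ _ _ _ D fst f) => //; [exact: open_fst|exact: Ck_fst|exact: CkS].
have fD' : forall z : (E * E)%type, D z.1 -> [set z : (F * F)%type | D' z.1] (f z.1, 'd f (z.1) z.2).
  by move=> z /= /fD.
have := IH _ _ _ _ _ _ _ (open_fst oD) fD' H Tg.
apply: Ck_ext; first exact: open_fst.
move=> [x v] /= Dx; rewrite (@diff_comp _ _ _ _ f g) //; [exact: df|exact/dg/fD].
Qed.

End CkTheory.

Section CkOps.
Variable R : realType.
Implicit Types E F G : normedModType R.

Lemma Ck_compl k E F G (D : set E) (l : F -> G) (f : E -> F) :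
  open D -> linear l -> continuous l -> Ck k D f -> Ck k D (fun x => l (f x)).
Proof.
move=> oD ll cl Cf; apply: (@Ck_comp _ _ _ _ _ D setT f l) => //; exact: Ck_linear.
Qed.

Lemma CkD k E F (D : set E) (f g : E -> F) : open D ->
  Ck k D f -> Ck k D g -> Ck k D (fun x => f x + g x).
Proof.
move=> oD Cf Cg.
apply: (@Ck_compl _ _ _ _ _ (fun z : F * F => z.1 + z.2) (fun x => (f x, g x))) => //.
- by move=> a u v /=; rewrite scalerDr addrACA.
- by move=> z; apply: cvgD; [exact: cvg_fst|exact: cvg_snd].
- exact: Ck_pair.
Qed.

Lemma CkZ k E F (D : set E) (f : E -> F) (c : R) : open D ->
  Ck k D f -> Ck k D (fun x => c *: f x).
Proof.
move=> oD; apply: Ck_compl => //; last exact: scaler_continuous.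
by move=> a u v; rewrite scalerDr !scalerA mulrC.
Qed.

Lemma CkN k E F (D : set E) (f : E -> F) : open D ->
  Ck k D f -> Ck k D (fun x => - f x).
Proof.
move=> oD /(CkZ (-1) oD); apply: Ck_ext => // x _; exact: scaleN1r.
Qed.

Lemma CkB k E F (D : set E) (f g : E -> F) : open D ->
  Ck k D f -> Ck k D g -> Ck k D (fun x => f x - g x).
Proof. by move=> oD Cf Cg; apply: CkD => //; exact: CkN. Qed.

Lemma Ck_scal k E F (D : set E) (f : E -> R) (c : F) : open D ->
  Ck k D f -> Ck k D (fun x => f x *: c).
Proof.
move=> oD; apply: (@Ck_compl _ _ _ _ _ (fun a : R => a *: c) f) => //; last exact: scalel_continuous.
by move=> a u v; rewrite scalerDl scalerA.
Qed.

Lemma Ck_fst_comp k E F G (D : set E) (f : E -> (F * G)%type) : open D ->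
  Ck k D f -> Ck k D (fun x => (f x).1).
Proof. by move=> oD Cf; apply: (@Ck_comp _ _ _ _ _ D setT f fst) => //; exact: Ck_fst. Qed.

Lemma Ck_snd_comp k E F G (D : set E) (f : E -> (F * G)%type) : open D ->
  Ck k D f -> Ck k D (fun x => (f x).2).
Proof. by move=> oD Cf; apply: (@Ck_comp _ _ _ _ _ D setT f snd) => //; exact: Ck_snd. Qed.

(** The differential of multiplication is again a sum of products of coordinates, so the induction
    closes on itself; products of functions then follow by composition, without a Leibniz rule at
    each order. *)
Lemma Ck_mulr k (D : set (R * R)%type) : open D ->
  Ck k D (fun z : R * R => z.1 * z.2).
Proof.
elim: k D => [|k IH] D oD; first by move=> x _; have [] := is_diff_mulr x.
split; first by move=> x _; have [] := is_diff_mulr x.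
have o2 := open_fst (F := (R * R)%type) oD.
apply: (@Ck_ext _ _ _ _ _ (fun z : (R * R) * (R * R) =>
     z.1.1 * z.2.2 + z.2.1 * z.1.2)) => //.
  by move=> [x v] /= _; have [_ ->] := is_diff_mulr x.
have [C1 C2] : Ck k [set z : (R * R) * (R * R) | D z.1] fst /\
    Ck k [set z : (R * R) * (R * R) | D z.1] snd by split; [exact: Ck_fst|exact: Ck_snd].
apply: CkD => //.
  apply: (@Ck_comp _ _ _ _ _ _ setT (fun z : (R * R) * (R * R) => (z.1.1, z.2.2))
     (fun z => z.1 * z.2)) => //; last exact: IH openT.
  by apply: Ck_pair => //; [exact: Ck_fst_comp|exact: Ck_snd_comp].
apply: (@Ck_comp _ _ _ _ _ _ setT (fun z : (R * R) * (R * R) => (z.2.1, z.1.2))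
   (fun z => z.1 * z.2)) => //; last exact: IH openT.
by apply: Ck_pair => //; [exact: Ck_fst_comp|exact: Ck_snd_comp].
Qed.

Lemma CkM k E (D : set E) (f g : E -> R) : open D ->
  Ck k D f -> Ck k D g -> Ck k D (fun x => f x * g x).
Proof.
move=> oD Cf Cg.
apply: (@Ck_comp _ _ _ _ _ D setT (fun x => (f x, g x)) (fun z => z.1 * z.2)) => //.
  exact: Ck_pair.
exact: Ck_mulr openT.
Qed.

Lemma CkX k E (D : set E) (f : E -> R) n : open D ->
  Ck k D f -> Ck k D (fun x => f x ^+ n).
Proof.
move=> oD Cf; elim: n => [|n IH]; first exact: (@Ck_cst R k E R D 1).
by apply: (Ck_ext oD _ (CkM oD Cf IH)) => x _; rewrite exprS.
Qed.

Lemma Ck_sum k E F (D : set E) (I : Type) (r : seq I) (P : pred I) (f : I -> E -> F) :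
  open D -> (forall i, Ck k D (f i)) -> Ck k D (fun x => \sum_(i <- r | P i) f i x).
Proof.
move=> oD Cf; elim: r => [|i r IH].
  by apply: (Ck_ext oD _ (Ck_cst _ _ 0)) => x _; rewrite big_nil.
have [Pi|nPi] := boolP (P i).
  by apply: (Ck_ext oD _ (CkD oD (Cf i) IH)) => x _; rewrite big_cons Pi.
by apply: (Ck_ext oD _ IH) => x _; rewrite big_cons (negbTE nPi).
Qed.

Lemma Ck_prod k E (D : set E) (I : Type) (r : seq I) (P : pred I) (f : I -> E -> R) :
  open D -> (forall i, Ck k D (f i)) -> Ck k D (fun x => \prod_(i <- r | P i) f i x).
Proof.
move=> oD Cf; elim: r => [|i r IH].
  by apply: (Ck_ext oD _ (@Ck_cst R k E R D 1)) => x _; rewrite big_nil.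
have [Pi|nPi] := boolP (P i).
  by apply: (Ck_ext oD _ (CkM oD (Cf i) IH)) => x _; rewrite big_cons Pi.
by apply: (Ck_ext oD _ IH) => x _; rewrite big_cons (negbTE nPi).
Qed.

Lemma Ck_coord k E n (D : set E) (f : E -> 'rV[R]_n) i : open D ->
  Ck k D f -> Ck k D (fun x => f x 0 i).
Proof.
move=> oD; apply: (@Ck_compl _ _ _ _ _ (fun v : 'rV[R]_n => v 0 i)) => //.
  by move=> a u v; rewrite !mxE.
exact: coord_continuous.
Qed.

Lemma Ck_row k E n (D : set E) (f : E -> 'rV[R]_n) : open D ->
  (forall i, Ck k D (fun x => f x 0 i)) -> Ck k D f.
Proof.
move=> oD Cf.
apply: (@Ck_ext _ _ _ _ _ (fun x => \sum_i f x 0 i *: delta_mx 0 i)) => //.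
  by move=> x _; rewrite -row_sum_delta.
by apply: Ck_sum => // i; exact: Ck_scal.
Qed.

Lemma Ck_derive1 k (D : set R) (f f' : R -> R) : open D ->
  (forall x, D x -> is_derive x 1 f (f' x)) -> Ck k D f' -> Ck k.+1 D f.
Proof.
move=> oD df Cf'.
have H x : D x -> differentiable f x.
  by move=> /df [? _]; apply/derivable1_diffP.
split => //.
have o2 := open_fst (F := R) oD.
apply: (@Ck_ext _ _ _ _ _ (fun z : R * R => z.2 * f' z.1)) => //.
  move=> [x v] /= Dx; rewrite diff1E; last exact: H.
  by rewrite derive1E; have [_ ->] := df _ Dx.
apply: CkM => //; first exact: Ck_snd.
by apply: (@Ck_comp _ _ _ _ _ _ D fst f') => //; exact: Ck_fst.
Qed.

Lemma Ck_expR k (D : set R) : open D -> Ck k D expR.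
Proof.
elim: k => [|k IH] oD; last by apply: (Ck_derive1 oD _ (IH oD)) => x _; exact: is_derive_expR.
by move=> x _; apply/derivable1_diffP; have [] := is_derive_expR x.
Qed.

Lemma Ck_sin_cos k (D : set R) : open D -> Ck k D sin /\ Ck k D cos.
Proof.
elim: k => [|k IH] oD.
  by split => x _; apply/derivable1_diffP; [have [] := is_derive_sin x|have [] := is_derive_cos x].
have [Cs Cc] := IH oD; split.
  by apply: (Ck_derive1 oD _ Cc) => x _; exact: is_derive_sin.
by apply: (Ck_derive1 oD _ (CkN oD Cs)) => x _; exact: is_derive_cos.
Qed.

Lemma is_derive_inv (x : R) : x != 0 -> is_derive x 1 (@GRing.inv R) (- (x^-1 ^+ 2)).
Proof.
move=> x0; have dx := differentiable_Rinv x0.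
apply: DeriveDef; first by apply/derivable1_diffP.
by rewrite deriveE// diff_Rinv//= -exprVn scaler1 ?mulNr ?scalerN.
Qed.

Lemma Ck_inv k (D : set R) : open D -> (forall x, D x -> x != 0) -> Ck k D (@GRing.inv R).
Proof.
elim: k => [|k IH] oD D0; first by move=> x /D0; exact: differentiable_Rinv.
apply: (Ck_derive1 oD _ (CkN oD (CkX 2 oD (IH oD D0)))) => x Dx.
exact/is_derive_inv/D0.
Qed.

Lemma CkV k E (D : set E) (f : E -> R) : open D -> (forall x, D x -> f x != 0) ->
  Ck k D f -> Ck k D (fun x => (f x)^-1).
Proof.
move=> oD f0 Cf.
apply: (@Ck_comp _ _ _ _ _ D [set x | x != 0] f (@GRing.inv R)) => //.
by apply: Ck_inv => //; exact: open_neq.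
Qed.

Lemma Ck_ln k (D : set R) : open D -> (forall x, D x -> 0 < x) -> Ck k D (@ln R).
Proof.
case: k => [|k] oD D0.
  by move=> x /D0 x0; apply/derivable1_diffP; have [] := is_derive1_ln x0.
apply: (@Ck_derive1 _ _ _ (@GRing.inv R)) => //; last first.
  by apply: Ck_inv => // x /D0; exact: lt0r_neq0.
by move=> x /D0; exact: is_derive1_ln.
Qed.

Lemma Ck_sqrt k (D : set R) : open D -> (forall x, D x -> 0 < x) -> Ck k D (@Num.sqrt R).
Proof.
move=> oD D0; apply: (@Ck_ext _ _ _ _ _ (fun x => expR (2^-1 *: ln x))) => //.
  move=> x /D0 x0; have e0 := expR_gt0 (2^-1 *: ln x).
  apply/eqP; rewrite -(@eqrXn2 _ 2) ?sqrtr_ge0 ?ltW// sqr_sqrtr ?ltW//.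
  by rewrite -expRM_natl -[_ *: _]/(_ * _) mulrA divff ?mul1r ?lnK// pnatr_eq0.
apply: (@Ck_comp _ _ _ _ _ D setT _ expR) => //; last exact: Ck_expR openT.
by apply: CkZ => //; exact: Ck_ln.
Qed.

Lemma Ck_atan k (D : set R) : open D -> Ck k D (@atan R).
Proof.
case: k => [|k] oD.
  by move=> x _; apply/derivable1_diffP; have [] := is_derive1_atan x.
apply: (@Ck_derive1 _ _ _ (fun x => (1 + x ^+ 2)^-1)) => //.
apply: CkV => //; first by move=> x _; rewrite lt0r_neq0// ltr_wpDr ?sqr_ge0.
by apply: CkD => //; [exact: (@Ck_cst R k R R D 1)|apply: CkX => //; exact: Ck_id].
Qed.

Lemma Csmooth_derive E F (D : set E) (f : E -> F) v : open D ->
  Csmooth D f -> Csmooth D ('D_v f).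
Proof.
move=> oD Cf k; have [df Tf] := Cf k.+1.
have /(Ck_ext oD) : forall x, D x -> 'd f x v = 'D_v f x.
  by move=> x /df fx; rewrite deriveE.
apply.
apply: (@Ck_comp _ _ _ _ _ D _ (fun x => (x, v)) _ oD _ _ Tf) => //.
by apply: Ck_pair => //; [exact: Ck_id|exact: Ck_cst].
Qed.

(** The bridge to the smoothness of the statement: a directional derivative is the tangent map
    evaluated along a constant section, so all iterated ones stay in the class. *)
Lemma Csmooth_smooth_on E F (D : set E) (f : E -> F) : open D ->
  Csmooth D f -> @smooth_on R E F D f.
Proof.
move=> oD Cf vs x Dx.
suff H : Csmooth D (iter_derive vs f) by exact: (Ck_differentiable (H 0) Dx).
by elim: vs => [|v vs IH] //=; exact: Csmooth_derive.
Qed.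

Lemma Ck_local k E F (D : set E) (f : E -> F) :
  (forall x, D x -> exists U g, [/\ open U, U x, Ck k U g & forall y, U y -> g y = f y]) ->
  Ck k D f.
Proof.
elim: k E D f => [|k IH] E D f H.
  move=> x /H [U [g [oU Ux Cg gf]]].
  exact: (Ck_differentiable (Ck_ext oU gf Cg) Ux).
split.
  move=> x /H [U [g [oU Ux Cg gf]]].
  exact: (Ck_differentiable (Ck_ext oU gf Cg) Ux).
apply: IH => -[x v] /= /H [U [g [oU Ux Cg gf]]].
have [_ Tf] := Ck_ext oU gf Cg.
by exists [set z | U z.1], (fun z => 'd f (z.1) z.2); split => //; exact: open_fst.
Qed.

End CkOps.

(** * Integration and the Goursat lemma *)

Section Integral.
Variable R : realType.

Lemma is_derive_quad (a b x : R) : is_derive x 1 (fun y => a * y + b / 2 * (y * y)) (a + b * x).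
Proof.
have d1 := is_deriveZ a (is_derive_id x 1).
have d2 := is_deriveZ (b / 2) (is_deriveM (is_derive_id x 1) (is_derive_id x 1)).
apply: (is_derive_eq (is_deriveD d1 d2)).
by rewrite /GRing.scale /= !mulr1; field.
Qed.

Lemma antiderivative_exists (g : R -> R) (a b : R) : continuous g ->
  exists F : R -> R, forall x, a <= x <= b -> is_derive x 1 F (g x).
Proof.
(* Starting at [a - 1], and ending at [b + 1] below, makes [a] and [b] interior points, so the
   derivative is two-sided at both. *)
move=> cg; pose F := fun x => (\int[@lebesgue_measure R]_(t in `[a - 1, x]) g t)%R.
exists F => x /andP[ax xb].
have [//|||//|dF F'] := @continuous_FTC1_closed R g (a - 1) x (b + 1).
- by rewrite (le_lt_trans xb)// ltrDl.
- apply: continuous_compact_integrable; first exact: segment_compact.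
  exact: continuous_subspaceT.
- by rewrite (lt_le_trans _ ax)// ltrBlDr ltrDl.
- exact: cg.
- exact: (DeriveDef dF (etrans (esym (derive1E F x)) F')).
Qed.

(** The integral as the increment of a chosen antiderivative: estimates reduce to the mean value
    theorem, with no integrability conditions to carry. When no antiderivative exists, [get] returns
    a default and the value is meaningless. *)
Definition prim_int (a b : R) (g : R -> R) : R :=
  let F := get (fun F : R -> R => forall x, a <= x <= b -> is_derive x 1 F (g x)) in
  F b - F a.

(** The workhorse for all integral estimates: compare with an explicit antiderivative [G] of a
    nearby function, through the mean value theorem for the difference of the two
    antiderivatives. *)
Lemma prim_int_approx (a b M : R) (g G g' : R -> R) : a <= b -> continuous g ->
  (forall x, a <= x <= b -> is_derive x 1 G (g' x)) ->
  (forall x, a <= x <= b -> `|g x - g' x| <= M) ->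
  `|prim_int a b g - (G b - G a)| <= M * (b - a).
Proof.
move=> ab cg dG gM; rewrite /prim_int.
set F := get _.
have dF : forall x, a <= x <= b -> is_derive x 1 F (g x).
  by have := antiderivative_exists a b cg; exact: getPex.
have dFG x : a <= x <= b -> is_derive x 1 (F - G) (g x - g' x).
  by move=> xab; exact: (is_deriveB (dF _ xab) (dG _ xab)).
have [||c cab] := @MVT_segment R (F - G) (fun x => g x - g' x) a b ab.
- by move=> x /itvP xab; apply: dFG; rewrite !xab.
- apply: derivable_within_continuous => x; rewrite in_itv /= => xab.
  by have [] := dFG x xab.
rewrite (_ : F b - F a - _ = (F - G) b - (F - G) a); last first.
  by transitivity ((F b - G b) - (F a - G a)); [ring|].
move=> ->; rewrite normrM [X in _ * X]ger0_norm ?subr_ge0//.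
by apply: ler_wpM2r; rewrite ?subr_ge0// gM//; move: cab; rewrite in_itv.
Qed.

Lemma prim_int_unique (a b : R) (g G : R -> R) : a <= b -> continuous g ->
  (forall x, a <= x <= b -> is_derive x 1 G (g x)) -> prim_int a b g = G b - G a.
Proof.
move=> ab cg dG; apply/eqP; rewrite -subr_eq0 -normr_le0.
rewrite -(mul0r (b - a)); apply: (prim_int_approx ab cg dG) => x _.
by rewrite subrr normr0.
Qed.

Lemma prim_int_bound (a b M : R) (g : R -> R) : a <= b -> continuous g ->
  (forall x, a <= x <= b -> `|g x| <= M) -> `|prim_int a b g| <= M * (b - a).
Proof.
move=> ab cg gM; rewrite -[prim_int _ _ _]subr0 -[X in _ - X](subrr (0:R)).
apply: (@prim_int_approx _ _ _ _ (cst 0) (cst 0)) => //.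
by move=> x /gM; rewrite subr0.
Qed.

Lemma prim_int_linear (a b k : R) (g h : R -> R) : a <= b -> continuous g -> continuous h ->
  prim_int a b (fun x => k * g x + h x) = k * prim_int a b g + prim_int a b h.
Proof.
move=> ab cg ch.
have [F dF] := antiderivative_exists a b cg.
have [G dG] := antiderivative_exists a b ch.
rewrite (prim_int_unique ab cg dF) (prim_int_unique ab ch dG).
have d x : a <= x <= b -> is_derive x 1 (fun x => k * F x + G x) (k * g x + h x).
  by move=> xab; exact: (is_deriveD (is_deriveZ k (dF _ xab)) (dG _ xab)).
rewrite (prim_int_unique ab _ d); first by ring.
by move=> x; apply: cvgD; [apply: cvgMr; exact: cg|exact: ch].
Qed.

Lemma prim_int_cst (a b k : R) : a <= b -> prim_int a b (cst k) = k * (b - a).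
Proof.
move=> ab.
have d x : a <= x <= b -> is_derive x 1 (fun x => k * x) (cst k x).
  by move=> _; have := is_deriveZ k (is_derive_id x 1); rewrite /GRing.scale /= mulr1.
by rewrite (prim_int_unique ab _ d) ?mulrBr// => x; exact: cvg_cst.
Qed.

Lemma prim_intZ (a b k : R) (g : R -> R) : a <= b -> continuous g ->
  prim_int a b (fun x => k * g x) = k * prim_int a b g.
Proof.
move=> ab cg.
have c0 : continuous (cst 0 : R -> R) by move=> x; exact: cvg_cst.
transitivity (prim_int a b (fun x => k * g x + cst 0 x)).
  by congr prim_int; apply/funext => x; rewrite addr0.
by rewrite prim_int_linear// prim_int_cst// mul0r addr0.
Qed.

Lemma prim_intB (a b : R) (g h : R -> R) : a <= b -> continuous g -> continuous h ->
  prim_int a b (fun x => g x - h x) = prim_int a b g - prim_int a b h.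
Proof.
move=> ab cg ch; rewrite addrC -mulN1r -prim_int_linear //.
by congr prim_int; apply/funext => x; rewrite mulN1r addrC.
Qed.

Lemma prim_int_chasles (a b c : R) (g : R -> R) : a <= b -> b <= c -> continuous g ->
  prim_int a c g = prim_int a b g + prim_int b c g.
Proof.
move=> ab bc cg; have [F dF] := antiderivative_exists a c cg.
rewrite (prim_int_unique (le_trans ab bc) cg dF).
have d1 x : a <= x <= b -> is_derive x 1 F (g x).
  by move=> /andP[ax xb]; apply: dF; rewrite ax (le_trans xb).
have d2 x : b <= x <= c -> is_derive x 1 F (g x).
  by move=> /andP[bx xc]; apply: dF; rewrite xc (le_trans ab).
by rewrite (prim_int_unique ab cg d1) (prim_int_unique bc cg d2); ring.
Qed.

Lemma cvg_prod_pair (T : Type) (U V : topologicalType) (F : set_system T) (f : T -> U)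
    (g : T -> V) (a : U) (b : V) : Filter F ->
  f @ F --> a -> g @ F --> b -> (f x, g x) @[x --> F] --> (a, b).
Proof.
by move=> FF fa gb; exact: (cvg_pair fa gb).
Qed.

(** The circulation of the form P dx + Q dy along the boundary of the rectangle [a, b] x [c, d],
    counterclockwise. *)
Definition boundary_int (P Q : R * R -> R) (a b c d : R) : R :=
  prim_int a b (fun x => P (x, c)) + prim_int c d (fun y => Q (b, y))
  - prim_int a b (fun x => P (x, d)) - prim_int c d (fun y => Q (a, y)).

Lemma continuous_slicel (P : R * R -> R) c : continuous P -> continuous (fun x => P (x, c)).
Proof.
move=> cP x; apply: (@continuous_comp _ _ _ (fun x => (x, c)) P); last exact: cP.
by apply: cvg_prod_pair; [exact: cvg_id|exact: cvg_cst].
Qed.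

Lemma continuous_slicer (P : R * R -> R) c : continuous P -> continuous (fun y => P (c, y)).
Proof.
move=> cP x; apply: (@continuous_comp _ _ _ (fun x => (c, x)) P); last exact: cP.
by apply: cvg_prod_pair; [exact: cvg_cst|exact: cvg_id].
Qed.

Lemma boundary_int_split (P Q : R * R -> R) (a m b c n d : R) :
  a <= m <= b -> c <= n <= d -> continuous P -> continuous Q ->
  boundary_int P Q a b c d = boundary_int P Q a m c n + boundary_int P Q m b c n +
    boundary_int P Q a m n d + boundary_int P Q m b n d.
Proof.
move=> /andP[am mb] /andP[cn nd] cP cQ; rewrite /boundary_int.
have cPx y := @continuous_slicel P y cP; have cQx y := @continuous_slicer Q y cQ.
rewrite (prim_int_chasles am mb (cPx c)) (prim_int_chasles am mb (cPx d)).
rewrite (prim_int_chasles cn nd (cQx a)) (prim_int_chasles cn nd (cQx b)).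
ring.
Qed.

(** An affine form whose two cross coefficients agree (both are [k]) is exact, so its circulation
    vanishes and only the errors on the four sides remain. *)
Lemma boundary_int_affine_approx (P Q : R * R -> R) (a b c d p px k q qy M : R) :
  a <= b -> c <= d -> continuous P -> continuous Q ->
  (forall x y, a <= x <= b -> c <= y <= d ->
     `|P (x, y) - (p + px * x + k * y)| <= M /\ `|Q (x, y) - (q + k * x + qy * y)| <= M) ->
  `|boundary_int P Q a b c d| <= 2 * M * ((b - a) + (d - c)).
Proof.
move=> ab cd cP cQ H.
pose G (u v : R) (t : R) := u * t + v / 2 * (t * t).
have HP y : c <= y <= d -> `|prim_int a b (fun x => P (x, y)) - (G (p + k * y) px b - G (p + k * y) px a)| <= M * (b - a).
  move=> ycd; apply: (@prim_int_approx _ _ _ _ _ (fun x => (p + k * y) + px * x)) => //.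
  - exact: continuous_slicel.
  - by move=> x _; exact: is_derive_quad.
  - move=> x xab; have [+ _] := H x y xab ycd; congr (`| _ - _| <= _); ring.
have HQ x : a <= x <= b -> `|prim_int c d (fun y => Q (x, y)) - (G (q + k * x) qy d - G (q + k * x) qy c)| <= M * (d - c).
  move=> xab; apply: (@prim_int_approx _ _ _ _ _ (fun y => (q + k * x) + qy * y)) => //.
  - exact: continuous_slicer.
  - by move=> y _; exact: is_derive_quad.
  - move=> y ycd; have [_ +] := H x y xab ycd; congr (`| _ - _| <= _); ring.
have c1 : c <= c <= d by rewrite lexx.
have c2 : c <= d <= d by rewrite lexx cd.
have a1 : a <= a <= b by rewrite lexx.
have a2 : a <= b <= b by rewrite lexx ab.
move: (HP c c1) (HP d c2) (HQ a a1) (HQ b a2).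
rewrite /boundary_int.
set I1 := prim_int _ _ _; set I2 := prim_int _ _ _; set I3 := prim_int _ _ _; set I4 := prim_int _ _ _.
rewrite !ler_norml /G => /andP[h1 h2] /andP[h3 h4] /andP[h5 h6] /andP[h7 h8].
apply/andP; split; lra.
Qed.

(** By the triangle inequality one of the four quarters carries at least a quarter of the
    circulation. A rectangle is encoded by its lower left corner and a scale [s], which keeps all
    rectangles of the bisection similar. *)
Lemma boundary_int_quarter (P Q : R * R -> R) (L L' s : R) (z : R * R) :
  continuous P -> continuous Q -> 0 <= L -> 0 <= L' -> 0 <= s ->
  let I (z : R * R) s := boundary_int P Q z.1 (z.1 + s * L) z.2 (z.2 + s * L') in
  exists z', [/\ z.1 <= z'.1, z'.1 + s / 2 * L <= z.1 + s * L,
    z.2 <= z'.2, z'.2 + s / 2 * L' <= z.2 + s * L' & `|I z s| <= 4 * `|I z' (s / 2)| ].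
Proof.
move=> cP cQ L0 L0' s0 I.
have sL : 0 <= s / 2 * L by rewrite mulr_ge0// divr_ge0.
have sL' : 0 <= s / 2 * L' by rewrite mulr_ge0// divr_ge0.
have hL : s * L = s / 2 * L + s / 2 * L by field.
have hL' : s * L' = s / 2 * L' + s / 2 * L' by field.
pose z1 := z; pose z2 := (z.1 + s / 2 * L, z.2).
pose z3 := (z.1, z.2 + s / 2 * L'); pose z4 := (z.1 + s / 2 * L, z.2 + s / 2 * L').
have E : I z s = I z1 (s / 2) + I z2 (s / 2) + I z3 (s / 2) + I z4 (s / 2).
  rewrite /I /z1 /z2 /z3 /z4 /= (@boundary_int_split _ _ _ (z.1 + s / 2 * L) _ _ (z.2 + s / 2 * L')) //.
  - by rewrite hL hL' !addrA.
  - by rewrite hL addrA !lerDl !sL.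
  - by rewrite hL' addrA !lerDl !sL'.
have tri : `|I z s| <= `|I z1 (s / 2)| + `|I z2 (s / 2)| + `|I z3 (s / 2)| + `|I z4 (s / 2)|.
  rewrite E; apply: (le_trans (ler_normD _ _)); apply: lerD => //.
  apply: (le_trans (ler_normD _ _)); apply: lerD => //; exact: ler_normD.
have [h1|h1] := leP `|I z s| (4 * `|I z1 (s / 2)|).
  by exists z1; split => //; rewrite /= ?hL ?hL'; lra.
have [h2|h2] := leP `|I z s| (4 * `|I z2 (s / 2)|).
  by exists z2; split => //; rewrite /= ?hL ?hL'; lra.
have [h3|h3] := leP `|I z s| (4 * `|I z3 (s / 2)|).
  by exists z3; split => //; rewrite /= ?hL ?hL'; lra.
exists z4; split => //; rewrite /= ?hL ?hL'; try lra.
Qed.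

End Integral.

Section Curves.
Variable R : realType.
Implicit Types E F : normedModType R.

Lemma is_derive_diff E (f : R -> E) (x : R) (l : E) : is_derive x 1 f l ->
  is_diff x f (fun v => v *: l).
Proof.
move=> [d e]; have df : differentiable f x by apply/derivable1_diffP.
by apply: DiffDef => //; rewrite diff1E // derive1E e.
Qed.

Lemma is_diff_derive E F (f : E -> F) x v l : differentiable f x -> 'd f x v = l ->
  is_derive x v f l.
Proof.
move=> df <-; apply: DeriveDef; first exact: diff_derivable.
by rewrite deriveE.
Qed.

Lemma is_derive_comp_curve E F (c : R -> E) (f : E -> F) (t : R) (v : E) :
  is_derive t 1 c v -> differentiable f (c t) -> is_derive t 1 (fun t => f (c t)) ('d f (c t) v).
Proof.
move=> /is_derive_diff [dc cv] df; apply: is_diff_derive.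
  by apply: (@differentiable_comp _ _ _ _ c f).
by rewrite (@diff_comp _ _ _ _ c f) //= cv scale1r.
Qed.

Lemma is_derive_pair_curve E F (c : R -> E) (d : R -> F) (t : R) v w :
  is_derive t 1 c v -> is_derive t 1 d w -> is_derive t 1 (fun t => (c t, d t)) (v, w).
Proof.
move=> /is_derive_diff [dc cv] /is_derive_diff [dd dv]; apply: is_diff_derive.
  exact: differentiable_pair.
by rewrite diff_pair //= cv dv !scale1r.
Qed.

Lemma is_derive_slicer (P : R * R -> R) z : differentiable P z ->
  is_derive z.2 1 (fun y => P (z.1, y)) ('d P z (0, 1)).
Proof.
case: z => x y /= dP.
apply: (@is_derive_comp_curve (R * R)%type R (fun y => (x, y)) P y (0, 1)) => //.
exact: is_derive_pair_curve.
Qed.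

Lemma is_derive_slicel (P : R * R -> R) z : differentiable P z ->
  is_derive z.1 1 (fun x => P (x, z.2)) ('d P z (1, 0)).
Proof.
case: z => x y /= dP.
apply: (@is_derive_comp_curve (R * R)%type R (fun x => (x, y)) P x (1, 0)) => //.
exact: is_derive_pair_curve.
Qed.

Lemma dist_in_interval (u v w a : R) : u <= v -> v <= u + a -> u <= w -> w <= u + a ->
  `|v - w| <= a.
Proof. by move=> *; rewrite ler_norml; apply/andP; split; lra. Qed.

Lemma nested_intervals (x y : nat -> R) : (forall n, x n <= x n.+1) ->
  (forall n, y n.+1 <= y n) -> (forall n, x n <= y n) ->
  exists l, forall n, x n <= l <= y n.
Proof.
move=> xi yd xy.
have xm m n : (m <= n)%N -> x m <= x n.
  by move=> /subnK <-; elim: (n - m)%N => // k IH; rewrite addSn (le_trans IH).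
have ym m n : (m <= n)%N -> y n <= y m.
  by move=> /subnK <-; elim: (n - m)%N => // k IH; rewrite addSn (le_trans _ IH).
have xyn m n : x m <= y n.
  have [mn|/ltnW nm] := leqP m n; first exact: le_trans (xm _ _ mn) (xy n).
  exact: le_trans (xy m) (ym _ _ nm).
have hs : has_sup (range x).
  by split; [exists (x 0), 0|exists (y 0) => _ [n _ <-]].
exists (sup (range x)) => n; apply/andP; split.
  by apply: ub_le_sup; [exact: hs.2|exists n].
by apply: ge_sup; [exact: hs.1|move=> _ [m _ <-]].
Qed.

(** Bisection: the rectangles shrink to a point where both functions are differentiable. The affine
    parts there form a closed form because the cross derivatives agree, and the remaining error is a
    small multiple of the squared scale, which compensates the factor [4 ^+ n]. Plain
    differentiability suffices, which matters since nothing is known yet about the derivatives of a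
    holomorphic map. *)
Lemma goursat (P Q : R * R -> R) (B a b c d : R) : continuous P -> continuous Q ->
  (forall z, z.1 < B -> [/\ differentiable P z, differentiable Q z &
     exists k, is_derive z.2 1 (fun y => P (z.1, y)) k /\
               is_derive z.1 1 (fun x => Q (x, z.2)) k]) ->
  a <= b -> b < B -> c <= d -> boundary_int P Q a b c d = 0.
Proof.
move=> cP cQ H ab bB cd.
pose L := b - a; pose L' := d - c.
have L0 : 0 <= L by rewrite subr_ge0.
have L0' : 0 <= L' by rewrite subr_ge0.
pose I (z : R * R) s := boundary_int P Q z.1 (z.1 + s * L) z.2 (z.2 + s * L').
pose s n : R := 2^-1 ^+ n.
have s0 n : 0 <= s n by rewrite exprn_ge0.
have sS n : s n.+1 = s n / 2 by rewrite /s exprSr.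
have /choice[st Hst] : forall x : (R * R) * nat, exists z', [/\ x.1.1 <= z'.1,
    z'.1 + s x.2 / 2 * L <= x.1.1 + s x.2 * L, x.1.2 <= z'.2,
    z'.2 + s x.2 / 2 * L' <= x.1.2 + s x.2 * L' &
    `|I x.1 (s x.2)| <= 4 * `|I z' (s x.2 / 2)| ].
  by move=> [z n]; exact: boundary_int_quarter.
pose u := fix u n := if n is m.+1 then st (u m, m) else (a, c).
have u1 n : (u n).1 <= (u n.+1).1 by have [] := Hst (u n, n).
have u2 n : (u n).2 <= (u n.+1).2 by have [] := Hst (u n, n).
have v1 n : (u n.+1).1 + s n.+1 * L <= (u n).1 + s n * L.
  by rewrite sS; have [] := Hst (u n, n).
have v2 n : (u n.+1).2 + s n.+1 * L' <= (u n).2 + s n * L'.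
  by rewrite sS; have [] := Hst (u n, n).
have [x0 Hx] : exists l, forall n, (u n).1 <= l <= (u n).1 + s n * L.
  by apply: nested_intervals => // n; rewrite lerDl mulr_ge0.
have [y0 Hy] : exists l, forall n, (u n).2 <= l <= (u n).2 + s n * L'.
  by apply: nested_intervals => // n; rewrite lerDl mulr_ge0.
have Iu n : `|I (a, c) 1| <= 4 ^+ n * `|I (u n) (s n)|.
  elim: n => [|n IH]; first by rewrite mul1r /s expr0.
  rewrite (le_trans IH)// exprSr -mulrA ler_wpM2l ?exprn_ge0//.
  by rewrite sS; have [] := Hst (u n, n).
have -> : boundary_int P Q a b c d = I (a, c) 1.
  by rewrite /I /= !mul1r /L /L' !(addrC _ (_ - _)) !subrK.
apply/eqP; rewrite -normr_le0 leNgt; apply/negP => k0.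
set kap := `|I _ _| in k0 Iu.
pose W2 := (L + L') ^+ 2.
have W20 : 0 <= W2 by rewrite sqr_ge0.
(* Chosen so that the final bound [2 * e * W2] falls below [kap]; the [+ 1] covers a degenerate
   rectangle. *)
pose e := kap / (4 * (W2 + 1)).
have e0 : 0 < e by rewrite divr_gt0// mulr_gt0// ltr_wpDl.
have x0B : x0 < B.
  rewrite (le_lt_trans _ bB)//; have /andP[_] := Hx 0%N.
  by rewrite /= /s expr0 mul1r /L addrC subrK.
have [dP dQ [k [Pk Qk]]] := H (x0, y0) x0B.
have Pk' : 'd P (x0, y0) (0, 1) = k.
  by have [_ <-] := is_derive_slicer dP; have [_ <-] := Pk.
have Qk' : 'd Q (x0, y0) (1, 0) = k.
  by have [_ <-] := is_derive_slicel dQ; have [_ <-] := Qk.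
have [del1 del10 HP] := diff_eps_delta dP e0.
have [del2 del20 HQ] := diff_eps_delta dQ e0.
pose del := Num.min del1 del2.
have del0 : 0 < del by rewrite lt_min del10.
have [n sn] : exists n, s n * (L + L') < del.
  have /cvgrPdist_lt/(_ del del0) : (fun n => s n * (L + L')) @ \oo --> (0 : R).
    rewrite -[X in _ --> X](mul0r (L + L')); apply: cvgMl; apply: cvg_expr.
    by rewrite ger0_norm// invf_lt1// ltr1n.
  case=> n _ /(_ n (leqnn n)) /=; rewrite sub0r normrN ger0_norm; first by exists n.
  by rewrite mulr_ge0// addr_ge0.
have lin (f : {linear (R * R)%type -> R}) h1 h2 : f (h1, h2) = h1 * f (1, 0) + h2 * f (0, 1).
  have -> : (h1, h2) = h1 *: (1, 0) + h2 *: (0, 1) :> (R * R)%type.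
    by congr pair => /=; rewrite /GRing.scale /= !(mulr0, mulr1, addr0, add0r).
  by rewrite linearD !linearZ.
pose M := e * (s n * (L + L')).
have approx : `|I (u n) (s n)| <= 2 * M * (s n * L + s n * L').
  have [px Hpx] : exists px, forall h1 h2, 'd P (x0, y0) (h1, h2) = h1 * px + h2 * k.
    by exists ('d P (x0, y0) (1, 0)) => h1 h2; rewrite lin Pk'.
  have [qy Hqy] : exists qy, forall h1 h2, 'd Q (x0, y0) (h1, h2) = h1 * k + h2 * qy.
    by exists ('d Q (x0, y0) (0, 1)) => h1 h2; rewrite lin Qk'.
  have := @boundary_int_affine_approx _ P Q (u n).1 ((u n).1 + s n * L) (u n).2 ((u n).2 + s n * L')
     (P (x0, y0) - px * x0 - k * y0) px k (Q (x0, y0) - k * x0 - qy * y0) qy M.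
  have -> : (u n).1 + s n * L - (u n).1 = s n * L by ring.
  have -> : (u n).2 + s n * L' - (u n).2 = s n * L' by ring.
  apply => //.
  - by rewrite lerDl mulr_ge0.
  - by rewrite lerDl mulr_ge0.
  move=> x y /andP[xl xr] /andP[yl yr].
  have /andP[xl' xr'] := Hx n; have /andP[yl' yr'] := Hy n.
  have hn : `|(x - x0, y - y0)| <= s n * (L + L').
    have sl := mulr_ge0 (s0 n) L0; have sl' := mulr_ge0 (s0 n) L0'.
    rewrite prod_normE /= ge_max mulrDr; apply/andP; split.
      by apply: le_trans (dist_in_interval xl xr xl' xr') _; rewrite lerDl.
    by apply: le_trans (dist_in_interval yl yr yl' yr') _; rewrite lerDr.
  have /andP[hn1 hn2] : (`|(x - x0, y - y0)| < del1) && (`|(x - x0, y - y0)| < del2).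
    by rewrite -lt_min (le_lt_trans hn).
  have h1 : `|P (x, y) - P (x0, y0) - ((x - x0) * px + (y - y0) * k)| <= e * `|(x - x0, y - y0)|.
    by rewrite -Hpx; exact: HP.
  have h2 : `|Q (x, y) - Q (x0, y0) - ((x - x0) * k + (y - y0) * qy)| <= e * `|(x - x0, y - y0)|.
    by rewrite -Hqy; exact: HQ.
  have hM : e * `|(x - x0, y - y0)| <= M by rewrite ler_pM2l.
  split; [apply: le_trans (le_trans h1 hM)|apply: le_trans (le_trans h2 hM)];
    by rewrite le_eqVlt; apply/orP; left; apply/eqP; congr `| _ |; ring.
have : kap <= 2 * e * W2.
  apply: (le_trans (Iu n)).
  apply: (le_trans (ler_wpM2l (exprn_ge0 n (ler0n R 4)) approx)).
  rewrite le_eqVlt; apply/orP; left; apply/eqP.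
  rewrite /M /W2 -mulrDr.
  have -> : 4 ^+ n = (s n ^+ 2)^-1.
    rewrite /s -exprM mulnC exprM -exprVn; congr (_ ^+ n).
    by rewrite exprVn invrK expr2 -natrM.
  have : s n != 0 by rewrite /s expf_neq0.
  by move=> sn0; field.
apply/negP; rewrite -ltNge.
have -> : 2 * e * W2 = kap * (W2 / (2 * (W2 + 1))).
  rewrite /e; field; rewrite gt_eqF//; lra.
rewrite gtr_pMr// ltr_pdivrMr; lra.
Qed.

End Curves.

(** * Integrals of holomorphic functions over concentric circles *)

Section Circle.
Variable R : realType.

(** When [P] takes the same values on the two horizontal sides, their contributions cancel and the
    circulation compares the two vertical sides. *)
Lemma goursat_period (P Q : R * R -> R) (B a b c d : R) :
  (forall z, z.1 < B -> [/\ differentiable P z, differentiable Q z &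
     exists k, is_derive z.2 1 (fun y => P (z.1, y)) k /\
               is_derive z.1 1 (fun x => Q (x, z.2)) k]) ->
  (forall x, P (x, c) = P (x, d)) ->
  a <= b -> b < B -> c <= d -> prim_int c d (fun y => Q (b, y)) = prim_int c d (fun y => Q (a, y)).
Proof.
move=> H per ab bB cd.
(* [goursat] wants continuity on the whole plane. Clamping the first coordinate at [B1], strictly
   between [b] and [B], provides it and changes nothing to the left of [B1]. *)
pose B1 := (b + B) / 2.
have bB1 : b < B1 by rewrite /B1 ltr_pdivlMr// mulrDr mulr1 ltrD2l.
have B1B : B1 < B by rewrite /B1 ltr_pdivrMr// mulrDr mulr1 ltrD2r.
pose cl (z : (R * R)%type) : (R * R)%type := (Num.min z.1 B1, z.2).
have ccl : continuous cl.
  move=> z; apply: cvg_prod_pair; last exact: cvg_snd.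
  have := @min_continuous _ R (z.1, B1) => mc.
  apply: (@continuous_comp _ _ _ (fun z : (R * R)%type => (z.1, B1)) (fun p => Num.min p.1 p.2) z) => //.
  by apply: cvg_prod_pair; [exact: cvg_fst|exact: cvg_cst].
have clB z : (cl z).1 < B by rewrite /= gt_min B1B orbT.
have cont (f : (R * R)%type -> R) : (forall z : (R * R)%type, z.1 < B -> differentiable f z) ->
    continuous (fun z => f (cl z)).
  move=> df z; apply: (@continuous_comp _ _ _ cl f z); first exact: ccl.
  by apply: differentiable_continuous; exact/df/clB.
have cP : continuous (fun z => P (cl z)) by apply: cont => z /H[].
have cQ : continuous (fun z => Q (cl z)) by apply: cont => z /H[].
have cle z : z.1 < B1 -> cl z = z by case: z => x y /= zB; rewrite /cl /= min_l// ltW.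
have oB : open [set z : (R * R)%type | z.1 < B1].
  by apply: (@open_fst R R R [set x | x < B1]); exact: open_lt.
have E1 x : a <= x <= b -> cl (x, c) = (x, c) /\ cl (x, d) = (x, d).
  by move=> /andP[_ xb]; split; apply: cle; exact: le_lt_trans bB1.
have H' z : z.1 < B1 -> [/\ differentiable (fun z => P (cl z)) z,
    differentiable (fun z => Q (cl z)) z &
    exists k, is_derive z.2 1 (fun y => P (cl (z.1, y))) k /\
              is_derive z.1 1 (fun x => Q (cl (x, z.2))) k].
  move=> zB1.
  have zB : z.1 < B by exact: lt_trans B1B.
  have [dP dQ [k [Pk Qk]]] := H z zB.
  have nz : \near z, cl z = z.
    by apply: filterS (open_nbhs_nbhs (conj oB zB1)) => y /cle.
  split.
  - have [] // := @near_eq_diff _ _ _ P (fun z => P (cl z)) z _ dP.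
    by apply: filterS nz => y /= ->.
  - have [] // := @near_eq_diff _ _ _ Q (fun z => Q (cl z)) z _ dQ.
    by apply: filterS nz => y /= ->.
  exists k; split.
    rewrite (_ : (fun y => _) = fun y => P (z.1, y)) //.
    by apply/funext => y; rewrite cle.
  apply: (near_eq_is_derive _ Qk).
  have : \forall x \near z.1, x < B1.
    apply: (@open_nbhs_nbhs _ z.1 [set x | x < B1]); split => //; exact: open_lt.
  by apply: filterS => x xB1; rewrite cle.
have := @goursat R _ _ B1 a b c d cP cQ H' ab bB1 cd.
rewrite /boundary_int.
rewrite (_ : prim_int a b (fun x => P (cl (x, c))) = prim_int a b (fun x => P (cl (x, d)))); last first.
  by congr prim_int; apply/funext => x; rewrite /cl /=; exact: per.
rewrite (_ : (fun y => Q (cl (b, y))) = fun y => Q (b, y)); last first.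
  by apply/funext => y; rewrite cle.
rewrite (_ : (fun y => Q (cl (a, y))) = fun y => Q (a, y)); last first.
  by apply/funext => y; rewrite cle//; exact: le_lt_trans bB1.
by rewrite [X in X - _ - _]addrC addrK => /eqP; rewrite subr_eq0 => /eqP.
Qed.

(* The value of the differential at [h] is that of the complex number
   [(a - i b) h]. *)
Definition CR_at (p q : R * R -> R) z := exists a b,
  is_diff z p (fun h : R * R => h.1 * a + h.2 * b) /\
  is_diff z q (fun h : R * R => h.2 * a - h.1 * b).

Lemma CR_at_diff p q z : CR_at p q z -> differentiable p z /\ differentiable q z.
Proof. by move=> [a [b [[? _] [? _]]]]. Qed.

Definition circle (r t : R) : R * R := (r * cos t, r * sin t).

Lemma is_derive_circler (r t : R) : is_derive t 1 (circle r) (- (r * sin t), r * cos t).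
Proof.
apply: is_derive_pair_curve.
  by apply: (is_derive_eq (is_deriveZ r (is_derive_cos t))); rewrite /GRing.scale /= mulrN.
Qed.

Lemma is_derive_circlel (r t : R) : is_derive r 1 (circle ^~ t) (cos t, sin t).
Proof.
apply: is_derive_pair_curve.
  have H := is_deriveM (is_derive_id r 1) (is_derive_cst (cos t) r 1).
  by apply: (is_derive_eq H); rewrite /GRing.scale /= mulr0 add0r mulr1.
have H := is_deriveM (is_derive_id r 1) (is_derive_cst (sin t) r 1).
by apply: (is_derive_eq H); rewrite /GRing.scale /= mulr0 add0r mulr1.
Qed.

(** In the coordinates (x, t) with point e^x (cos t, sin t), circles become vertical segments and
    functions become periodic in t. With f = p + i q, the two equalities express that the imaginary
    parts of f dz / z and of f dz / z^2 are closed away from 0. *)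
Lemma circle_int_const (p q : R * R -> R) (rho r1 r2 : R) :
  (forall r t, 0 < r < rho -> CR_at p q (circle r t)) -> 0 < r1 -> r1 <= r2 -> r2 < rho ->
  prim_int 0 (2 * pi) (fun t => p (circle r2 t)) = prim_int 0 (2 * pi) (fun t => p (circle r1 t)) /\
  prim_int 0 (2 * pi) (fun t => p (circle r2 t) * cos t + q (circle r2 t) * sin t) / r2 =
  prim_int 0 (2 * pi) (fun t => p (circle r1 t) * cos t + q (circle r1 t) * sin t) / r1.
Proof.
move=> H r10 r12 r2r; have r20 := lt_le_trans r10 r12; have rho0 := lt_trans r20 r2r.
pose E (z : R * R) := circle (expR z.1) z.2.
have dE : Ck 0 setT E.
  have [C1 C2] := @Ck_sin_cos R 0 setT openT.
  have Ce : Ck 0 setT (fun z : (R * R)%type => expR z.1).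
    apply: (@Ck_comp _ _ _ _ _ setT setT fst expR) => //; first exact: openT.
      exact: Ck_fst.
    exact: Ck_expR openT.
  apply: Ck_pair; last exact: openT; apply: CkM => //; try exact: openT.
    apply: (@Ck_comp _ _ _ _ _ setT setT snd (@cos R)) => //; first exact: openT.
    exact: Ck_snd.
  apply: (@Ck_comp _ _ _ _ _ setT setT snd (@sin R)) => //; first exact: openT.
  exact: Ck_snd.
have E1 (z : R * R) : is_derive z.1 1 (fun x => E (x, z.2)) (expR z.1 * cos z.2, expR z.1 * sin z.2).
  have := @is_derive_comp_curve R R (R * R)%type expR (circle ^~ z.2) z.1 (expR z.1).
  have dc := is_derive_circlel (expR z.1) z.2.
  have [dfc ec] := is_derive_diff dc.
  move=> /(_ (is_derive_expR _) dfc); rewrite ec => H1.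
  by apply: (is_derive_eq H1).
have E2 (z : R * R) : is_derive z.2 1 (fun y => E (z.1, y)) (- (expR z.1 * sin z.2), expR z.1 * cos z.2).
  exact: (is_derive_circler (expR z.1) z.2).
have EH (z : R * R) : z.1 < ln rho -> CR_at p q (E z).
  by move=> zr; apply: H; rewrite expR_gt0 -(lnK rho0) ltr_expR.
have dcomp f z : differentiable f (E z) -> differentiable (fun z => f (E z)) z.
  move=> df; apply: (@differentiable_comp _ _ _ _ E f z) => //.
  exact: (Ck_differentiable dE Logic.I).
have dpq z : z.1 < ln rho -> differentiable p (E z) /\ differentiable q (E z) by move=> /EH/CR_at_diff.
have key (z : R * R) : z.1 < ln rho -> exists a b, [/\
    is_derive z.2 1 (fun y => q (E (z.1, y))) (- (expR z.1 * sin z.2) * - b + expR z.1 * cos z.2 * a),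
    is_derive z.2 1 (fun y => p (E (z.1, y))) (- (expR z.1 * sin z.2) * a + expR z.1 * cos z.2 * b),
    is_derive z.1 1 (fun x => p (E (x, z.2))) (expR z.1 * cos z.2 * a + expR z.1 * sin z.2 * b) &
    is_derive z.1 1 (fun x => q (E (x, z.2))) (expR z.1 * cos z.2 * - b + expR z.1 * sin z.2 * a)].
  move=> /EH[a [b [[dp ep] [dq eq]]]]; exists a, b; split.
  - have := is_derive_comp_curve (E2 z) dq; rewrite eq => H1.
    by apply: (is_derive_eq H1) => /=; ring.
  - have := is_derive_comp_curve (E2 z) dp; rewrite ep => H1.
    by apply: (is_derive_eq H1) => /=; ring.
  - have := is_derive_comp_curve (E1 z) dp; rewrite ep => H1.
    by apply: (is_derive_eq H1) => /=; ring.
  - have := is_derive_comp_curve (E1 z) dq; rewrite eq => H1.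
    by apply: (is_derive_eq H1) => /=; ring.
have lr12 : ln r1 <= ln r2 by rewrite ler_ln.
have lr2 : ln r2 < ln rho by rewrite ltr_ln.
have pi0 : 0 <= 2 * pi :> R by rewrite mulr_ge0// pi_ge0.
have Er r t : 0 < r -> E (ln r, t) = circle r t by move=> r0; rewrite /E /= lnK.
have per x : E (x, 0) = E (x, 2 * pi).
  by rewrite /E /circle /= mulr_natl cos2pi sin2pi cos0 sin0.
have fr1 f : (fun t : R => f t (circle r1 t)) = (fun t => f t (E (ln r1, t))) :> (R -> R).
  by apply/funext => t; rewrite Er.
have fr2 f : (fun t : R => f t (circle r2 t)) = (fun t => f t (E (ln r2, t))) :> (R -> R).
  by apply/funext => t; rewrite Er.
split.
  rewrite (fr1 (fun _ => p)) (fr2 (fun _ => p)).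
  apply: (@goursat_period (fun z => q (E z)) (fun z => p (E z)) (ln rho)) => //.
    move=> z zr; have [dp dq] := dpq z zr; split; try exact: dcomp.
    have [a [b [q2 p2 p1 q1]]] := key z zr.
    exists (expR z.1 * (cos z.2 * a + sin z.2 * b)); split.
      by apply: (is_derive_eq q2); ring.
    by apply: (is_derive_eq p1); ring.
  by move=> x; rewrite per.
have shift r : 0 < r < rho -> prim_int 0 (2 * pi) (fun t => p (circle r t) * cos t + q (circle r t) * sin t) / r =
    prim_int 0 (2 * pi) (fun t => (p (E (ln r, t)) * cos t + q (E (ln r, t)) * sin t) * expR (- ln r)).
  move=> rr; have /andP[r0 _] := rr; rewrite mulrC -prim_intZ //.
    by congr prim_int; apply/funext => t; rewrite Er // mulrC expRN lnK.
  have cc f : (forall t, differentiable f (circle r t)) -> continuous (fun t => f (circle r t)).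
    move=> df t; apply: differentiable_continuous; apply/derivable1_diffP.
    by have [] := is_derive_comp_curve (is_derive_circler r t) (df t).
  move=> t; apply: cvgD; apply: cvgM; try exact: continuous_cos; try exact: continuous_sin.
    by apply: cc => s; have [] := CR_at_diff (H r s rr).
  by apply: cc => s; have [] := CR_at_diff (H r s rr).
rewrite !shift ?r10 ?r20 ?r2r ?(le_lt_trans r12)//.
(* [P1] and [Q1] are the components of the imaginary part of f dz / z^2 in logarithmic polar
   coordinates. *)
pose P1 z := (q (E z) * cos z.2 - p (E z) * sin z.2) * expR (- z.1).
pose Q1 z := (p (E z) * cos z.2 + q (E z) * sin z.2) * expR (- z.1).
have expN (x : R) : is_derive x 1 (fun x => expR (- x)) (- expR (- x)).
  have h : is_derive x 1 (@GRing.opp R) (-1) by exact: is_deriveNid.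
  have [dx ex] := is_derive_diff (is_derive_expR (- x)).
  have := is_derive_comp_curve h dx; rewrite ex => H1.
  by apply: (is_derive_eq H1); rewrite /GRing.scale /= mulN1r.
have [Cs Cc] := @Ck_sin_cos R 0 setT openT.
have C1 : Ck 0 setT (fun z : (R * R)%type => cos z.2).
  by apply: (Ck_comp openT _ (Ck_snd _ _) Cc).
have C2 : Ck 0 setT (fun z : (R * R)%type => sin z.2).
  by apply: (Ck_comp openT _ (Ck_snd _ _) Cs).
have C3 : Ck 0 setT (fun z : (R * R)%type => expR (- z.1)).
  apply: (Ck_comp openT _ _ (Ck_expR 0 openT)) => //.
  by apply: CkN; [exact: openT|exact: Ck_fst].
apply: (@goursat_period P1 Q1 (ln rho)) => //; last first.
  by move=> x; rewrite /P1 per mulr_natl /= cos2pi sin2pi cos0 sin0.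
move=> z zr; have [dp dq] := dpq z zr; split.
- apply: differentiableM; last exact: (Ck_differentiable C3 Logic.I).
  apply: differentiableB; apply: differentiableM; try exact: dcomp.
    exact: (Ck_differentiable C1 Logic.I).
  exact: (Ck_differentiable C2 Logic.I).
- apply: differentiableM; last exact: (Ck_differentiable C3 Logic.I).
  apply: differentiableD; apply: differentiableM; try exact: dcomp.
    exact: (Ck_differentiable C1 Logic.I).
  exact: (Ck_differentiable C2 Logic.I).
have [a [b [q2 p2 p1 q1]]] := key z zr.
pose e := expR (- z.1).
exists ((expR z.1 * a * (cos z.2 ^+ 2 + sin z.2 ^+ 2) - p (E z) * cos z.2 - q (E z) * sin z.2) * e).
split.
- have h1 := is_deriveM q2 (is_derive_cos z.2).
  have h2 := is_deriveM p2 (is_derive_sin z.2).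
  have h3 := is_deriveM (is_deriveB h1 h2) (is_derive_cst e z.2 1).
  apply: (is_derive_eq h3); rewrite /GRing.scale /= -/e.
  rewrite mulr0 add0r -[E (z.1, z.2)]/(E z).
  move: (q (E z)) (p (E z)) => u v; ring.
- have h1 := is_deriveM p1 (is_derive_cst (cos z.2) z.1 1).
  have h2 := is_deriveM q1 (is_derive_cst (sin z.2) z.1 1).
  have h3 := is_deriveM (is_deriveD h1 h2) (expN z.1).
  apply: (is_derive_eq h3); rewrite /GRing.scale /= -/e.
  rewrite -[X in X * - e + _]/(p (E z) * cos z.2 + q (E z) * sin z.2) -[E (z.1, z.2)]/(E z).
  move: (q (E z)) (p (E z)) => u v; ring.
Qed.

End Circle.

(** * Cauchy estimates and smoothness of holomorphic maps *)

Section Holomorphic.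
Variables (R : realType) (E : normedModType R) (J : E -> E).
Implicit Types (D : set E) (p q : E -> R).

(* [p + i q] is holomorphic for the complex structure [J]. *)
Definition hol D p q := forall z, D z -> [/\ differentiable p z, differentiable q z &
  forall v, 'd p z (J v) = - 'd q z v /\ 'd q z (J v) = 'd p z v].

Lemma hol_intro (p q : E -> R) z (dp dq : E -> R) : is_diff z p dp -> is_diff z q dq ->
  (forall v, dp (J v) = - dq v /\ dq (J v) = dp v) -> [/\ differentiable p z, differentiable q z &
  forall v, 'd p z (J v) = - 'd q z v /\ 'd q z (J v) = 'd p z v].
Proof. by move=> [d1 e1] [d2 e2] c; split => // v; rewrite e1 e2. Qed.

(** The point z + (w1 + i w2) v of the complex line through [z] in the direction [v]. *)
Definition disc (z v : E) (w : R * R) : E := (w.1 *: v + w.2 *: J v) + z.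

(** This is multiplication by -i; it transfers every result on the real part to the imaginary
    part. *)
Lemma hol_rot D p q : hol D p q -> hol D q (fun z => - p z).
Proof.
move=> H z /H[dp dq c].
apply: (hol_intro (differentiableP dq) (is_diffN (differentiableP dp))) => v.
have [c1 c2] := c v; split; first exact: (etrans c2 (esym (opprK _))).
exact: (etrans (congr1 (fun x => - x) c1) (opprK _)).
Qed.

Lemma disc_diff z v w : is_diff w (disc z v) (fun w => w.1 *: v + w.2 *: J v).
Proof.
pose l := fun w : (R * R)%type => w.1 *: v + w.2 *: J v.
have ll : linear l.
  move=> a x y; rewrite /l /= !scalerDl scalerDr !scalerA.
  by rewrite addrACA.
have cl : continuous l.
  move=> x; apply: cvgD; apply: cvgZr_tmp.
    exact: cvg_fst.
  exact: cvg_snd.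
pose L : {linear (R * R)%type -> E} := HB.pack l (GRing.isLinear.Build R (R * R)%type E *:%R l ll).
have h1 : is_diff w L L.
  by apply: DiffDef; [exact: linear_differentiable|rewrite diff_lin].
have h2 := is_diffD h1 (is_diff_cst z w).
by have [d e] := h2; apply: DiffDef => //; rewrite e addr0.
Qed.

Lemma hol_slice D p q z v w : hol D p q -> D (disc z v w) ->
  is_diff w (p \o disc z v)
     (fun h => h.1 * 'd p (disc z v w) v + h.2 * - 'd q (disc z v w) v) /\
  is_diff w (q \o disc z v)
     (fun h => h.2 * 'd p (disc z v w) v - h.1 * - 'd q (disc z v w) v).
Proof.
move=> H Dz; have [dp dq c] := H _ Dz; have dd := disc_diff z v w.
have [c1 c2] := c v; split.
  have h := @is_diff_comp _ _ _ _ _ _ _ _ _ dd (differentiableP dp).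
  have [d e] := h; apply: DiffDef => //; rewrite e; apply/funext => -[h1 h2] /=.
  by rewrite linearD !linearZ /= c1.
have h := @is_diff_comp _ _ _ _ _ _ _ _ _ dd (differentiableP dq).
have [d e] := h; apply: DiffDef => //; rewrite e; apply/funext => -[h1 h2] /=.
rewrite linearD !linearZ /= c2 /GRing.scale /=.
by move: ('d q _ _) ('d p _ _) => a b; ring.
Qed.

Lemma le_eps0 (x C : R) : (forall e, 0 < e -> `|x| <= C * e) -> x = 0.
Proof.
move=> H; apply/eqP; rewrite -normr_le0 leNgt; apply/negP => x0.
have C1 : 0 < `|C| + 1 by rewrite ltr_wpDl.
have /H : 0 < `|x| / (2 * (`|C| + 1)) by rewrite divr_gt0// mulr_gt0.
rewrite mulrA ler_pdivlMr ?mulr_gt0// => h.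
have : C * `|x| <= `|C| * `|x| by rewrite ler_wpM2r// ler_norm.
nra.
Qed.

Lemma norm_circle (r t : R) : 0 <= r -> `|circle r t| <= r.
Proof.
move=> r0; rewrite prod_normE /= ge_max !normrM !(ger0_norm r0).
by rewrite !ler_piMr// ?cos_max ?sin_max.
Qed.

(** The mean value property and the Cauchy formula for the derivative. Both integrals, suitably
    normalised, are independent of the radius r, and their limits as r tends to 0 are read off the
    first order expansion at [z]. The hypothesis covers the disc of radius 2 so that the unit circle
    lies strictly inside. *)
Lemma hol_circle_int D p q z v : hol D p q ->
  (forall w, w.1 ^+ 2 + w.2 ^+ 2 < 4 -> D (disc z v w)) ->
  prim_int 0 (2 * pi) (fun t => p (disc z v (circle 1 t))) = 2 * pi * p z /\
  prim_int 0 (2 * pi) (fun t => p (disc z v (circle 1 t)) * cos t + q (disc z v (circle 1 t)) * sin t) =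
    2 * pi * 'd p z v.
Proof.
move=> H Dd.
have D0 : D (disc z v (0, 0)) by apply: Dd; rewrite /= expr0n /= addr0.
have e0 : disc z v (0, 0) = z by rewrite /disc /= !scale0r addr0 add0r.
have [hp hq] := hol_slice H D0; rewrite e0 in hp hq.
set a := 'd p z v in hp hq *; set b := - 'd q z v in hp hq.
pose P := p \o disc z v; pose Q := q \o disc z v.
have circ2 r t : (circle r t).1 ^+ 2 + (circle r t).2 ^+ 2 = r ^+ 2.
  by rewrite /= !exprMn -mulrDr cos2Dsin2 mulr1.
have CR r t : 0 < r < 2 -> CR_at P Q (circle r t).
  move=> /andP[r0 r2]; have Dr : D (disc z v (circle r t)).
    by apply: Dd; rewrite circ2; nra.
  by have [h1 h2] := hol_slice H Dr; eexists; eexists; split; [exact: h1|exact: h2].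
have pi20 : 0 <= 2 * pi :> R by rewrite mulr_ge0// pi_ge0.
have eq r : 0 < r -> r <= 1 ->
   prim_int 0 (2 * pi) (fun t => P (circle 1 t)) = prim_int 0 (2 * pi) (fun t => P (circle r t)) /\
   prim_int 0 (2 * pi) (fun t => P (circle 1 t) * cos t + Q (circle 1 t) * sin t) =
   prim_int 0 (2 * pi) (fun t => P (circle r t) * cos t + Q (circle r t) * sin t) / r.
  move=> r0 r1; have [|h1 h2] := circle_int_const CR r0 r1; first by rewrite ltr1n.
  by split => //; rewrite -h2 divr1.
have cP f r : (forall t, differentiable f (circle r t)) -> continuous (fun t => f (circle r t)).
  move=> df t; apply: differentiable_continuous; apply/derivable1_diffP.
  by have [] := is_derive_comp_curve (is_derive_circler r t) (df t).
have near_small e : 0 < e -> exists r, [/\ 0 < r, r <= 1 & forall t,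
   `|P (circle r t) - (p z + r * (a * cos t + b * sin t))| <= e * r /\
   `|Q (circle r t) - (q z + r * (a * sin t - b * cos t))| <= e * r].
  move=> ep; have [dP eP] := hp; have [dQ eQ] := hq.
  have [d1 d10 h1] := diff_eps_delta dP ep.
  have [d2 d20 h2] := diff_eps_delta dQ ep.
  have m0 : 0 < Num.min d1 d2 by rewrite lt_min d10.
  pose r := Num.min 1 (Num.min d1 d2 / 2).
  have r0 : 0 < r by rewrite lt_min ltr01 divr_gt0.
  have rm : r < Num.min d1 d2.
    by rewrite /r gt_min; apply/orP; right; rewrite ltr_pdivrMr// ltr_pMr// ltr1n.
  have /andP[rd1 rd2] : (r < d1) && (r < d2) by rewrite -lt_min.
  exists r; split => //; first by rewrite /r ge_min lexx.
  move=> t; have nc := norm_circle t (ltW r0).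
  have s0 : circle r t - (0, 0) = circle r t by rewrite subr0.
  have n1 := h1 (circle r t); have n2 := h2 (circle r t).
  rewrite s0 in n1 n2; rewrite eP in n1; rewrite eQ in n2.
  have {}n1 := n1 (le_lt_trans nc rd1); have {}n2 := n2 (le_lt_trans nc rd2).
  have b1 := le_trans n1 (ler_wpM2l (ltW ep) nc).
  have b2 := le_trans n2 (ler_wpM2l (ltW ep) nc).
  split; [move: b1|move: b2]; rewrite /= e0; congr (`| _ | <= _);
    rewrite /P /Q /=; ring.
split.
  apply/eqP; rewrite -subr_eq0; apply/eqP; apply: (@le_eps0 _ (2 * pi)) => e ep.
  have [r [r0 r1 hr]] := near_small e ep.
  have [-> _] := eq r r0 r1.
  pose G (t : R) := p z * t + r * (a * sin t - b * cos t).
  have -> : 2 * pi * p z = G (2 * pi) - G 0.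
    by rewrite /G sin0 cos0 mulr_natl cos2pi sin2pi -mulr_natl; ring.
  have -> : 2 * pi * e = e * (2 * pi - 0) by ring.
  apply: (@prim_int_approx _ _ _ _ _ _ (fun t => p z + r * (a * cos t + b * sin t))) => //.
  - by apply: cP => t; have [] := CR_at_diff (CR r t _); rewrite ?r0 ?(le_lt_trans r1) ?ltr1n.
  - move=> t _.
    have h1 := is_deriveZ (p z) (is_derive_id t 1).
    have h2 := is_deriveB (is_deriveZ a (is_derive_sin t)) (is_deriveZ b (is_derive_cos t)).
    apply: (is_derive_eq (is_deriveD h1 (is_deriveZ r h2))).
    rewrite /GRing.scale /=; ring.
  - move=> t _; have [h _] := hr t; apply: (le_trans h).
    by rewrite ler_piMr// ltW.
apply/eqP; rewrite -subr_eq0; apply/eqP; apply: (@le_eps0 _ (4 * pi)) => e ep.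
have [r [r0 r1 hr]] := near_small e ep.
have [_ ->] := eq r r0 r1.
(* An antiderivative of the first order part of the integrand; the trigonometric terms are periodic,
   so its increment over a full turn is [2 * pi * a * r]. *)
pose G (t : R) := p z * sin t - q z * cos t + r * a * t.
set I := prim_int _ _ _.
have HI : `|I - (G (2 * pi) - G 0)| <= 2 * e * r * (2 * pi - 0).
  apply: (@prim_int_approx _ _ _ _ _ _ (fun t => p z * cos t + q z * sin t + r * a)) => //.
  - have [dd1 dd2] : (forall t, differentiable P (circle r t)) /\ (forall t, differentiable Q (circle r t)).
      by split => t; have [] := CR_at_diff (CR r t _); rewrite ?r0 ?(le_lt_trans r1) ?ltr1n.
    move=> t; apply: cvgD; apply: cvgM; try exact: continuous_cos; try exact: continuous_sin.
      exact: cP.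
    exact: cP.
  - move=> t _.
    have h1 := is_deriveB (is_deriveZ (p z) (is_derive_sin t)) (is_deriveZ (q z) (is_derive_cos t)).
    apply: (is_derive_eq (is_deriveD h1 (is_deriveZ (r * a) (is_derive_id t 1)))).
    rewrite /GRing.scale /=; ring.
  - move=> t _; have [h1 h2] := hr t.
    rewrite [X in `|X|](_ : _ = (P (circle r t) - (p z + r * (a * cos t + b * sin t))) * cos t +
      (Q (circle r t) - (q z + r * (a * sin t - b * cos t))) * sin t); last first.
      have := cos2Dsin2 t => cs.
      have -> : r * a = r * a * (cos t ^+ 2 + sin t ^+ 2) by rewrite cs mulr1.
      by ring.
    rewrite -mulrA mulr_natl mulr2n; apply: (le_trans (ler_normD _ _)).
    apply: lerD; rewrite normrM.
      by rewrite -[leRHS]mulr1 ler_pM// cos_max.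
    by rewrite -[leRHS]mulr1 ler_pM// sin_max.
have EG : G (2 * pi) - G 0 = 2 * pi * a * r.
  by rewrite /G sin0 cos0 mulr_natl cos2pi sin2pi -mulr_natl; ring.
rewrite EG in HI.
have -> : I / r - 2 * pi * a = (I - 2 * pi * a * r) / r by field; rewrite gt_eqF.
rewrite normrM normfV (gtr0_norm r0) ler_pdivrMr//.
apply: (le_trans HI); rewrite le_eqVlt; apply/orP; left; apply/eqP; ring.
Qed.

End Holomorphic.

Section Cauchy.
Variables (R : realType) (E : normedModType R).
Implicit Types (D : set E) (p q : E -> R).

Lemma mean_value p (y y' : E) :
  (forall s : R, 0 <= s <= 1 -> differentiable p (y + s *: (y' - y))) ->
  exists2 s : R, 0 <= s <= 1 & p y' - p y = 'd p (y + s *: (y' - y)) (y' - y).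
Proof.
move=> dp.
pose c (s : R) := y + s *: (y' - y).
have dc (s : R) : is_derive s 1 c (y' - y).
  have [d e] := is_diff_scalel s (y' - y).
  have h : is_derive s 1 (fun s : R => s *: (y' - y)) (y' - y).
    by apply: is_diff_derive => //; rewrite e scale1r.
  by have := is_deriveD (is_derive_cst y s 1) h; rewrite add0r.
have dpc (s : R) : 0 <= s <= 1 -> is_derive s 1 (fun s => p (c s)) ('d p (c s) (y' - y)).
  by move=> /dp; exact: is_derive_comp_curve.
have [||s sI] := @MVT_segment R (fun s => p (c s)) (fun s => 'd p (c s) (y' - y)) 0 1 ler01.
- by move=> x /itvP x01; apply: dpc; rewrite !x01.
- apply: derivable_within_continuous => x; rewrite in_itv /= => xab.
  by have [] := dpc x xab.
have -> : c 1 = y' by rewrite /c scale1r addrC subrK.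
have -> : c 0 = y by rewrite /c scale0r addr0.
rewrite subr0 mulr1 => e.
by exists s => //; move: sI; rewrite in_itv.
Qed.

Lemma segment_ball (z y y' : E) (r s : R) : `|y - z| < r -> `|y' - z| < r ->
  0 <= s <= 1 -> `|y + s *: (y' - y) - z| < r.
Proof.
move=> h1 h2 /andP[s0 s1].
have -> : y + s *: (y' - y) - z = (1 - s) *: (y - z) + s *: (y' - z).
  have -> : y' - z = (y' - y) + (y - z) by rewrite addrA subrK.
  by rewrite [LHS]addrAC [s *: (_ + (y - z))]scalerDr scalerBl scale1r [_ + s *: (y - z)]addrC addrA subrK.
apply: (le_lt_trans (ler_normD _ _)); rewrite !normrZ (ger0_norm s0) ger0_norm ?subr_ge0//.
have [->|s1'] := eqVneq s 1; first by rewrite subrr mul0r add0r mul1r.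
have : 0 < 1 - s by rewrite subr_gt0 lt_neqAle s1'.
nra.
Qed.

Lemma disc_bound (J : E -> E) (C : R) (z v : E) w (k : R) : 1 <= C -> (forall v, `|J v| <= C * `|v|) ->
  `|w.1| <= k -> `|w.2| <= k -> `|disc J z v w - z| <= 2 * C * k * `|v|.
Proof.
move=> C1 JC w1 w2; rewrite /disc addrK; apply: (le_trans (ler_normD _ _)).
rewrite !normrZ.
have k0 : 0 <= k by exact: le_trans w1.
have h1 : `|w.1| * `|v| <= k * `|v| by rewrite ler_wpM2r.
have h2 : `|w.2| * `|J v| <= k * (C * `|v|) by rewrite ler_pM.
have h3 : 0 <= k * `|v| * (C - 1) by rewrite !mulr_ge0// subr_ge0.
nra.
Qed.

(** The Cauchy formula on a circle of radius proportional to [rho] in the direction of [v]. The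
    constant [C] accounts for a norm that [J] need not preserve. *)
Lemma cauchy_estimate (J : E -> E) (C : R) D p q z (rho M : R) : 1 <= C ->
  (forall v, `|J v| <= C * `|v|) -> hol J D p q -> 0 < rho ->
  (forall y, `|y - z| < rho -> [/\ D y, `|p y| <= M & `|q y| <= M]) ->
  forall v, `|'d p z v| <= 10 * C / rho * M * `|v|.
Proof.
move=> C1 JC H rho0 HB v.
have [->|v0] := eqVneq v 0; first by rewrite linear0 !normr0 mulr0.
have nv : 0 < `|v| by rewrite normr_gt0.
(* [disc_bound] with [k = 2] keeps the disc of radius 2 within 4 C eta, that is 4/5 of [rho], of
   [z]; dividing 2 M by [eta] then gives the factor [10 * C / rho]. *)
pose eta := rho / (5 * C).
have C0 : 0 < C by lra.
have eta0 : 0 < eta by rewrite divr_gt0// mulr_gt0.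
pose u := (eta / `|v|) *: v.
have nu : `|u| = eta by rewrite normrZ normrM normfV normr_id divfK ?gt_eqF// gtr0_norm.
have sq2 (x y : R) : x ^+ 2 + y ^+ 2 < 4 -> `|x| <= 2 /\ `|y| <= 2.
  by move=> h; split; rewrite ler_norml; nra.
have inball w : w.1 ^+ 2 + w.2 ^+ 2 < 4 -> `|disc J z u w - z| < rho.
  move=> /sq2[w1 w2]; apply: (le_lt_trans (disc_bound z u C1 JC w1 w2)).
  rewrite nu /eta.
  have -> : 2 * C * 2 * (rho / (5 * C)) = 4 / 5 * rho by field; lra.
  lra.
have [|_ h] := hol_circle_int (z := z) (v := u) H.
  by move=> w /inball /HB[].
have pi0 : 0 < 2 * pi :> R by rewrite mulr_gt0// pi_gt0.
have vu : v = (`|v| / eta) *: u.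
  by rewrite /u scalerA mulrA divfK ?gt_eqF// divff ?gt_eqF// scale1r.
have dE : 'd p z v = (`|v| / eta) * 'd p z u.
  by rewrite {1}vu linearZ.
have inb t : `|p (disc J z u (circle 1 t))| <= M /\ `|q (disc J z u (circle 1 t))| <= M.
  have [] // := HB (disc J z u (circle 1 t)) _.
  by apply: inball; rewrite /= !mul1r cos2Dsin2 ltr1n.
have b : `|2 * pi * 'd p z u| <= 2 * M * (2 * pi - 0).
  rewrite -h; apply: prim_int_bound; first exact: ltW.
    have cc f : (forall y, D y -> differentiable f y) -> continuous (fun t => f (disc J z u (circle 1 t))).
      move=> df t; apply: differentiable_continuous; apply/derivable1_diffP.
      have [dd _] := disc_diff J z u (circle 1 t).
      have h1 := is_derive_comp_curve (is_derive_circler 1 t) dd.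
      have dD : D (disc J z u (circle 1 t)).
        by have [] // := HB (disc J z u (circle 1 t)) _; apply: inball; rewrite /= !mul1r cos2Dsin2 ltr1n.
      by have [] := is_derive_comp_curve h1 (df _ dD).
    move=> t; apply: cvgD; apply: cvgM; try exact: continuous_cos; try exact: continuous_sin.
      by apply: cc => y /H[].
    by apply: cc => y /H[].
  move=> t _; have [h1 h2] := inb t.
  rewrite mulr_natl mulr2n (le_trans (ler_normD _ _))// lerD// normrM.
    by rewrite -[leRHS]mulr1 ler_pM// cos_max.
  by rewrite -[leRHS]mulr1 ler_pM// sin_max.
have {}b : `|'d p z u| <= 2 * M.
  by move: b; rewrite subr0 normrM (gtr0_norm pi0) [leRHS]mulrC ler_pM2l.
have e1 : 0 <= `|v| / eta by rewrite divr_ge0// ltW.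
rewrite dE normrM (ger0_norm e1).
apply: (@le_trans _ _ (`|v| / eta * (2 * M))).
  by rewrite ler_wpM2l.
rewrite le_eqVlt; apply/orP; left; apply/eqP; rewrite /eta; field.
by rewrite !gt_eqF.
Qed.

(** C^{1,1} control with explicit constants on a ball. It yields a quadratic Taylor remainder, and
    so differentiation under the integral sign, before any second derivative is available. *)
Definition deriv_lipschitz p (z0 : E) (d B M : R) := forall y y',
  `|y - z0| < d -> `|y' - z0| < d -> [/\ differentiable p y,
    forall h, `|'d p y h| <= B * `|h| &
    forall h, `|'d p y h - 'd p y' h| <= M * `|y - y'| * `|h|].

Lemma deriv_lipschitz_taylor p z0 d B M y y' : 0 <= M -> deriv_lipschitz p z0 d B M ->
  `|y - z0| < d -> `|y' - z0| < d -> `|p y' - p y - 'd p y (y' - y)| <= M * `|y' - y| ^+ 2.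
Proof.
move=> M0 H hy hy'.
have [|s s01 ->] := @mean_value p y y'.
  by move=> s s01; have [] := H _ _ (segment_ball hy hy' s01) hy.
have [_ _ h] := H _ _ (segment_ball hy hy' s01) hy.
apply: (le_trans (h _)); rewrite addrAC subrr add0r normrZ expr2 mulrA.
have /andP[s0 s1] := s01; rewrite (ger0_norm s0) mulrA.
by rewrite ler_wpM2r// ler_wpM2r// ler_piMr.
Qed.

(** The Cauchy estimate is used twice. It bounds the differentials on the ball of radius [3 * rho],
    so the translated difference p(x + h0) - p(x), which is holomorphic on radius [2 * rho], is at
    most a multiple of the norm of [h0]; applied to that difference it bounds the variation of the
    differential. *)
Lemma hol_deriv_lipschitz1 (J : E -> E) (C : R) D p q z0 (rho M0 : R) : 1 <= C ->
  (forall v, `|J v| <= C * `|v|) -> hol J D p q -> 0 < rho ->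
  (forall y, `|y - z0| < 4 * rho -> [/\ D y, `|p y| <= M0 & `|q y| <= M0]) ->
  deriv_lipschitz p z0 (rho / 2) (10 * C / rho * M0)
    (10 * C / rho * (10 * C / rho * M0)).
Proof.
move=> C1 JC H rho0 HB.
pose L := 10 * C / rho * M0.
have M00 : 0 <= M0.
  have [] := HB z0 _; first by rewrite subrr normr0; lra.
  by move=> _ + _; apply: le_trans.
have K0 : 0 <= 10 * C / rho by rewrite divr_ge0 ?ltW//; lra.
have L0 : 0 <= L by rewrite mulr_ge0.
have b3 f g (Hfg : hol J D f g) : (forall y, `|y - z0| < 4 * rho -> [/\ D y, `|f y| <= M0 & `|g y| <= M0]) ->
    forall y, `|y - z0| < 3 * rho -> forall v, `|'d f y v| <= L * `|v|.
  move=> HB' y hy v; apply: (cauchy_estimate C1 JC Hfg rho0) => x hx; apply: HB'.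
  rewrite -(subrKA y) (le_lt_trans (ler_normD _ _))//; lra.
have HD y : `|y - z0| < 4 * rho -> D y by move=> /HB[].
have lip f g (Hfg : hol J D f g) : (forall y, `|y - z0| < 4 * rho -> [/\ D y, `|f y| <= M0 & `|g y| <= M0]) ->
    forall y y', `|y - z0| < 3 * rho -> `|y' - z0| < 3 * rho -> `|f y' - f y| <= L * `|y' - y|.
  move=> HB' y y' hy hy'.
  have [|s s01 ->] := @mean_value f y y'.
    move=> s s01; have [] // := Hfg (y + s *: (y' - y)) _; apply: HD.
    by rewrite (lt_trans (segment_ball hy hy' s01))//; lra.
  by apply: (b3 _ _ Hfg HB'); exact: segment_ball.
have HBr y : `|y - z0| < 4 * rho -> [/\ D y, `|q y| <= M0 & `|- p y| <= M0].
  by move=> /HB[h1 h2 h3]; rewrite normrN.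
move=> y y' hy hy'; split.
- have [] // := H y _; apply: HD; lra.
- by apply: (b3 _ _ H HB); lra.
move=> h; pose h0 := y - y'.
have nh0 : `|h0| < rho.
  rewrite /h0 -(subrKA z0) (le_lt_trans (ler_normD _ _))// [`|z0 - _|]distrC; lra.
have shd (f : E -> R) x : differentiable f (x + h0) -> is_diff x (fun x => f (x + h0)) ('d f (x + h0)).
  move=> df; have h1 : is_diff x (fun x => x + h0) id.
    have [d e] := is_diffD (is_diff_id x) (is_diff_cst h0 x).
    by apply: DiffDef => //; rewrite e addr0.
  have [d e] := @is_diff_comp _ _ _ _ (fun x => x + h0) _ _ _ x h1 (differentiableP df).
  by apply: DiffDef.
have shdB (f : E -> R) x : differentiable f (x + h0) -> differentiable f x ->
   is_diff x (fun x => f (x + h0) - f x) (fun v => 'd f (x + h0) v - 'd f x v).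
  move=> d1 d2; have h1 := shd _ _ d1; have [d e] := is_diffB h1 (differentiableP d2).
  by apply: DiffDef.
have HP : hol J [set x | `|x - z0| < 2 * rho] (fun x => p (x + h0) - p x) (fun x => q (x + h0) - q x).
  move=> x /= hx.
  have D1 : D x by apply: HD; lra.
  have D2 : D (x + h0).
    by apply: HD; rewrite addrAC (le_lt_trans (ler_normD _ _))//; lra.
  have [p1 q1 c1] := H _ D1; have [p2 q2 c2] := H _ D2.
  apply: (hol_intro (shdB _ _ p2 p1) (shdB _ _ q2 q1)) => v; have [a1 a2] := c1 v; have [b1 b2] := c2 v.
  split; last exact: (congr2 (fun a b => a - b) b2 a2).
  by apply: etrans (congr2 (fun a b => a - b) b1 a1) _; rewrite opprD.
have y'h : y' + h0 = y by rewrite /h0 addrC subrK.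
have := @cauchy_estimate J C _ _ _ y' rho (L * `|h0|) C1 JC HP rho0.
have Dy : D y by apply: HD; lra.
have Dy' : D y' by apply: HD; lra.
have [py _ _] := H _ Dy; have [py' _ _] := H _ Dy'.
have [_ ->] := shdB p y' (eq_ind_r (fun x => differentiable p x) py y'h) py'.
rewrite y'h => /(_ _ h) E0.
rewrite -/L -/h0; apply: (le_trans (E0 _)); last by rewrite !mulrA.
move=> x hx.
have h2 : `|x - z0| < 2 * rho.
  rewrite -(subrKA y') (le_lt_trans (ler_normD _ _))//; lra.
have h3 : `|x + h0 - z0| < 3 * rho.
  by rewrite addrAC (le_lt_trans (ler_normD _ _))//; lra.
have h3' : `|x - z0| < 3 * rho by lra.
have eh : `|x + h0 - x| = `|h0| by rewrite addrAC subrr add0r.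
split => //.
  by rewrite -eh; exact: (lip _ _ H HB).
by rewrite -eh; exact: (lip _ _ (hol_rot H) HBr).
Qed.

Lemma hol_deriv_lipschitz (J : E -> E) (C : R) D p q z0 : 1 <= C ->
  (forall v, `|J v| <= C * `|v|) -> open D -> hol J D p q -> D z0 ->
  exists d B M, [/\ [/\ 0 < d, 0 <= B & 0 <= M], (forall y, `|y - z0| < d -> D y),
    deriv_lipschitz p z0 d B M & deriv_lipschitz q z0 d B M].
Proof.
move=> C1 JC oD H Dz0.
have [dp dq _] := H _ Dz0.
pose M0 := `|p z0| + `|q z0| + 1.
have cp := differentiable_continuous dp; have cq := differentiable_continuous dq.
have np : \forall y \near z0, `|p y| <= M0.
  have /cvgrPdist_lt/(_ 1 ltr01) := cp; apply: filterS => y /= h.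
  rewrite -(subrK (p z0) (p y)) (le_trans (ler_normD _ _))// /M0.
  by rewrite distrC in h; have := normr_ge0 (q z0); lra.
have nq : \forall y \near z0, `|q y| <= M0.
  have /cvgrPdist_lt/(_ 1 ltr01) := cq; apply: filterS => y /= h.
  rewrite -(subrK (q z0) (q y)) (le_trans (ler_normD _ _))// /M0.
  by rewrite distrC in h; have := normr_ge0 (p z0); lra.
have nD : nbhs z0 D by exact: open_nbhs_nbhs.
have : nbhs z0 (D `&` ([set y | `|p y| <= M0] `&` [set y | `|q y| <= M0])).
  exact: filterI nD (filterI np nq).
move=> /nbhs_ballP[r /= r0 Hr].
pose rho := r / 4.
have rho0 : 0 < rho by rewrite divr_gt0.
have HB y : `|y - z0| < 4 * rho -> [/\ D y, `|p y| <= M0 & `|q y| <= M0].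
  move=> h; have [] := Hr y; last by move=> ? [].
  by rewrite -ball_normE /= distrC (lt_le_trans h)// /rho; lra.
have M00 : 0 <= M0 by rewrite /M0 !addr_ge0.
have K0 : 0 <= 10 * C / rho by rewrite divr_ge0 ?ltW//; lra.
exists (rho / 2), (10 * C / rho * M0), (10 * C / rho * (10 * C / rho * M0)); split.
- split; [by rewrite divr_gt0|exact: mulr_ge0|exact: mulr_ge0 K0 (mulr_ge0 K0 M00)].
- by move=> y hy; have [] // := HB y _; lra.
- exact: (hol_deriv_lipschitz1 C1 JC H).
apply: (hol_deriv_lipschitz1 C1 JC (hol_rot H) rho0) => y /HB[h1 h2 h3].
by rewrite normrN.
Qed.

End Cauchy.

Lemma linear_bound_continuous (K : numFieldType) (E F : normedModType K) (f : E -> F) (C : K) :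
  linear f -> 0 <= C -> (forall v, `|f v| <= C * `|v|) -> continuous f.
Proof.
move=> lf C0 fC x; apply/cvgrPdist_lt => e e0.
pose L : {linear E -> F} := HB.pack f (GRing.isLinear.Build K E F *:%R f lf).
have C1 : 0 < C + 1 by rewrite ltr_wpDl.
have : \forall y \near x, `|x - y| < e / (C + 1).
  by apply: cvgr_dist_lt; [exact: cvg_id|rewrite divr_gt0].
apply: filterS => y; rewrite ltr_pdivlMr// => h.
rewrite -[f x - f y](linearB L x y) (le_lt_trans (fC _))//.
by apply: (le_lt_trans _ h); rewrite mulrC ler_wpM2l// lerDl.
Qed.

Section DiffUnderInt.
Variable R : realType.
Implicit Types E F : normedModType R.

(** A Taylor remainder that is quadratic uniformly in [t] integrates to a quadratic remainder, so
    the integral is differentiable by the definition, without a dominated convergence argument. *)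
Lemma diff_under_int E (g : E -> R -> R) (L : R -> E -> R) (x0 : E) (a b d M : R) :
  a <= b -> 0 < d -> 0 <= M -> (forall t, linear (L t)) ->
  (forall h, continuous (fun t => L t h)) ->
  (forall x, `|x - x0| < d -> continuous (g x)) ->
  (forall x t, a <= t <= b -> `|x - x0| < d ->
     `|g x t - g x0 t - L t (x - x0)| <= M * `|x - x0| ^+ 2) ->
  (forall t h, a <= t <= b -> `|L t h| <= M * `|h|) ->
  is_diff x0 (fun x => prim_int a b (g x)) (fun h => prim_int a b (fun t => L t h)).
Proof.
move=> ab d0 M0 Ll Lc gc HT Lb.
pose l := fun h => prim_int a b (fun t => L t h).
have ll : linear l.
  move=> k u v; rewrite /l.
  have -> : (fun t => L t (k *: u + v)) = (fun t => k * L t u + L t v).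
    by apply/funext => t; rewrite Ll.
  exact: prim_int_linear.
have lb v : `|l v| <= M * (b - a) * `|v|.
  by rewrite mulrAC; apply: prim_int_bound => // t tab; exact: Lb.
have Mab : 0 <= M * (b - a) by rewrite mulr_ge0// subr_ge0.
have lc : continuous l := linear_bound_continuous ll Mab lb.
pose l' : {linear E -> R} := HB.pack l (GRing.isLinear.Build R E R *:%R l ll).
suff : is_diff x0 (fun x => prim_int a b (g x)) l' by [].
apply: diff_intro => // e e0.
have c0 : 0 < M * (b - a) + 1 by rewrite ltr_wpDl// mulr_ge0// subr_ge0.
pose d' := Num.min d (e / (M * (b - a) + 1)).
have d'0 : 0 < d' by rewrite lt_min d0 divr_gt0.
apply/nbhs_ballP; exists d' => // h; rewrite -ball_normE /= sub0r normrN.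
rewrite lt_min => /andP[hd he].
have hx : h + x0 - x0 = h by rewrite addrK.
have hd' : `|h + x0 - x0| < d by rewrite hx.
have x0d : `|x0 - x0| < d by rewrite subrr normr0.
have c1 := gc _ hd'; have c2 := gc _ x0d.
rewrite /l -prim_intB // -prim_intB //; last by move=> t; apply: cvgB; [exact: c1|exact: c2].
apply: (@le_trans _ _ (M * `|h| ^+ 2 * (b - a))).
  apply: prim_int_bound => //.
    by move=> t; apply: cvgB; [apply: cvgB; [exact: c1|exact: c2]|exact: Lc].
  by move=> t tab; have := HT (h + x0) t tab hd'; rewrite hx.
move: he; rewrite ltr_pdivlMr// => he.
have h0 := normr_ge0 h.
have -> : M * `|h| ^+ 2 * (b - a) = (`|h| * (M * (b - a))) * `|h| by ring.
rewrite ler_wpM2r//; lra.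
Qed.

End DiffUnderInt.

Section HolomorphicDerivative.
Variable R : realType.
Implicit Types E : normedModType R.

Lemma deriv_lipschitz_continuous E (p : E -> R) z0 d B M (c w : R -> E) :
  0 <= M -> deriv_lipschitz p z0 d B M -> (forall t, `|c t - z0| < d) ->
  continuous c -> continuous w -> continuous (fun t => 'd p (c t) (w t)).
Proof.
move=> M0 H cd cc cw t.
have [dp _ _] := H _ _ (cd t) (cd t).
have -> : (fun s => 'd p (c s) (w s)) =
  (fun s => ('d p (c s) (w s) - 'd p (c t) (w s)) + 'd p (c t) (w s)).
  by apply/funext => s; rewrite subrK.
have n0 : `|c s - c t| @[s --> t] --> (0 : R).
  apply/cvgr0Pnorm_lt => e e0.
  have /cvgrPdist_lt/(_ e e0) := cc t; apply: filterS => s.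
  by rewrite normr_id distrC.
have b0 : M * `|c s - c t| * `|w s| @[s --> t] --> (0 : R).
  rewrite -(mul0r `|w t|); apply: cvgM; last by apply: cvg_norm; exact: cw.
  by have h := cvgM (cvg_cst M) n0; rewrite mulr0 in h; exact: h.
have h0 : ('d p (c s) (w s) - 'd p (c t) (w s)) @[s --> t] --> (0 : R).
  apply/cvgr0Pnorm_lt => e e0; near=> s.
  have [_ _ h] := H _ _ (cd s) (cd t).
  apply: (le_lt_trans (h _)); apply: (le_lt_trans (ler_norm _)).
  by near: s; move/cvgr0Pnorm_lt: b0; exact.
have h1 : 'd p (c t) (w s) @[s --> t] --> 'd p (c t) (w t).
  apply: (@continuous_comp _ _ _ w ('d p (c t)) t); first exact: cw.
  exact: diff_continuous.
have h2 := cvgD h0 h1; rewrite add0r in h2.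
by rewrite /continuous_at subrr add0r; apply: h2.
Unshelve. all: by end_near. Qed.

(* The Cauchy formula for the derivative, rescaled by [eta] so that the circle
   stays in the ball where the differentials are Lipschitz. *)
Definition cauchy_deriv E (J : E -> E) (p q : E -> R) (eta : R) (x : (E * E)%type) : R :=
  (2 * pi * eta)^-1 * prim_int 0 (2 * pi) (fun t =>
    p (disc J x.1 (eta *: x.2) (circle 1 t)) * cos t +
    q (disc J x.1 (eta *: x.2) (circle 1 t)) * sin t).

Definition cauchy_deriv_diff E (J : E -> E) (p q : E -> R) (eta : R) (x h : (E * E)%type) : R :=
  (2 * pi * eta)^-1 * prim_int 0 (2 * pi) (fun t =>
    'd p (disc J x.1 (eta *: x.2) (circle 1 t)) (disc J h.1 (eta *: h.2) (circle 1 t)) * cos t +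
    'd q (disc J x.1 (eta *: x.2) (circle 1 t)) (disc J h.1 (eta *: h.2) (circle 1 t)) * sin t).

Section Closure.
Variables (E : normedModType R) (J : E -> E) (C : R).
Hypotheses (lJ : linear J) (C1 : 1 <= C) (JC : forall v, `|J v| <= C * `|v|).

Let JB u v : J (u - v) = J u - J v.
Proof. by rewrite addrC -scaleN1r lJ scaleN1r addrC. Qed.

Let JZ (k : R) v : J (k *: v) = k *: J v.
Proof.
have J0 : J 0 = 0 by have := JB 0 0; rewrite !subrr.
by have := lJ k v 0; rewrite !addr0 J0 addr0.
Qed.

Lemma disc_linear (eta : R) w :
  linear (fun x : (E * E)%type => disc J x.1 (eta *: x.2) w).
Proof.
move=> k x y /=; rewrite /disc /= scalerDr.
have -> : J (eta *: (k *: x.2) + eta *: y.2) = k *: J (eta *: x.2) + J (eta *: y.2).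
  by rewrite scalerA [eta * k]mulrC -scalerA lJ.
have eA : w.1 *: (eta *: (k *: x.2)) = k *: (w.1 *: (eta *: x.2)).
  by rewrite !scalerA; congr (_ *: _); ring.
have eB u : w.2 *: (k *: u) = k *: (w.2 *: u) :> E by rewrite !scalerA mulrC.
rewrite [w.1 *: (_ + _)]scalerDr eA [w.2 *: (_ + _)]scalerDr eB [k *: (_ + _ + _)]scalerDr [k *: (_ + _)]scalerDr.
rewrite [X in X + _ = _]addrACA [LHS]addrACA.
by [].
Qed.

Lemma discB (eta : R) (x y : (E * E)%type) w :
  disc J x.1 (eta *: x.2) w - disc J y.1 (eta *: y.2) w =
  disc J (x - y).1 (eta *: (x - y).2) w.
Proof.
pose f := fun x : (E * E)%type => disc J x.1 (eta *: x.2) w.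
pose L : {linear (E * E)%type -> E} :=
  HB.pack f (GRing.isLinear.Build R (E * E)%type E *:%R f (disc_linear eta w)).
exact: esym (linearB L x y).
Qed.

Lemma disc_circle_continuous (z v : E) : continuous (fun t => disc J z v (circle 1 t)).
Proof.
move=> t; apply: differentiable_continuous; apply/derivable1_diffP.
have [dd _] := disc_diff J z v (circle 1 t).
by have [] := is_derive_comp_curve (is_derive_circler 1 t) dd.
Qed.

(** The points of the circle depend linearly on the pair (centre, direction), so the integrand
    inherits a quadratic Taylor bound and [diff_under_int] applies. The value of [eta] makes the
    radius at most [d / 4] for directions of norm up to that of [v0] plus 1; with centres within
    [d / 2] of [z0], all circles stay in the ball of control. *)
Lemma cauchy_deriv_is_diff (p q : E -> R) (z0 v0 : E) d B M :
  0 < d -> 0 <= B -> 0 <= M ->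
  deriv_lipschitz p z0 d B M -> deriv_lipschitz q z0 d B M ->
  forall eta, eta = d / (8 * C * (`|v0| + 1)) ->
  is_diff (z0, v0) (cauchy_deriv J p q eta) (cauchy_deriv_diff J p q eta (z0, v0)).
Proof.
move=> d0 B0 M0 Hp Hq eta eE.
have v00 := normr_ge0 v0.
have C0 : 0 < C by exact: lt_le_trans ltr01 C1.
have v10 : 0 < `|v0| + 1 by rewrite ltr_wpDl.
have eta0 : 0 < eta by rewrite eE divr_gt0// !mulr_gt0.
pose lam (x : (E * E)%type) t := disc J x.1 (eta *: x.2) (circle 1 t).
have K0 : 0 <= 1 + 2 * C * eta by rewrite addr_ge0// !mulr_ge0// ltW.
have lamz x t : `|lam x t - x.1| <= 2 * C * eta * `|x.2|.
  have c1 : `|(circle 1 t).1| <= 1 by rewrite /= mul1r cos_max.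
  have c2 : `|(circle 1 t).2| <= 1 by rewrite /= mul1r sin_max.
  apply: (le_trans (disc_bound x.1 (eta *: x.2) C1 JC c1 c2)).
  by rewrite mulr1 normrZ (gtr0_norm eta0) mulrA.
have n1 (x : (E * E)%type) : `|x.1| <= `|x| by rewrite prod_normE le_max lexx.
have n2 (x : (E * E)%type) : `|x.2| <= `|x| by rewrite prod_normE le_max lexx orbT.
have lamb x t : `|lam x t| <= (1 + 2 * C * eta) * `|x|.
  rewrite -(subrK x.1 (lam x t)) (le_trans (ler_normD _ _))// mulrDl mul1r addrC lerD//.
  by apply: (le_trans (lamz x t)); rewrite ler_wpM2l// !mulr_ge0// ltW.
have lamd (x : (E * E)%type) t : `|x - (z0, v0)| < Num.min 1 (d / 2) -> `|lam x t - z0| < d.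
  rewrite lt_min => /andP[h1 h2].
  have a1 := n1 (x - (z0, v0)); have a2 := n2 (x - (z0, v0)).
  have b1 : `|x.1 - z0| < d / 2 by exact: le_lt_trans a1 h2.
  have b2 : `|x.2 - v0| < 1 by exact: le_lt_trans a2 h1.
  have b3 : `|x.2| <= `|v0| + 1.
    by rewrite -(subrK v0 x.2) (le_trans (ler_normD _ _))// addrC lerD// ltW.
  rewrite -(subrKA x.1) (le_lt_trans (ler_normD _ _))//.
  have b4 : 2 * C * eta * `|x.2| <= 2 * C * eta * (`|v0| + 1).
    by rewrite ler_wpM2l// !mulr_ge0// ltW.
  have b5 : 2 * C * eta * (`|v0| + 1) = d / 4 by rewrite eE; field; rewrite !gt_eqF.
  have := lamz x t; lra.
pose r := Num.min 1 (d / 2).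
have r0 : 0 < r by rewrite lt_min ltr01 divr_gt0.
have x00 : `|(z0, v0) - (z0, v0)| < r by rewrite subrr normr0.
have cg f x : deriv_lipschitz f z0 d B M -> `|x - (z0, v0)| < r -> continuous (fun t => f (lam x t)).
  move=> Hf hx t; apply: (@continuous_comp _ _ _ (lam x) f t); first exact: disc_circle_continuous.
  by have [df _ _] := Hf _ _ (lamd x t hx) (lamd x t hx); exact: differentiable_continuous.
pose K := 1 + 2 * C * eta.
pose g x t := p (lam x t) * cos t + q (lam x t) * sin t.
pose L t h := 'd p (lam (z0, v0) t) (lam h t) * cos t + 'd q (lam (z0, v0) t) (lam h t) * sin t.
have taylor f x t : deriv_lipschitz f z0 d B M -> `|x - (z0, v0)| < r ->
   `|f (lam x t) - f (lam (z0, v0) t) - 'd f (lam (z0, v0) t) (lam (x - (z0, v0)) t)| <= M * K ^+ 2 * `|x - (z0, v0)| ^+ 2.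
  move=> Hf hx; rewrite -[lam (x - _) t]discB.
  apply: (le_trans (deriv_lipschitz_taylor M0 Hf (lamd _ t x00) (lamd _ t hx))).
  rewrite -mulrA ler_wpM2l// -exprMn ler_pXn2r ?nnegrE ?mulr_ge0//.
  by rewrite discB; exact: lamb.
have lamL t : linear (lam ^~ t) by exact: disc_linear.
have dL (f : E -> R) t : linear (fun h => 'd f (lam (z0, v0) t) (lam h t)).
  by move=> k u v; rewrite lamL linearP.
have Kp : 0 <= 2 * M * K ^+ 2 + 2 * B * K.
  by rewrite addr_ge0// !mulr_ge0// exprn_ge0.
have cos1 (u c t' : R) : `|u| <= c -> `|u * cos t'| <= c.
  by move=> h; rewrite normrM -[leRHS]mulr1 ler_pM// cos_max.
have sin1 (u c t' : R) : `|u| <= c -> `|u * sin t'| <= c.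
  by move=> h; rewrite normrM -[leRHS]mulr1 ler_pM// sin_max.
have pi20 : 0 <= 2 * pi :> R by rewrite mulr_ge0// pi_ge0.
have aux1 (k a b a' b' u v : R) :
    (k *: a + b) * u + (k *: a' + b') * v = k *: (a * u + a' * v) + (b * u + b' * v).
  by rewrite /GRing.scale /=; ring.
have aux2 (a b c a' b' c' u v : R) : a * u + a' * v - (b * u + b' * v) - (c * u + c' * v) =
    (a - b - c) * u + (a' - b' - c') * v by ring.
have [|||||d1 e1] := @diff_under_int R (E * E)%type g L (z0, v0) 0 (2 * pi) r (2 * M * K ^+ 2 + 2 * B * K) pi20 r0 Kp.
- move=> t k u v; rewrite /L.
  exact: (etrans (congr2 (fun a b => a * cos t + b * sin t) (dL p t k u v) (dL q t k u v))
    (aux1 _ _ _ _ _ _ _)).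
- move=> h t; apply: cvgD; apply: cvgM; try exact: continuous_cos; try exact: continuous_sin;
    apply: (deriv_lipschitz_continuous M0 _ _ _ (w := fun t => lam h t)); try exact: disc_circle_continuous;
    try (by move=> s; exact: lamd); try exact: Hp; exact: Hq.
- move=> x hx t; apply: cvgD; apply: cvgM; try exact: continuous_cos; try exact: continuous_sin.
    exact: cg Hp hx t.
  exact: cg Hq hx t.
- move=> x t _ hx.
  rewrite [X in `|X|](_ : _ =
    (p (lam x t) - p (lam (z0, v0) t) - 'd p (lam (z0, v0) t) (lam (x - (z0, v0)) t)) * cos t +
    (q (lam x t) - q (lam (z0, v0) t) - 'd q (lam (z0, v0) t) (lam (x - (z0, v0)) t)) * sin t); last first.
    exact: aux2.
  rewrite (le_trans (ler_normD _ _))//.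
  have t1 := cos1 _ _ t (taylor p x t Hp hx); have t2 := sin1 _ _ t (taylor q x t Hq hx).
  apply: (le_trans (lerD t1 t2)).
  have : 0 <= 2 * B * K * `|x - (z0, v0)| ^+ 2 by rewrite !mulr_ge0// exprn_ge0.
  lra.
- move=> t h _; rewrite /L (le_trans (ler_normD _ _))//.
  have bb f : deriv_lipschitz f z0 d B M -> `|'d f (lam (z0, v0) t) (lam h t)| <= B * K * `|h|.
    move=> Hf; have [_ hb _] := Hf _ _ (lamd (z0, v0) t x00) (lamd (z0, v0) t x00).
    by apply: (le_trans (hb _)); rewrite -mulrA ler_wpM2l.
  apply: (le_trans (lerD (cos1 _ _ t (bb p Hp)) (sin1 _ _ t (bb q Hq)))).
  have : 0 <= 2 * M * K ^+ 2 * `|h| by rewrite !mulr_ge0// exprn_ge0.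
  lra.
have h1 : is_diff (z0, v0) (fun x => prim_int 0 (2 * pi) (g x))
    (fun h => prim_int 0 (2 * pi) (fun t => L t h)) by apply: DiffDef.
have [d2 e2] := is_diffZ (2 * pi * eta)^-1 h1.
apply: DiffDef; first exact: d2.
by rewrite e2.
Qed.

Definition Jpair (z : (E * E)%type) : (E * E)%type := (J z.1, J z.2).

Lemma deriv_lipschitzN (p : E -> R) z0 d B M : deriv_lipschitz p z0 d B M ->
  deriv_lipschitz (fun z => - p z) z0 d B M.
Proof.
move=> H y y' hy hy'.
have eN x : `|x - z0| < d -> forall h, 'd (fun z => - p z) x h = - 'd p x h.
  move=> hx h; have [dx _ _] := H x x hx hx.
  have [_ e] := is_diffN (differentiableP dx).
  exact: (congr1 (fun f => f h) e).
have [dp b l] := H y y' hy hy'; split; first exact: differentiableN.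
  by move=> h; rewrite eN// normrN.
by move=> h; rewrite !eN// -opprD normrN.
Qed.

End Closure.
End HolomorphicDerivative.

Section HolomorphicSmooth.
Variable R : realType.
Section Closure.
Variables (E : normedModType R) (J : E -> E) (C : R).
Hypotheses (lJ : linear J) (C1 : 1 <= C) (JC : forall v, `|J v| <= C * `|v|).

(** The Cauchy formula writes the tangent map near each point as a circle integral that can be
    differentiated; the Cauchy-Riemann equations of the integrand pass to the integral. Hence the
    tangent map is again holomorphic, which is the inductive step towards smoothness. *)
Lemma hol_derivative D p q : open D -> hol J D p q ->
  hol (Jpair J) [set z : (E * E)%type | D z.1]
    (fun z : (E * E)%type => 'd p (z.1) z.2) (fun z : (E * E)%type => 'd q (z.1) z.2).
Proof.
move=> oD H [z0 v0] /= Dz0.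
have [d [B [M [[d0 B0 M0] dD Hp Hq]]]] := hol_deriv_lipschitz C1 JC oD H Dz0.
pose eta := d / (8 * C * (`|v0| + 1)).
have v00 := normr_ge0 v0.
have C0 : 0 < C by exact: lt_le_trans ltr01 C1.
have v10 : 0 < `|v0| + 1 by rewrite ltr_wpDl.
have eta0 : 0 < eta by rewrite divr_gt0// !mulr_gt0.
have pi0 : 0 < pi :> R by exact: pi_gt0.
have pi20 : 0 < 2 * pi :> R by rewrite mulr_gt0// pi_gt0.
have formula f g : hol J D f g -> \forall x \near (z0, v0), cauchy_deriv J f g eta x = 'd f (x.1) x.2.
  move=> Hfg; apply/nbhs_ballP; exists (Num.min 1 (d / 2)).
    by rewrite /= lt_min ltr01 divr_gt0.
  move=> [z v]; rewrite -ball_normE /= lt_min => /andP[h1 h2].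
  have n1 : `|z0 - z| <= `|(z0, v0) - (z, v)| by rewrite prod_normE le_max lexx.
  have n2 : `|v0 - v| <= `|(z0, v0) - (z, v)| by rewrite prod_normE le_max lexx orbT.
  have b1 : `|z - z0| < d / 2 by rewrite distrC; exact: le_lt_trans n1 h2.
  have b2 : `|v - v0| < 1 by rewrite distrC; exact: le_lt_trans n2 h1.
  have b3 : `|v| <= `|v0| + 1.
    by rewrite -(subrK v0 v) (le_trans (ler_normD _ _))// addrC lerD// ltW.
  have inD w : w.1 ^+ 2 + w.2 ^+ 2 < 4 -> D (disc J z (eta *: v) w).
    move=> hw; apply: dD.
    have w1 : `|w.1| <= 2 by rewrite ler_norml; have := sqr_ge0 w.2; nra.
    have w2 : `|w.2| <= 2 by rewrite ler_norml; have := sqr_ge0 w.1; nra.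
    rewrite -(subrKA z) (le_lt_trans (ler_normD _ _))//.
    have b4 := disc_bound z (eta *: v) C1 JC w1 w2.
    have b5 : 2 * C * 2 * `|eta *: v| <= d / 2.
      rewrite normrZ (gtr0_norm eta0).
      have -> : d / 2 = 2 * C * 2 * (eta * (`|v0| + 1)) by rewrite /eta; field; rewrite !gt_eqF.
      by rewrite ler_wpM2l ?mulr_ge0 ?ler_wpM2l// ltW.
    lra.
  have [_ h] := hol_circle_int Hfg inD.
  rewrite /cauchy_deriv h linearZ /=; move: ('d f z v) => X.
  have fld (a e : R) : 0 < a -> 0 < e -> (a * e)^-1 * (a * (e * X)) = X.
    by move=> a0 e0; field; rewrite !gt_eqF.
  exact: fld.
(* The formula for the differential of [q] is the one for [p] applied to the pair [(q, - p)]. *)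
have Hr := hol_rot H.
have dp := cauchy_deriv_is_diff lJ C1 JC d0 B0 M0 Hp Hq (erefl eta).
have dq := cauchy_deriv_is_diff lJ C1 JC d0 B0 M0 Hq (deriv_lipschitzN Hp) (erefl eta).
have [dP eP] := near_eq_diff (formula _ _ H) (@ex_diff _ _ _ _ _ _ _ dp).
have [dQ eQ] := near_eq_diff (formula _ _ Hr) (@ex_diff _ _ _ _ _ _ _ dq).
have {}eP h := etrans (congr1 (fun f => f h) eP) (congr1 (fun f => f h) (@diff_val _ _ _ _ _ _ _ dp)).
have {}eQ h := etrans (congr1 (fun f => f h) eQ) (congr1 (fun f => f h) (@diff_val _ _ _ _ _ _ _ dq)).
suff g h : cauchy_deriv_diff J p q eta (z0, v0) (Jpair J h) =
      - cauchy_deriv_diff J q (fun z => - p z) eta (z0, v0) h /\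
    cauchy_deriv_diff J q (fun z => - p z) eta (z0, v0) (Jpair J h) =
      cauchy_deriv_diff J p q eta (z0, v0) h.
  split; [exact: dP|exact: dQ|move=> h; have [g1 g2] := g h; split].
    exact: etrans (eP _) (etrans g1 (esym (congr1 (@GRing.opp R) (eQ h)))).
  exact: etrans (eQ _) (etrans g2 (esym (eP h))).
rewrite /cauchy_deriv_diff.

have JD u v : J (u + v) = J u + J v by have := lJ 1 u v; rewrite !scale1r.
have J0 : J 0 = 0 by apply: (addrI (J 0)); rewrite -JD !addr0.
have JZ k v : J (k *: v) = k *: J v by have := lJ k v 0; rewrite J0 !addr0.
pose c t := disc J z0 (eta *: v0) (circle 1 t); pose w t := disc J h.1 (eta *: h.2) (circle 1 t).
have wJ t : disc J (Jpair J h).1 (eta *: (Jpair J h).2) (circle 1 t) = J (w t).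
  by rewrite /w /disc /= -!JZ !JD !JZ.
have cd t : `|c t - z0| < d.
  have c1 : `|(circle 1 t).1| <= 1 by rewrite /= mul1r cos_max.
  have c2 : `|(circle 1 t).2| <= 1 by rewrite /= mul1r sin_max.
  apply: (le_lt_trans (disc_bound z0 (eta *: v0) C1 JC c1 c2)).
  rewrite mulr1 normrZ (gtr0_norm eta0).
  have : 2 * C * (eta * `|v0|) <= 2 * C * (eta * (`|v0| + 1)).
    rewrite ler_wpM2l//; first by rewrite mulr_ge0// ltW.
    by rewrite ler_wpM2l ?lerDl// ltW.
  have -> : 2 * C * (eta * (`|v0| + 1)) = d / 4 by rewrite /eta; field; rewrite !gt_eqF.
  lra.
have dcp t : differentiable p (c t) by have [] := Hp _ _ (cd t) (cd t).
have dcq t : differentiable q (c t) by have [] := Hq _ _ (cd t) (cd t).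
have cw : continuous w by exact: disc_circle_continuous.
have cc : continuous c by exact: disc_circle_continuous.
have cp := deriv_lipschitz_continuous M0 Hp cd cc cw.
have cq := deriv_lipschitz_continuous M0 Hq cd cc cw.
have eN t v : 'd (fun z => - p z) (c t) v = - 'd p (c t) v.
  have [_ e] := is_diffN (differentiableP (dcp t)).
  exact: (congr1 (fun f => f v) e).
have cN : continuous (fun t => 'd (fun z => - p z) (c t) (w t)).
  rewrite (_ : (fun t => _) = fun t => - 'd p (c t) (w t)); last by apply/funext => s; rewrite eN.
  by move=> t; apply: (@cvgN _ _ _ _ _ _ _ (cp t)).
have HJ t := H _ (dD _ (cd t)).
split.
  rewrite -mulrN; congr (_ * _).
  rewrite -mulN1r -prim_intZ ?ltW//.
    congr prim_int; apply/funext => t; rewrite wJ -/(c t) -/(w t) eN.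
    have [_ _ /(_ (w t)) [h1 h2]] := HJ t.
    transitivity (- 'd q (c t) (w t) * cos t + 'd p (c t) (w t) * sin t).
      by congr (_ * _ + _ * _).
    move: ('d q _ _) ('d p _ _) => a b; ring.
  move=> t; apply: cvgD; apply: cvgM; try exact: continuous_cos; try exact: continuous_sin.
    exact: cq.
  exact: cN.
congr (_ * _); congr prim_int; apply/funext => t; rewrite wJ -/(c t) -/(w t) eN.
have [_ _ /(_ (w t)) [h1 h2]] := HJ t.
transitivity ('d p (c t) (w t) * cos t + - (- 'd q (c t) (w t)) * sin t).
  by congr (_ * _ + - _ * _).
by rewrite opprK.
Qed.

End Closure.

(** The space and its complex structure vary in the induction, since the tangent map lives on the
    square of [E] with [Jpair]. The bound [C] is preserved because the norm of a product is a
    maximum. *)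
Lemma hol_Ck k (E : normedModType R) (J : E -> E) (C : R) (D : set E) p q :
  linear J -> 1 <= C -> (forall v, `|J v| <= C * `|v|) -> open D -> hol J D p q ->
  Ck k D p /\ Ck k D q.
Proof.
elim: k E J D p q => [|k IH] E J D p q lJ C1 JC oD H.
  by split => x /H[].
have lJ2 : linear (Jpair J) by move=> a u v; rewrite /Jpair /= !lJ.
have JC2 v : `|Jpair J v| <= C * `|v|.
  have C0 : 0 <= C by exact: le_trans ler01 C1.
  rewrite !prod_normE /= ge_max.
  rewrite (le_trans (JC _)) ?ler_wpM2l ?le_max ?lexx//=.
  by rewrite (le_trans (JC _))// ler_wpM2l// le_max lexx orbT.
have [h1 h2] := IH _ _ _ _ _ lJ2 C1 JC2 (open_fst oD) (hol_derivative lJ C1 JC oD H).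
by split; split => //; move=> x /H[].
Qed.

End HolomorphicSmooth.

(** * Hartogs extension *)

Lemma open_neq0 (K : numFieldType) (E : normedModType K) : open [set z : E | z != 0].
Proof.
rewrite (_ : [set z : E | z != 0] = ~` [set 0]); last first.
  by apply/seteqP; split => z /= /eqP.
apply: closed_openC; apply: accessible_closed_set1; apply: hausdorff_accessible.
exact: norm_hausdorff.
Qed.

Lemma angle_exists (R : realType) (a b : R) : a ^+ 2 + b ^+ 2 = 1 ->
  exists t, a = cos t /\ b = sin t.
Proof.
move=> h; have a1 : -1 <= a <= 1 by apply/andP; split; nra.
have b2 : 1 - a ^+ 2 = b ^+ 2 by rewrite -h addrC addKr.
have [b0|b0] := leP 0 b.
  by exists (acos a); rewrite acosK// sin_acos// b2 sqrtr_sqr ger0_norm.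
exists (- acos a); rewrite cosN sinN acosK// sin_acos// b2 sqrtr_sqr ltr0_norm//.
by rewrite opprK.
Qed.

Section Hartogs.
Variables (R : realType) (E : normedModType R) (J : E -> E) (C : R).
Hypotheses (lJ : linear J) (C1 : 1 <= C) (JC : forall v, `|J v| <= C * `|v|).

Lemma deriv_lipschitz_sub (p : E -> R) z0 z d d' B B' M M' :
  deriv_lipschitz p z0 d B M -> `|z - z0| + d' <= d -> B <= B' -> M <= M' ->
  deriv_lipschitz p z d' B' M'.
Proof.
move=> H dd BB MM y y' hy hy'.
have tr x : `|x - z| < d' -> `|x - z0| < d.
  by move=> h; rewrite -(subrKA z) (le_lt_trans (ler_normD _ _))//; lra.
have [dp b l] := H _ _ (tr _ hy) (tr _ hy'); split => // h.
  by rewrite (le_trans (b h))// ler_wpM2r.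
by rewrite (le_trans (l h))// ler_wpM2r// ler_wpM2r.
Qed.

Lemma compact_deriv_lipschitz (D : set E) p q (K : set E) : open D -> hol J D p q ->
  compact K -> K `<=` D -> exists d B, [/\ 0 < d, 0 <= B & forall z, K z ->
    deriv_lipschitz p z d B B /\ deriv_lipschitz q z d B B].
Proof.
move=> oD H /compact_near_coveringP cK KD.
(* One index gives both the inverse radius and the bounds, so the property weakens as [n] grows and
   compactness produces a common [n]. *)
pose P (n : nat) z := deriv_lipschitz p z (n.+1%:R^-1) n%:R n%:R /\
   deriv_lipschitz q z (n.+1%:R^-1) n%:R n%:R.
have [N _ HN] : \forall n \near \oo, K `<=` P n.
  apply: cK => z /KD Dz.
  have [d [B [M [[d0 B0 M0] _ Hp Hq]]]] := hol_deriv_lipschitz C1 JC oD H Dz.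
  exists (ball z (d / 2), [set n | d^-1 * 2 + B + M <= n%:R]) => [|[z' n] /= [+ hn]].
    by split; [apply: nbhsx_ballx; rewrite divr_gt0|exact: nbhs_infty_ger].
    rewrite -ball_normE /= distrC => hz.
    have {}hn : d^-1 * 2 + B + M <= n%:R := hn.
    have d20 : 0 < d^-1 * 2 by rewrite mulr_gt0 ?invr_gt0.
    have hd : n.+1%:R^-1 <= d / 2.
      rewrite -[d / 2]invrK lef_pV2 ?posrE ?invr_gt0 ?divr_gt0//.
      by rewrite invf_div mulrC -natr1; lra.
    have hB : B <= n%:R by lra.
    have hM : M <= n%:R by lra.
    have hz' : `|z' - z| + n.+1%:R^-1 <= d by rewrite [leRHS]splitr lerD// ltW.
    by split; [exact: (deriv_lipschitz_sub Hp)|exact: (deriv_lipschitz_sub Hq)].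
exists N.+1%:R^-1, N%:R; split => //.
by move=> z Kz; exact: (HN N (leqnn N)).
Qed.

Lemma disc_shift (x y w : E) v : disc J x w v - disc J y w v = x - y.
Proof. by rewrite /disc opprD addrACA subrr add0r. Qed.

Definition circle_mean (w : E) (p : E -> R) (z : E) : R :=
  (2 * pi)^-1 * prim_int 0 (2 * pi) (fun t => p (disc J z w (circle 1 t))).

(** Compactness of the circle makes the Lipschitz constants uniform along it. Only the circle has to
    lie in [D], not its centre [z0]: this is what allows the mean to cross a singularity. *)
Lemma circle_mean_diff (D : set E) p q w z0 : open D -> hol J D p q ->
  (forall t, D (disc J z0 w (circle 1 t))) ->
  is_diff z0 (circle_mean w p)
    (fun h => circle_mean w (fun y => 'd p y h) z0) /\
  continuous (fun t => p (disc J z0 w (circle 1 t))) /\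
  forall h, continuous (fun t => 'd p (disc J z0 w (circle 1 t)) h).
Proof.
move=> oD H HD.
have pi20 : 0 <= 2 * pi :> R by rewrite mulr_ge0// pi_ge0.
pose c t := disc J z0 w (circle 1 t).
have cc : continuous c by exact: disc_circle_continuous.
have dc t : c t = disc J z0 w (circle 1 t) by [].
have [d [B [d0 B0 HB]]] : exists d B, [/\ 0 < d, 0 <= B & forall t,
    deriv_lipschitz p (c t) d B B].
  have S1c : compact [set v : (R * R)%type | v.1 ^+ 2 + v.2 ^+ 2 = 1].
    apply: (@subclosed_compact _ _ ((`[-1, 1] : set R) `*` (`[-1, 1] : set R))).
    - apply: (@closed_comp _ _ (fun v : (R * R)%type => v.1 ^+ 2 + v.2 ^+ 2) [set x : R | x = 1]); last exact: closed_eq.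
      by move=> v _; apply: cvgD; rewrite expr2; apply: cvgM; try exact: cvg_fst; exact: cvg_snd.
    - by apply: compact_setX; exact: segment_compact.
    - by move=> [a b] /= h; rewrite !in_itv /=; split; apply/andP; split; nra.
  have Kc : compact (disc J z0 w @` [set v : (R * R)%type | v.1 ^+ 2 + v.2 ^+ 2 = 1]).
    apply: continuous_compact => //; apply: continuous_subspaceT => v.
    by have [dd _] := disc_diff J z0 w v; exact: differentiable_continuous.
  have KD : disc J z0 w @` [set v : (R * R)%type | v.1 ^+ 2 + v.2 ^+ 2 = 1] `<=` D.
    move=> _ [[a b] /= ab <-]; have [t [-> ->]] := angle_exists ab.
    by have := HD t; rewrite /circle !mul1r.
  have [d [B [d0 B0 HB]]] := compact_deriv_lipschitz oD H Kc KD.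
  exists d, B; split => // t; have [] // := HB (c t) _.
  by exists (circle 1 t) => //=; rewrite !mul1r cos2Dsin2.
have c0 t : `|c t - c t| < d by rewrite subrr normr0.
have dp y t : `|y - c t| < d -> differentiable p y by move=> h; have [] := HB t y y h h.
have cp x : `|x - z0| < d -> continuous (fun t => p (disc J x w (circle 1 t))).
  move=> hx t; apply: (@continuous_comp _ _ _ (fun t => disc J x w (circle 1 t)) p t).
    exact: disc_circle_continuous.
  apply: differentiable_continuous; apply: (dp _ t).
  by rewrite /c disc_shift.
have cdp h : continuous (fun t => 'd p (c t) h).
  move=> t; apply/cvgrPdist_lt => e e0.
  have Bh : 0 < B * `|h| + 1 by rewrite ltr_wpDl// mulr_ge0.
  have m0 : 0 < Num.min d (e / (B * `|h| + 1)) by rewrite lt_min d0 divr_gt0.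
  have /cvgrPdist_lt/(_ _ m0) := cc t; apply: filterS => s.
  rewrite lt_min => /andP[h1 h2].
  rewrite distrC in h1; have [_ _ l] := HB t _ _ (c0 t) h1.
  apply: (le_lt_trans (l h)).
  move: h2; rewrite ltr_pdivlMr// => h2.
  have := normr_ge0 (c t - c s); nra.
split; last by split; [apply: (cp z0); rewrite subrr normr0|exact: cdp].
have h1 := @diff_under_int R E (fun x t => p (disc J x w (circle 1 t))) (fun t h => 'd p (c t) h) z0
   0 (2 * pi) d B pi20 d0 B0 _ cdp cp _ _.
have [|||d1 e1] := h1.
- by move=> t a u v; rewrite linearP.
- move=> x t _ hx.
  have e : disc J x w (circle 1 t) - c t = x - z0.
    by rewrite /c disc_shift.
  have := deriv_lipschitz_taylor B0 (HB t) (c0 t) (_ : `|disc J x w (circle 1 t) - c t| < d).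
  by rewrite e; apply.
- by move=> t h _; have [_ + _] := HB t _ _ (c0 t) (c0 t); apply.
have h2 : is_diff z0 (fun x => prim_int 0 (2 * pi) (fun t => p (disc J x w (circle 1 t))))
  (fun h => prim_int 0 (2 * pi) (fun t => 'd p (c t) h)) by apply: DiffDef.
have [d2 e2] := is_diffZ (2 * pi)^-1 h2.
by apply: DiffDef; [exact: d2|rewrite e2].
Qed.

(* For [z] off the complex line through [w] the disc around [z] avoids [0] and
   the mean over its boundary is the value at [z]; the mean is differentiable
   across [0], hence extends the function. *)
Lemma hartogs (p q : E -> R) (w u : E) (c : R) : 0 < c ->
  (forall t, c <= `|disc J 0 w (circle 1 t)|) ->
  (forall (t : R) v, t *: u = disc J 0 w v -> t = 0) ->
  hol J [set z | z != 0] p q ->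
  exists a b, hol J setT (fun z => if z == 0 then a else p z)
                         (fun z => if z == 0 then b else q z).
Proof.
move=> c0 wc uw H.
have oD := @open_neq0 R E.
exists (circle_mean w p 0), (circle_mean w q 0).
have HD z t : `|z| < c -> disc J z w (circle 1 t) != 0.
  move=> zc; apply/negP => /eqP; rewrite /disc => /eqP; rewrite addr_eq0 => /eqP e.
  by have := wc t; rewrite /disc addr0 e normrN leNgt zc.
have diff f g z : hol J [set z | z != 0] f g -> `|z| < c ->
    [/\ is_diff z (circle_mean w f) (fun h => circle_mean w (fun y => 'd f y h) z),
       continuous (fun t => f (disc J z w (circle 1 t))) &
       forall h, continuous (fun t => 'd f (disc J z w (circle 1 t)) h)].
  by move=> Hf zc; have [h1 [h2 h3]] := @circle_mean_diff _ _ _ w z oD Hf (fun t => HD z t zc).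
have off f g z : hol J [set z | z != 0] f g -> (forall v, z <> disc J 0 w v) -> circle_mean w f z = f z.
  move=> Hf zw; have [|h _] := hol_circle_int (z := z) (v := w) Hf.
    move=> v _ /=; apply/negP => /eqP; rewrite /disc => /eqP; rewrite addrC addr_eq0 => /eqP e.
    apply: (zw (- v.1, - v.2)); rewrite e /disc /= addr0 opprD.
    by rewrite !scaleNr.
  rewrite /circle_mean h mulrA mulVf ?mul1r//.
  by rewrite mulf_neq0// gt_eqF// pi_gt0.
have eqm f g z : hol J [set z | z != 0] f g -> z != 0 -> `|z| < c -> circle_mean w f z = f z.
  move=> Hf z0 zc.
  have [zw|/existsNP[v /contrapT zv]] := pselect (forall v, z <> disc J 0 w v).
    exact: (off f g z Hf zw).
  (* Here [z] lies on the complex line of [w]. The direction [u] leaves that line, so [z] is a limit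
     of points where the equality is known, and both sides are continuous at [z]. *)
  pose l (t : R) := z + t *: u.
  have lc : continuous l.
    by move=> t; apply: cvgD; [exact: cvg_cst|apply: cvgZr_tmp; exact: cvg_id].
  have l0 : l 0 = z by rewrite /l scale0r addr0.
  have [[dm _] _ _] := diff _ _ _ Hf zc.
  have [df _ _] := Hf _ z0.
  pose h y := circle_mean w f y - f y.
  suff hz : h z = 0 by apply/eqP; rewrite -subr_eq0; exact/eqP.
  have ch : h (l t) @[t --> (0 : R)] --> h (l 0).
    apply: (@continuous_comp _ _ _ l h 0); first exact: lc.
    rewrite l0; apply: (@differentiable_continuous _ _ _ z h).
    exact: differentiableB.
  rewrite l0 in ch.
  apply: (@le_eps0 _ _ 1) => e e0; rewrite mul1r.
  have /cvgrPdist_lt/(_ e e0) := ch.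
  move=> /nbhs_ballP[r /= r0 Hr].
  have t0 : r / 2 != 0 by rewrite gt_eqF// divr_gt0.
  have rt : ball 0 r (r / 2).
    by rewrite -ball_normE /= sub0r normrN gtr0_norm ?divr_gt0//; lra.
  have := Hr _ rt; rewrite /= /h (off _ _ (l (r / 2)) Hf).
    by rewrite subrr subr0 => /ltW.
  move=> v' lv; case/eqP: t0; apply: (uw _ (v'.1 - v.1, v'.2 - v.2)).
  move: lv; rewrite /l zv /disc /= !addr0 => lv.
  have -> : (r / 2) *: u = (v'.1 *: w + v'.2 *: J w) - (v.1 *: w + v.2 *: J w).
    by rewrite -lv addrC addKr.
  by rewrite !scalerBl opprD addrACA.
have near_diff f g a z : hol J [set z | z != 0] f g -> z != 0 ->
    is_diff z (fun z => if z == 0 then a else f z) ('d f z).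
  move=> Hf z0; have [df _ _] := Hf _ z0; apply: near_eq_diff => //.
  have : nbhs z [set z : E | z != 0] by exact: open_nbhs_nbhs.
  by apply: filterS => y /= /negPf ->.
have n0 : `|0 : E| < c by rewrite normr0.
have near_diff0 f g : hol J [set z | z != 0] f g ->
    is_diff 0 (fun z => if z == 0 then circle_mean w f 0 else f z)
      (fun h => circle_mean w (fun y => 'd f y h) 0).
  move=> Hf; have [[dm em] _ _] := diff _ _ _ Hf n0.
  rewrite -em; apply: near_eq_diff => //.
  have : \forall y \near (0 : E), `|0 - y| < c by apply: cvgr_dist_lt => //; exact: cvg_id.
  apply: filterS => y; rewrite sub0r normrN => yc.
  by case: eqP => [->//|/eqP y0]; exact: (eqm _ _ _ Hf).
move=> z _.
have [->|z0] := eqVneq z 0; last first.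
  have hp := near_diff p q (circle_mean w p 0) z H z0.
  have hq := near_diff q (fun z => - p z) (circle_mean w q 0) z (hol_rot H) z0.
  by have [_ _ hc] := H _ z0; exact: (hol_intro hp hq hc).
have [dp ep] := near_diff0 p q H.
have [dq eq] := near_diff0 q (fun z => - p z) (hol_rot H).
have [_ _ c3] := diff _ _ _ H n0; have [_ _ c4] := diff _ _ _ (hol_rot H) n0.
have Ht t v : 'd p (disc J 0 w (circle 1 t)) (J v) = - 'd q (disc J 0 w (circle 1 t)) v /\
   'd q (disc J 0 w (circle 1 t)) (J v) = 'd p (disc J 0 w (circle 1 t)) v.
  by have [_ _] := H _ (HD 0 t n0); apply.
have pi20 : 0 <= 2 * pi :> R by rewrite mulr_ge0// pi_ge0.
split => // v.
have e1 := congr1 (fun f => f (J v)) ep; have e2 := congr1 (fun f => f v) eq.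
have e3 := congr1 (fun f => f (J v)) eq; have e4 := congr1 (fun f => f v) ep.
split.
  apply: etrans e1 (etrans _ (esym (congr1 (@GRing.opp R) e2))).
  rewrite /circle_mean -mulrN; congr (_ * _).
  rewrite -mulN1r -prim_intZ//; congr prim_int; apply/funext => t.
  by rewrite mulN1r; have [] := Ht t v.
apply: etrans e3 (etrans _ (esym e4)).
by rewrite /circle_mean; congr (_ * prim_int _ _ _); apply/funext => t; have [] := Ht t v.
Qed.

End Hartogs.

(** * Real coordinates and lifts *)

Lemma mx_norm_coord (K : numDomainType) m n (x : 'M[K]_(m, n)) i j : `|x i j| <= `|x|.
Proof.
have : `|x| <= `|x| by [].
rewrite [leLHS]/Num.norm /= mx_normE -[X in _ <= X]/((NngNum (normr_ge0 x))%:num) num_le.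
by move=> /bigmax_leP[_ /(_ (i, j) isT)]; rewrite -num_le.
Qed.

Lemma mx_norm_le (K : numDomainType) m n (x : 'M[K]_(m, n)) (c : K) : 0 <= c ->
  (forall i j, `|x i j| <= c) -> `|x| <= c.
Proof.
move=> c0 H; rewrite [leLHS]/Num.norm /= mx_normE.
rewrite -[c]/((NngNum c0)%:num) num_le; apply/bigmax_leP; split.
  by rewrite -num_le.
by move=> [i j] _; rewrite -num_le /=.
Qed.

Section RealCoords.
Variables (R : realType) (n : nat).
Implicit Types (z : Cn R n) (x : 'rV[R]_(n + n)).

Definition complex_coords x : Cn R n :=
  \row_j (x 0 (lshift n j) +i* x 0 (rshift n j)).

Lemma real_coordsl z j : real_coords z 0 (lshift n j) = complex.Re (z 0 j).
Proof. by rewrite /real_coords row_mxEl mxE. Qed.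

Lemma real_coordsr z j : real_coords z 0 (rshift n j) = complex.Im (z 0 j).
Proof. by rewrite /real_coords row_mxEr mxE. Qed.

Lemma real_coordsK : cancel (@real_coords R n) complex_coords.
Proof.
move=> z; apply/rowP => j; rewrite mxE real_coordsl real_coordsr.
by case: (z 0 j).
Qed.

Lemma complex_coordsK : cancel complex_coords (@real_coords R n).
Proof.
move=> x; apply/rowP => k; rewrite -(splitK k); case: (fintype.split k) => j /=.
  by rewrite real_coordsl mxE.
by rewrite real_coordsr mxE.
Qed.

Lemma real_coordsD z w : real_coords (z + w) = real_coords z + real_coords w.
Proof.
rewrite /real_coords add_row_mx; congr row_mx; apply/rowP => j; rewrite !mxE;
  by case: (z 0 j) (w 0 j) => ? ? [].
Qed.

Lemma real_coordsZ (k : R) z : real_coords (k%:C *: z) = k *: real_coords z.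
Proof.
rewrite /real_coords scale_row_mx; congr row_mx; apply/rowP => j; rewrite !mxE;
  by case: (z 0 j) => a b; rewrite /= mul0r ?subr0 ?addr0.
Qed.

Lemma real_coordsN z : real_coords (- z) = - real_coords z.
Proof. by rewrite -scaleN1r -[in RHS]scaleN1r -real_coordsZ rmorphN1. Qed.

Lemma real_coordsB z w : real_coords (z - w) = real_coords z - real_coords w.
Proof. by rewrite real_coordsD real_coordsN. Qed.

Lemma real_coords0 : real_coords (0 : Cn R n) = 0.
Proof. by rewrite -(subrr 0) real_coordsB subrr. Qed.

Lemma complex_coordsD x y : complex_coords (x + y) = complex_coords x + complex_coords y.
Proof. by apply: (can_inj real_coordsK); rewrite real_coordsD !complex_coordsK. Qed.

Lemma complex_coordsB x y : complex_coords (x - y) = complex_coords x - complex_coords y.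
Proof. by apply: (can_inj real_coordsK); rewrite real_coordsB !complex_coordsK. Qed.

Lemma complex_coordsZ (k : R) x : complex_coords (k *: x) = k%:C *: complex_coords x.
Proof. by apply: (can_inj real_coordsK); rewrite real_coordsZ !complex_coordsK. Qed.

Lemma complex_coords0 : complex_coords 0 = 0.
Proof. by apply: (can_inj real_coordsK); rewrite complex_coordsK real_coords0. Qed.

Lemma normc_ge_Im (c : R[i]) : `|complex.Im c|%:C <= `|c|.
Proof.
case: c => a b; rewrite normc_def lecR /= -sqrtr_sqr ler_sqrt; last first.
  by rewrite addr_ge0 ?sqr_ge0.
by rewrite lerDr sqr_ge0.
Qed.

Lemma norm_real_coords z : `|real_coords z|%:C <= `|z|.
Proof.
have h (c : R) k : `|real_coords z 0 k|%:C <= `|z|.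
  rewrite -(splitK k); case: (fintype.split k) => j /=.
    by rewrite real_coordsl (le_trans (normc_ge_Re _))// mx_norm_coord.
  by rewrite real_coordsr (le_trans (normc_ge_Im _))// mx_norm_coord.
have : `|z| \is Num.real by rewrite normr_real.
move=> /complex_realP[c ec]; rewrite ec lecR; apply: mx_norm_le.
  by rewrite -lecR -ec normr_ge0.
by move=> i k; rewrite -lecR -ec ord1; exact: h.
Qed.

Lemma norm_complex_coords x : `|complex_coords x| <= (2 * `|x|)%:C.
Proof.
apply: mx_norm_le; first by rewrite ler0c mulr_ge0.
move=> i j; rewrite mxE normc_def /= lecR.
apply: (@le_trans _ _ (`|x 0 (lshift n j)| + `|x 0 (rshift n j)|)); last first.
  by rewrite mulr_natl mulr2n lerD// mx_norm_coord.
set a := x _ _; set b := x _ _.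
rewrite -[leRHS]ger0_norm ?addr_ge0// -sqrtr_sqr ler_sqrt ?sqr_ge0//.
rewrite sqrrD !real_normK ?num_real// lerD2r lerDl.
by rewrite mulrn_wge0// mulr_ge0.
Qed.

Definition mulI x : 'rV[R]_(n + n) := real_coords ('i *: complex_coords x).

Lemma mulI_linear : linear mulI.
Proof.
move=> k x y; rewrite /mulI complex_coordsD complex_coordsZ scalerDr real_coordsD.
by rewrite scalerA mulrC -scalerA real_coordsZ.
Qed.

Lemma mulI_bound x : `|mulI x| <= 2 * `|x|.
Proof.
rewrite -lecR (le_trans (norm_real_coords _))// normrZ.
have -> : `|'i : R[i]| = 1 by rewrite normc_def /= expr0n expr1n add0r sqrtr1.
by rewrite mul1r norm_complex_coords.
Qed.

Lemma mulI_left x j : mulI x 0 (lshift n j) = - x 0 (rshift n j).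
Proof. by rewrite real_coordsl !mxE /= mul0r mul1r add0r. Qed.

Lemma mulI_right x j : mulI x 0 (rshift n j) = x 0 (lshift n j).
Proof. by rewrite real_coordsr !mxE /= mul0r mul1r add0r. Qed.

End RealCoords.

Section RealDifferential.
Variables (R : realType) (m n : nat).

Definition realify (g : Cn R m -> Cn R n) (x : 'rV[R]_(m + m)) : 'rV[R]_(n + n) :=
  real_coords (g (complex_coords x)).

(** The two differentials live over different scalar fields, so the chain rule does not apply; the
    defining estimate is transferred by hand, the comparison of the two sup norms costing a factor
    2. *)
Lemma is_diff_realify (g : Cn R m -> Cn R n) (x : 'rV[R]_(m + m)) :
  differentiable g (complex_coords x) ->
  is_diff x (realify g) (realify ('d g (complex_coords x))).
Proof.
set z := complex_coords x => dg.
have ll : linear (realify ('d g z)).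
  move=> k u v; rewrite /realify complex_coordsD complex_coordsZ linearP.
  by rewrite real_coordsD real_coordsZ.
have [k k0 lk] := linear_lipschitz (diff_continuous dg).
have kr : k = (complex.Re k)%:C by rewrite RRe_real// gtr0_real.
have lb v : `|realify ('d g z) v| <= complex.Re k * 2 * `|v|.
  rewrite -lecR (le_trans (norm_real_coords _))// (le_trans (lk _))//.
  have -> : (complex.Re k * 2 * `|v|)%:C = k * (2 * `|v|)%:C.
    by rewrite [in RHS]kr -rmorphM /= mulrA.
  rewrite ler_wpM2l ?(ltW k0)//.
  exact: norm_complex_coords.
have k20 : 0 <= complex.Re k * 2 by rewrite mulr_ge0// -ler0c -kr ltW.
have lc := linear_bound_continuous ll k20 lb.
pose l : {linear 'rV[R]_(m + m) -> 'rV[R]_(n + n)} :=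
  HB.pack (realify ('d g z)) (GRing.isLinear.Build R _ _ *:%R _ ll).
suff : is_diff x (realify g) l by [].
apply: diff_intro => // e e0.
have [d d0 H] : exists2 d : R[i], 0 < d & forall y, `|y - z| < d ->
    `|g y - g z - 'd g z (y - z)| <= (e / 2)%:C * `|y - z|.
  by apply: diff_eps_delta => //; rewrite ltcR divr_gt0.
have dr : d = (complex.Re d)%:C by rewrite RRe_real// gtr0_real.
have rd0 : 0 < complex.Re d by rewrite -ltcR -dr.
apply/nbhs_ballP; exists (complex.Re d / 2); first by rewrite /= divr_gt0.
move=> h; rewrite -ball_normE /= sub0r normrN => hd.
have hz : complex_coords (h + x) - z = complex_coords h by rewrite complex_coordsD addrK.
have := H (complex_coords (h + x)); rewrite hz => H1.
rewrite -lecR -!real_coordsB.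
apply: (le_trans (norm_real_coords _)); apply: (le_trans (H1 _)).
  apply: (le_lt_trans (norm_complex_coords _)); rewrite dr ltcR.
  by rewrite mulrC -ltr_pdivlMr.
have -> : e * `|h| = e / 2 * (2 * `|h|) by field.
rewrite [leRHS](rmorphM (real_complex R)) ler_wpM2l ?norm_complex_coords//.
by rewrite ler0c divr_ge0// ltW.
Qed.

Lemma hol_realify (D : set (Cn R m)) (g : Cn R m -> Cn R n) j :
  holomorphic_on D g ->
  hol (@mulI R m) [set x | D (complex_coords x)]
    (fun x => realify g x 0 (lshift n j)) (fun x => realify g x 0 (rshift n j)).
Proof.
move=> H x /= /H dg; have hr := is_diff_realify dg.
have dc k : is_diff x (fun x => realify g x 0 k) (fun v => realify ('d g (complex_coords x)) v 0 k).
  pose c := (fun v : 'rV[R]_(n + n) => v 0 k).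
  have lc : linear c by move=> a u v; rewrite /c !mxE.
  pose L : {linear 'rV[R]_(n + n) -> R} := HB.pack c (GRing.isLinear.Build R _ _ *:%R c lc).
  have cL : continuous L by exact: coord_continuous.
  have hL : is_diff (realify g x) L L.
    by apply: DiffDef; [exact: linear_differentiable|rewrite diff_lin].
  have [d e] := @is_diff_comp _ _ _ _ (realify g) _ L _ x hr hL.
  by apply: DiffDef.
apply: (hol_intro (dc (lshift n j)) (dc (rshift n j))) => v.
have -> : realify ('d g (complex_coords x)) (mulI v) = mulI (realify ('d g (complex_coords x)) v).
  by rewrite /realify /mulI !real_coordsK linearZ.
by rewrite mulI_left mulI_right.
Qed.

Lemma Csmooth_realify (D : set (Cn R m)) (g : Cn R m -> Cn R n) :
  open [set x | D (complex_coords x)] -> holomorphic_on D g ->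
  Csmooth [set x | D (complex_coords x)] (realify g).
Proof.
move=> oD H k; apply: Ck_row => // i.
have l12 : 1 <= 2 :> R by rewrite ler1n.
have h j := hol_Ck k (@mulI_linear R m) l12 (@mulI_bound R m) oD (hol_realify j H).
rewrite -(splitK i); case: (fintype.split i) => j /=.
  by have [] := h j.
by have [] := h j.
Qed.

End RealDifferential.

Lemma within_open_preimage (T U : topologicalType) (A : set T) (f : T -> U) (X : set U) :
  open A -> {within A, continuous f} -> open X -> open (A `&` f @^-1` X).
Proof.
move=> oA; rewrite continuous_open_subspace// => cf.
by have [h _] := @continuous_inP T U A f oA; apply: h.
Qed.

Lemma open_within (T U : topologicalType) (A : set T) (f : T -> U) :
  open A -> (forall X, open X -> open (A `&` f @^-1` X)) -> {within A, continuous f}.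
Proof. move=> oA H; rewrite continuous_open_subspace//.
by have [_ h] := @continuous_inP T U A f oA; apply: h. Qed.

Lemma chart_image_open (T E : topologicalType) (c : chart T E) (O : set T) :
  is_chart c -> open O -> O `<=` chart_dom c -> open (chart_fun c @` O).
Proof.
move=> [oU oV cf [g [cg gK]]] oO sO.
have -> : chart_fun c @` O = (chart_fun c @` chart_dom c) `&` g @^-1` O.
  apply/seteqP; split => [_ [x Ox <-]|y [[x Ux <-]] /=].
    by split; [exists x => //; exact: sO|rewrite /= gK//; exact: sO].
  by rewrite gK// => Ox; exists x.
exact: within_open_preimage.
Qed.

Section PuncturedSpace.
Variable R : realType.
Implicit Types (w : W R) (z : Cn R 2).

Let one2 : Cn R 2 := const_mx 1.

Lemma one2_neq0 : one2 != 0.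
Proof. by apply/eqP => /rowP/(_ ord0); rewrite !mxE => /eqP; rewrite oner_eq0. Qed.

Definition W_point : W R := exist _ one2 (mem_set one2_neq0).

(** A total inverse of the inclusion of [W R]; at 0 it takes the default value [W_point], whence the
    restriction to nonzero points in what follows. *)
Definition to_W z : W R := insubd W_point z.

Lemma to_WK z : z != 0 -> set_val (to_W z) = z.
Proof. by move=> z0; rewrite set_valE /to_W insubdK//; exact: mem_set. Qed.

Lemma val_W w : (set_val w : Cn R 2) != 0.
Proof. exact: (set_valP w). Qed.

Lemma W_valK w : to_W (set_val w) = w.
Proof. by apply: val_inj; rewrite -set_valE to_WK// val_W. Qed.

Lemma open_W_image (O : set (W R)) : open O -> open (set_val @` O : set (Cn R 2)).
Proof.
move=> [B oB BO].
have -> : (set_val @` O : set (Cn R 2)) = B `&` [set z | z != 0].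
  apply/seteqP; split => [_ [w Ow <-]|z [Bz z0]].
    by split; [move: Ow; rewrite -BO|exact: val_W].
  by exists (to_W z); rewrite -?BO /= to_WK.
apply: openI => //.
exact: open_neq0.
Qed.

Lemma val_W_continuous : continuous (set_val : W R -> Cn R 2).
Proof. exact: initial_continuous. Qed.

Lemma conj_row_conj_row z : conj_row (conj_row z) = z.
Proof. by apply/rowP => j; rewrite !mxE conjcK. Qed.

Lemma norm_conj_row z : `|conj_row z| = `|z|.
Proof.
have h y : `|conj_row y| <= `|y|.
  apply: mx_norm_le => // i j; rewrite mxE normcJ; exact: mx_norm_coord.
by apply/eqP; rewrite eq_le h /= -{1}(conj_row_conj_row z) h.
Qed.

Lemma conj_rowD z (y : Cn R 2) : conj_row (z + y) = conj_row z + conj_row y.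
Proof. by apply/rowP => j; rewrite !mxE rmorphD. Qed.

Lemma conj_rowZ (c : R[i]) z : conj_row (c *: z) = (c^*)%C *: conj_row z.
Proof. by apply/rowP => j; rewrite !mxE rmorphM. Qed.

Lemma conj_rowN z : conj_row (- z) = - conj_row z.
Proof. by apply/rowP => j; rewrite !mxE rmorphN. Qed.

(** Conjugation is not differentiable over [R[i]], but applied on both sides it turns a complex
    linear differential into a complex linear one. *)
Lemma differentiable_conj_conj (g : Cn R 2 -> Cn R 2) z :
  differentiable g (conj_row z) ->
  differentiable (@conj_row R 2 \o g \o @conj_row R 2) z.
Proof.
move=> dg; pose l := @conj_row R 2 \o 'd g (conj_row z) \o @conj_row R 2.
have ll : linear l.
  move=> c u v; rewrite /l /= conj_rowD conj_rowZ linearP conj_rowD conj_rowZ.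
  by rewrite conjcK.
have [k k0 lk] := linear_lipschitz (diff_continuous dg).
have lb v : `|l v| <= k * `|v|.
  by rewrite /l /= norm_conj_row (le_trans (lk _))// norm_conj_row.
have lc := linear_bound_continuous ll (ltW k0) lb.
pose L : {linear Cn R 2 -> Cn R 2} := HB.pack l (GRing.isLinear.Build _ _ _ *:%R l ll).
suff [] : is_diff z (@conj_row R 2 \o g \o @conj_row R 2) L by [].
apply: diff_intro => // e e0.
have [d d0 H] := diff_eps_delta dg e0.
apply/nbhs_ballP; exists d => // h; rewrite -ball_normE /= sub0r normrN => hd.
rewrite -norm_conj_row in hd.
have hz : conj_row h = conj_row (h + z) - conj_row z by rewrite conj_rowD addrK.
rewrite hz in hd; have := H _ hd; rewrite -hz norm_conj_row.
by rewrite -[X in `|X| <= _ -> _]conj_row_conj_row norm_conj_row !conj_rowD !conj_rowN.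
Qed.

Lemma image_W_nbhs (O : set (W R)) w : open O -> O w -> nbhs (set_val w : Cn R 2) (set_val @` O).
Proof.
move=> oO Ow; apply: open_nbhs_nbhs; split; first exact: open_W_image.
by exists w.
Qed.

Section Lift.
Variables (H : complex_surface R) (p : W R -> H).
Local Notation A := (surf_atlas H).
Hypothesis cov : holomorphic_covering (W_atlas R) A p.

Lemma W_chart_in : W_atlas R (Chart setT (set_val : W R -> Cn R 2)).
Proof. by []. Qed.

(* [k] is the local inverse of the covering map with values in the sheet [U]. *)
Lemma covering_sheet w : exists (U : set (W R)) (V : set H) (k : H -> W R),
  [/\ [/\ open U, U w, open V & V (p w)],
      (forall x, U x -> V (p x) /\ k (p x) = x),
      (forall y, V y -> U (k y) /\ p (k y) = y),
      regular_on (@holomorphic_on R _ _) (W_atlas R) A U p &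
      regular_on (@holomorphic_on R _ _) A (W_atlas R) V k].
Proof.
have [_ /(_ (p w)) [V [oV Vp [I [U [oU _ UV iso]]]]]] := cov.
have : (\bigcup_i U i) w by rewrite UV.
move=> [i _ Ui]; have [k [h1 h2 h3 h4]] := iso i.
by exists (U i), V, k; split.
Qed.

Lemma covering_continuous : continuous p.
Proof.
move=> w; have [U [V [k [[oU Uw oV Vp] _ _ [cp _] _]]]] := covering_sheet w.
by move: cp; rewrite continuous_open_subspace// => /(_ w); apply; exact: mem_set.
Qed.

Lemma chart_open (c : chart H (Cn R 2)) : A c -> open (chart_dom c).
Proof. by have [h _ _] := surf_is_atlas H; move=> /h[]. Qed.

Lemma chart_at y : exists2 c, A c & chart_dom c y.
Proof. by have [_ h _] := surf_is_atlas H. Qed.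

Lemma covering_in_chart (a : chart H (Cn R 2)) w : A a -> chart_dom a (p w) ->
  exists (N : set (W R)) (g : Cn R 2 -> Cn R 2),
  [/\ open N, N w, N `<=` p @^-1` chart_dom a,
      holomorphic_on (set_val @` N) g & forall x, N x -> g (set_val x) = chart_fun a (p x)].
Proof.
move=> Aa aw; have [U [V [k [[oU Uw oV Vp] _ _ [_ cp] _]]]] := covering_sheet w.
have [g [hg gE]] := cp _ _ W_chart_in Aa.
have eO : (U `&` setT `&` p @^-1` chart_dom a) = U `&` p @^-1` chart_dom a by rewrite setIT.
exists (U `&` p @^-1` chart_dom a), g; split => //.
- apply: openI => //; apply: open_comp; last exact: chart_open.
  by move=> x _; exact: covering_continuous.
- by rewrite -eO.
- by move=> x [Ux ax]; apply: gE; split.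
Qed.

(** Continuity of [s] decides the sheet: near each point, [s] is [sigma \o p] followed by the
    holomorphic inverse of [p] on the sheet around the image point, and so it inherits the
    antiholomorphy of [sigma]. *)
Lemma antiholomorphic_lift (sigma : H -> H) (s : W R -> W R) :
  regular_on (@antiholomorphic_on R 2 2) A A setT sigma -> continuous s ->
  (forall w, p (s w) = sigma (p w)) ->
  antiholomorphic_on [set z : Cn R 2 | z != 0] (fun z => set_val (s (to_W z))).
Proof.
move=> [csig Hsig] cs ps z /= z0; set w := to_W z.
have wz : set_val w = z by exact: to_WK.
have [a Aa aw] := chart_at (p w).
have [b Ab bw] := chart_at (sigma (p w)).
have [N1 [g1 [oN1 N1w N1a hg1 g1E]]] := covering_in_chart Aa aw.
have [g2 [hg2 g2E]] := Hsig _ _ Aa Ab.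
have [U [V [k [[oU Uw oV Vp] kp pk _ [_ ck]]]]] := covering_sheet (s w).
have [g3 [hg3 g3E]] := ck _ _ Ab W_chart_in.
have csp : continuous (sigma \o p).
  move=> x; apply: continuous_comp; first exact: covering_continuous.
  have cs1 : continuous sigma by apply/continuous_subspace_setT.
  exact: cs1.
pose N := N1 `&` ((sigma \o p) @^-1` (V `&` chart_dom b) `&` s @^-1` U).
have oN : open N.
  apply: openI => //; apply: openI.
    by apply: open_comp; [move=> x _; exact: csp|apply: openI => //; exact: chart_open].
  by apply: open_comp => // x _; exact: cs.
have Nw : N w.
  by split => //; split => //; split => //; rewrite /= -ps.
have eq x : N x -> set_val (s x) = g3 (g2 (g1 (set_val x))).
  move=> [N1x [[Vx bx] Ux]]; rewrite g1E// g2E; last by split => //; split => //; exact: N1a.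
  rewrite g3E; last by split.
  by rewrite -[in RHS]ps; have [_ ->] := kp _ Ux.
(* The only antiholomorphic factor is [g2]. A pair of conjugations inserted after it splits the
   conjugate of the composite into maps differentiable over [R[i]]. *)
pose G := (@conj_row R 2 \o g3 \o @conj_row R 2) \o (@conj_row R 2 \o g2) \o g1.
have nG : \forall y \near z, G y = (@conj_row R 2 \o (fun z => set_val (s (to_W z)))) y.
  have := image_W_nbhs oN Nw; rewrite wz; apply: filterS => _ [x Nx <-].
  by rewrite /G /= W_valK conj_row_conj_row eq.
suff dG : differentiable G z by have [] := near_eq_diff nG dG.
have d1 : differentiable g1 z by apply: hg1; exists w.
have e1 : g1 z = chart_fun a (p w) by rewrite -wz g1E.
have d2 : differentiable (@conj_row R 2 \o g2) (g1 z).
  by rewrite e1; apply: hg2; exists (p w) => //; split.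
have e2 : g2 (g1 z) = chart_fun b (sigma (p w)) by rewrite e1 g2E//; split.
have d3 : differentiable (@conj_row R 2 \o g3 \o @conj_row R 2) ((@conj_row R 2 \o g2) (g1 z)).
  apply: differentiable_conj_conj; rewrite /= conj_row_conj_row e2.
  by apply: hg3; exists (sigma (p w)) => //; split => //; split => //; rewrite -ps.
have d23 := @differentiable_comp _ _ _ _ (@conj_row R 2 \o g2)
  (@conj_row R 2 \o g3 \o @conj_row R 2) (g1 z) d2 d3.
exact: (@differentiable_comp _ _ _ _ g1
  ((@conj_row R 2 \o g3 \o @conj_row R 2) \o (@conj_row R 2 \o g2)) z d1 d23).
Qed.

End Lift.

End PuncturedSpace.

Section CoordsTopology.
Variables (R : realType) (n : nat).

Lemma complex_coords_continuous : continuous (@complex_coords R n).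
Proof.
move=> x B /nbhs_ballP[e /= e0 eB].
have er : e = (complex.Re e)%:C by rewrite RRe_real// gtr0_real.
have re0 : 0 < complex.Re e by rewrite -ltcR -er.
apply/nbhs_ballP; exists (complex.Re e / 2); first by rewrite /= divr_gt0.
move=> y; rewrite -ball_normE /= => h; apply: eB; rewrite -ball_normE /=.
rewrite -complex_coordsB (le_lt_trans (norm_complex_coords _))//.
by rewrite er ltcR mulrC -ltr_pdivlMr.
Qed.

Lemma real_coords_continuous : continuous (@real_coords R n).
Proof.
move=> x B /nbhs_ballP[e /= e0 eB].
have : nbhs x (ball x e%:C) by apply: nbhsx_ballx; rewrite ltcR.
apply: filterS => y; rewrite -ball_normE /= => h; apply: eB; rewrite -ball_normE /=.
by rewrite -ltcR -real_coordsB (le_lt_trans (norm_real_coords _)).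
Qed.

Lemma real_coords_image (O : set (Cn R n)) : @real_coords R n @` O = @complex_coords R n @^-1` O.
Proof.
apply/seteqP; split => [_ [z Oz <-]|x Ox] /=; first by rewrite real_coordsK.
by exists (complex_coords x); rewrite ?complex_coordsK.
Qed.

Lemma open_real_coords_image (O : set (Cn R n)) : open O -> open (@real_coords R n @` O).
Proof.
move=> oO; rewrite real_coords_image; apply: open_comp => // x _.
exact: complex_coords_continuous.
Qed.

Lemma complex_coords_eq0 (x : 'rV[R]_(n + n)) : (complex_coords x == 0) = (x == 0).
Proof.
apply/eqP/eqP => [h|->]; last exact: complex_coords0.
by rewrite -(complex_coordsK x) h real_coords0.
Qed.

End CoordsTopology.

Section RealInterface.
Variable R : realType.
Local Notation V := 'rV[R]_(2 + 2).

Definition punctured : set V := [set x | x != 0].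

Lemma punctured_complex : punctured = [set x : V | complex_coords x != 0].
Proof. by apply/seteqP; split => x /=; rewrite complex_coords_eq0. Qed.

Lemma open_punctured : open punctured.
Proof. exact: open_neq0. Qed.

Definition real_W (w : W R) : V := real_coords (set_val w : Cn R 2).
Definition W_real (x : V) : W R := to_W (complex_coords x).

Lemma real_W_neq0 w : real_W w != 0.
Proof.
apply/eqP => h; have := val_W w; rewrite -(real_coordsK (set_val w)).
by rewrite -/(real_W w) h complex_coords0 eqxx.
Qed.

Lemma W_realK x : x != 0 -> real_W (W_real x) = x.
Proof.
move=> x0; rewrite /real_W /W_real to_WK ?complex_coordsK//.
by rewrite complex_coords_eq0.
Qed.

Lemma real_WK w : W_real (real_W w) = w.
Proof. by rewrite /W_real /real_W real_coordsK W_valK. Qed.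

Lemma real_W_continuous : continuous real_W.
Proof.
move=> w; apply: (@continuous_comp _ _ _ (set_val : W R -> Cn R 2) (@real_coords R 2) w).
  exact: val_W_continuous.
exact: real_coords_continuous.
Qed.

Lemma real_W_image (N : set (W R)) : real_W @` N = @real_coords R 2 @` (set_val @` N).
Proof. by rewrite image_comp. Qed.

Lemma open_real_W_image (N : set (W R)) : open N -> open (real_W @` N).
Proof. by move=> oN; rewrite real_W_image; apply/open_real_coords_image/open_W_image. Qed.

Lemma W_real_continuous x : x != 0 -> {for x, continuous W_real}.
Proof.
move=> x0 O; rewrite nbhsE => -[B [oB Bx] BO].
have : nbhs x (real_W @` B).
  apply: open_nbhs_nbhs; split; first exact: open_real_W_image.
  by exists (W_real x) => //; exact: W_realK.
by apply: filterS => _ [w Bw <-]; rewrite /= real_WK; exact: BO.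
Qed.

Definition conj_real : V -> V := realify (@conj_row R 2).

Definition W_map (g : W R -> W R) (x : V) : V := real_W (g (W_real x)).

(** Conjugating the values turns antiholomorphy into the equations [hol] for each complex
    coordinate, so that the theory above applies as it stands. *)
Definition antihol (S : V -> V) := forall j : 'I_2, hol (@mulI R 2) punctured
  (fun x => conj_real (S x) 0 (lshift 2 j)) (fun x => conj_real (S x) 0 (rshift 2 j)).

Lemma antihol_W_map g :
  antiholomorphic_on [set z : Cn R 2 | z != 0] (fun z => set_val (g (to_W z))) ->
  antihol (W_map g).
Proof.
move=> H j; rewrite punctured_complex.
have e x : conj_real (W_map g x) =
    realify (@conj_row R 2 \o (fun z => set_val (g (to_W z)))) x.
  by rewrite /conj_real /W_map /realify /real_W real_coordsK.
have el k : (fun x => conj_real (W_map g x) 0 k) =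
   (fun x => realify (@conj_row R 2 \o (fun z => set_val (g (to_W z)))) x 0 k).
  by apply/funext => x; rewrite e.
by rewrite !el; exact: (hol_realify j H).
Qed.

Section Interface.
Variables (H : complex_surface R) (sigma : H -> H).
Local Notation A := (surf_atlas H).

(** The covering in real coordinates: [S] lifts the Real structure, [S'] is its inverse and [S \o S]
    generates the deck group. [lift_section] and [lift_chart] express that [P] is a local
    diffeomorphism, through smooth local inverses and through smooth expressions in charts. *)
Record real_lift (S S' : V -> V) (P : V -> H) : Prop := RealLift {
  lift_neq0 : forall x, x != 0 -> S x != 0 /\ S' x != 0;
  lift_inverse : forall x, x != 0 -> S' (S x) = x /\ S (S' x) = x;
  lift_antihol : antihol S /\ antihol S';
  lift_sigma : forall x, x != 0 -> P (S x) = sigma (P x);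
  lift_surj : forall y, exists2 x, x != 0 & P x = y;
  lift_fiber : forall x y, x != 0 -> y != 0 ->
    (P x = P y <-> exists n, iter n (S \o S) x = y \/ iter n (S \o S) y = x);
  lift_section : forall x, x != 0 -> exists (U : set V) (N : set H) (k : H -> V),
    [/\ [/\ open U, U x, U `<=` punctured, open N & N (P x)],
        (forall u, U u -> N (P u) /\ k (P u) = u),
        (forall y, N y -> U (k y) /\ P (k y) = y),
        {within N, continuous k} &
        forall a, A a -> exists G : V -> V,
          [/\ open ((@real_coords R 2 \o chart_fun a) @` (N `&` chart_dom a)),
              Csmooth ((@real_coords R 2 \o chart_fun a) @` (N `&` chart_dom a)) G &
              forall y, N y -> chart_dom a y -> G (real_coords (chart_fun a y)) = k y]];
  lift_continuous : forall x, x != 0 -> {for x, continuous P};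
  lift_chart : forall a x, A a -> x != 0 -> chart_dom a (P x) ->
    exists (U : set V) (G : V -> V),
    [/\ [/\ open U, U x & U `<=` punctured], (forall u, U u -> chart_dom a (P u)),
        Csmooth U G & forall u, U u -> G u = real_coords (chart_fun a (P u))]
}.

Lemma odd_real_lift : Real_structure sigma -> odd_Real sigma ->
  exists S S' P, real_lift S S' P.
Proof.
move=> [rs sK] [f [p [s [[k [fk kf rf [ck hk]]] [cov pf] [cs ps] ss]]]].
have kfK x : k (f x) = x by have [] := fk x I.
have fkK x : f (k x) = x by have [] := kf x I.
have sinj x y : s x = s y -> x = y by move=> e; rewrite -(kfK x) -(kfK y) -!ss e.
(* As [s \o s] is [f] and [k] inverts [f], this is the inverse of [s]. *)
pose s' w := s (k w).
have s'K x : s' (s x) = x by apply: sinj; rewrite /s' ss fkK.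
have sK' x : s (s' x) = x by rewrite /s' ss fkK.
have as_ := antiholomorphic_lift cov rs cs ps.
have hk' : holomorphic_on [set z : Cn R 2 | z != 0] (fun z => set_val (k (to_W z))).
  move=> z /= z0; have [g [hg gE]] := hk _ _ (W_chart_in R) (W_chart_in R).
  have ng : \forall y \near z, g y = set_val (k (to_W y)).
    have : nbhs z [set y : Cn R 2 | y != 0].
      by apply: open_nbhs_nbhs; split => //; exact: open_neq0.
    apply: filterS => y /= y0; rewrite -{1}(to_WK y0); exact: gE.
  have dg : differentiable g z.
    by apply: hg; exists (to_W z); [|exact: to_WK].
  by have [] := near_eq_diff ng dg.
have as' : antiholomorphic_on [set z : Cn R 2 | z != 0] (fun z => set_val (s' (to_W z))).
  move=> z /= z0; have d1 := hk' z z0.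
  have d2 := as_ _ (val_W (k (to_W z))).
  have := @differentiable_comp _ _ _ _ (fun z => set_val (k (to_W z)))
    (@conj_row R 2 \o (fun z => set_val (s (to_W z)))) z d1 d2.
  by rewrite /comp /= /s'; under eq_fun do rewrite W_valK.
have Sx g x : W_map g (real_W x) = real_W (g x) by rewrite /W_map real_WK.
have iterS n x : iter n (W_map s \o W_map s) (real_W x) = real_W (iter n f x).
  by elim: n => //= n ->; rewrite !Sx ss.
exists (W_map s), (W_map s'), (p \o W_real).
have ex x : x != 0 -> exists w, x = real_W w by move=> x0; exists (W_real x); rewrite W_realK.
have rinj x y : real_W x = real_W y -> x = y by move=> e; rewrite -(real_WK x) e real_WK.
split.
- by move=> x _; split; exact: real_W_neq0.
- by move=> x /ex[w ->]; rewrite !Sx s'K sK'.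
- by split; apply: antihol_W_map.
- by move=> x /ex[w ->]; rewrite Sx /= !real_WK ps.
- move=> y; have [x px] := cov.1 y; exists (real_W x); first exact: real_W_neq0.
  by rewrite /= real_WK.
- move=> x y /ex[w ->] /ex[w' ->]; rewrite /= !real_WK; split.
    by move=> /pf[n h]; exists n; rewrite !iterS; case: h => ->; [left|right].
  by move=> [n]; rewrite !iterS => h; apply/pf; exists n; case: h => /rinj ->; [left|right].
- move=> x /ex[w ->]; rewrite /= real_WK.
  have [U [N [kk [[oU Uw oN Np] kp pk _ [ck' hkk]]]]] := covering_sheet cov w.
  exists (real_W @` U), N, (real_W \o kk); split.
  + split; [exact: open_real_W_image|by exists w| |exact: oN|exact: Np].
    by move=> _ [u _ <-]; exact: real_W_neq0.
  + by move=> _ [u Uu <-]; rewrite /= real_WK; have [h1 ->] := kp _ Uu.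
  + move=> y Ny; have [h1 h2] := pk _ Ny; split; first by exists (kk y).
    by rewrite /= real_WK.
  + apply: open_within => // X oX; rewrite comp_preimage.
    apply: (within_open_preimage oN ck'); apply: open_comp => // z _.
    exact: real_W_continuous.
  move=> a Aa; have [g [hg gE]] := hkk _ _ Aa (W_chart_in R).
  have [atc _ _] := surf_is_atlas H.
  have oNa : open (N `&` chart_dom a) by apply: openI => //; have [] := atc _ Aa.
  have oI : open (chart_fun a @` (N `&` chart_dom a) : set (Cn R 2)).
    by apply: chart_image_open => //; exact: atc.
  have eI : (@real_coords R 2 \o chart_fun a) @` (N `&` chart_dom a) =
     [set x | (chart_fun a @` (N `&` chart_dom a)) (complex_coords x)].
    by rewrite -image_comp real_coords_image.
  exists (realify g); rewrite eI; split.
  + by have := open_real_coords_image oI; rewrite real_coords_image.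
  + apply: Csmooth_realify.
      by have := open_real_coords_image oI; rewrite real_coords_image.
    have e3 : N `&` chart_dom a `&` kk @^-1` chart_dom (Chart setT (set_val : W R -> Cn R 2)) = N `&` chart_dom a.
      by rewrite /= preimage_setT setIT.
    by rewrite e3 in hg.
  + by move=> y Ny ay; rewrite /realify real_coordsK gE.
- move=> x x0; apply: continuous_comp; first exact: W_real_continuous.
  exact: covering_continuous.
- move=> a x Aa /ex[w ->]; rewrite /= real_WK => aw.
  have [N [g [oN Nw Na hg gE]]] := covering_in_chart cov Aa aw.
  have oI := open_W_image oN.
  exists (real_W @` N), (realify g); split.
  + split; [exact: open_real_W_image|by exists w|].
    by move=> _ [u _ <-]; exact: real_W_neq0.
  + by move=> _ [u Nu <-]; rewrite /= real_WK; exact: Na.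
  + have -> : real_W @` N = [set x | (set_val @` N) (complex_coords x)].
      by rewrite real_W_image real_coords_image.
    apply: Csmooth_realify => //.
    by have := open_real_coords_image oI; rewrite real_coords_image.
  + by move=> _ [u Nu <-]; rewrite /= real_WK /realify /real_W real_coordsK gE.
Qed.

End Interface.

End RealInterface.

(** * Dynamics of the lift *)

Section ConnectedPunctured.
Variable R : realType.
Local Notation V := 'rV[R]_(2 + 2).

Lemma segment_connected_set (x y : V) : connected [set x + t *: (y - x) | t in `[0, 1]%classic].
Proof.
apply: connected_continuous_connected.
  by apply/connected_intervalP; exact: interval_is_interval.
apply: continuous_subspaceT => t; apply: cvgD; first exact: cvg_cst.
by apply: cvgZr_tmp; exact: cvg_id.
Qed.

Lemma connected_star (x : V) (D : set V) :
  connected [set y | forall t : R, 0 <= t <= 1 -> D (x + t *: (y - x))].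
Proof.
set B := (X in connected X).
have -> : B = \bigcup_(y in B) [set x + t *: (y - x) | t in `[0, 1]%classic].
  apply/seteqP; split => [y By|z [y By [t]]] /=.
    exists y => //; exists 1; first by rewrite /= in_itv /= ler01 lexx.
    by rewrite scale1r addrC subrK.
  rewrite in_itv /= => /andP[t0 t1] <- s /andP[s0 s1].
  have -> : x + s *: (x + t *: (y - x) - x) = x + (s * t) *: (y - x).
    by rewrite [x + t *: _ - x]addrAC subrr add0r scalerA.
  by apply: By; rewrite mulr_ge0//= mulr_ile1.
apply: bigcup_connected; last by move=> y _; exact: segment_connected_set.
exists x => y _; exists 0; first by rewrite /= in_itv /= lexx ler01.
by rewrite scale0r addr0.
Qed.

(** The points seen from a basis vector [e i] along a segment avoiding 0 form a star-shaped set that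
    omits only the opposite ray. Two basis vectors have different opposite rays, so two such sets
    cover everything, and they meet. *)
Lemma connected_punctured : connected (@punctured R).
Proof.
pose e (i : 'I_(2 + 2)) : V := delta_mx 0 i.
pose i0 : 'I_(2 + 2) := inord 0; pose i1 : 'I_(2 + 2) := inord 1.
have ne : i0 != i1 by apply/eqP => /(congr1 val); rewrite /= !inordK.
pose B i := [set y : V | forall t : R, 0 <= t <= 1 -> punctured (e i + t *: (y - e i))].
have ee i : e i 0 i = 1 by rewrite mxE !eqxx.
have e01 : e i0 0 i1 = 0 by rewrite mxE eqxx /= eq_sym (negbTE ne).
have e10 : e i1 0 i0 = 0 by rewrite mxE eqxx /= (negbTE ne).
have nB i y : punctured y -> ~ B i y -> exists2 t : R, 0 < t & y = - t *: e i.
  move=> y0 /existsNP[t /not_implyP[/andP[t0 t1]]] /negP; rewrite negbK => /eqP h.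
  have tp : 0 < t.
    rewrite lt_neqAle t0 andbT eq_sym; apply/eqP => t00; move: h; rewrite t00 scale0r addr0.
    by move=> /matrixP/(_ 0 i)/eqP; rewrite ee mxE oner_eq0.
  have tl : t < 1.
    rewrite lt_neqAle t1 andbT; apply/eqP => t00; move: h; rewrite t00 scale1r addrC subrK.
    by move=> y00; move: y0; rewrite /punctured /= y00 eqxx.
  exists ((1 - t) / t); first by rewrite divr_gt0// subr_gt0.
  have : t^-1 *: (e i + t *: (y - e i)) = 0 by rewrite h scaler0.
  rewrite scalerDr scalerA mulVf ?gt_eqF// scale1r => h2.
  apply/matrixP => a b; move/matrixP: h2 => /(_ a b); rewrite !mxE.
  set u := (_ && _)%:R; set v := y a b => h2.
  have t00 : t != 0 by rewrite gt_eqF.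
  have : v = u - t^-1 * u by apply/eqP; rewrite -subr_eq0 -h2; apply/eqP; ring.
  by move=> ->; field.
have B01 : B i0 (e i1).
  apply: contrapT => /nB[|t t0].
    by apply/eqP => /matrixP/(_ 0 i1)/eqP; rewrite ee mxE oner_eq0.
  by move/matrixP => /(_ 0 i1)/eqP; rewrite ee mxE e01 mulr0 oner_eq0.
have B11 : B i1 (e i1) by move=> t _; rewrite subrr scaler0 addr0; apply/eqP => /matrixP/(_ 0 i1)/eqP; rewrite ee mxE oner_eq0.
have -> : @punctured R = B i0 `|` B i1.
  apply/seteqP; split => [y y0|y [|] /(_ 1)]; last 2 first.
    by rewrite scale1r addrC subrK; apply; rewrite ler01 lexx.
    by rewrite scale1r addrC subrK; apply; rewrite ler01 lexx.
  apply: contrapT => /not_orP[/(nB _ _ y0)[s s0 ys] /(nB _ _ y0)[t t0 yt]].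
  have := congr1 (fun y : V => y 0 i0) yt.
  rewrite ys mxE ee mulr1 mxE e10 mulr0 => /eqP.
  by rewrite oppr_eq0 gt_eqF.
by apply: connectedU; [exists (e i1)|exact: connected_star|exact: connected_star].
Qed.

Lemma normalize_continuous (K : realType) (E : normedModType K) (r : K) (x : E) : x != 0 ->
  {for x, continuous (fun y : E => (r / `|y|) *: y)}.
Proof.
move=> x0.
have c1 : {for x, continuous (fun y : E => r / `|y|)}.
  apply: (@continuous_comp _ _ _ (fun x : E => `|x|) (fun t : K => r / t) x).
    exact: norm_continuous.
  by apply: cvgM; [exact: cvg_cst|apply: cvgV; [rewrite normr_eq0|exact: cvg_id]].
by apply: cvgZ; [exact: c1|exact: cvg_id].
Qed.

Lemma connected_sphere (r : R) : 0 < r -> connected [set x : V | `|x| = r].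
Proof.
move=> r0.
have -> : [set x : V | `|x| = r] = [set (r / `|x|) *: x | x in @punctured R].
  apply/seteqP; split => [x /= xr|_ [x /= x0 <-]] /=.
    exists x; last by rewrite xr divff ?gt_eqF// scale1r.
    by rewrite /punctured /= -normr_gt0 xr.
  rewrite normrZ normrM normfV normr_id (gtr0_norm r0) mulfVK// normr_eq0//.
apply: connected_continuous_connected; first exact: connected_punctured.
apply: continuous_in_subspaceT => x /set_mem /= x0.
exact: normalize_continuous.
Qed.

End ConnectedPunctured.

Section Dynamics.
Variable R : realType.
Local Notation V := 'rV[R]_(2 + 2).

Lemma iter_continuous (h : V -> V) n : continuous h -> continuous (iter n h).
Proof.
by move=> ch; elim: n => [|n IH] x; [exact: cvg_id|exact: (continuous_comp (IH x) (ch _))].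
Qed.

Lemma iter0 (h : V -> V) n : h 0 = 0 -> iter n h 0 = 0.
Proof. by move=> h0; elim: n => //= n ->. Qed.

Lemma iterK (h h' : V -> V) n : cancel h h' -> cancel (iter n h) (iter n h').
Proof. by move=> hK; elim: n => // n IH x; rewrite iterSr iterS hK IH. Qed.

Lemma norm_curve_continuous (h : V -> V) (c : R -> V) : continuous h -> continuous c ->
  continuous (fun t => `|h (c t)|).
Proof.
move=> ch cc t; apply: (@continuous_comp _ _ _ c (fun x => `|h x|) t); first exact: cc.
apply: (@continuous_comp _ _ _ h (fun x : V => `|x|)); first exact: ch.
exact: norm_continuous.
Qed.

Lemma compact_annulus (a b : R) : compact [set x : V | a <= `|x| <= b].
Proof.
apply: bounded_closed_compact.
  by exists b; split; [exact: num_real|move=> M bM x /= /andP[_ xb]; rewrite (le_trans xb)// ltW].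
have -> : [set x : V | a <= `|x| <= b] = (fun x : V => `|x|) @^-1` `[a, b]%classic.
  by apply/seteqP; split => x /=; rewrite in_itv.
apply: (@closed_comp _ _ (fun x : V => `|x|)); last exact: interval_closed.
by move=> x _; exact: norm_continuous.
Qed.

Lemma line_continuous (w : V) : continuous (fun t : R => t *: w).
Proof. exact: scalel_continuous. Qed.

Lemma norm_bound_continuous (h : V -> V) (r : R) : continuous h ->
  exists2 C, 0 < C & forall x, `|x| <= r -> `|h x| <= C.
Proof.
move=> ch.
have : compact [set `|h x| | x in [set x : V | 0 <= `|x| <= r]].
  apply: continuous_compact; last exact: compact_annulus.
  by apply: continuous_subspaceT => x; apply: (continuous_comp (ch x)); exact: norm_continuous.
move=> /compact_bounded[M [_ HM]]; exists (`|M| + 1); first by rewrite ltr_wpDl.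
move=> x xr; have := HM (`|M| + 1).
rewrite (le_lt_trans (ler_norm M)) ?ltrDl// => /(_ isT (`|h x|)) hM.
apply: (le_trans (ler_norm _)); apply: hM.
by exists x => //=; rewrite normr_ge0.
Qed.

(* The radial path from the image to infinity pulls back to a path leaving the
   ball, hence crossing its boundary. *)
Lemma sphere_in_ball (F G : V -> V) (r e : R) : 0 < r -> 0 < e -> continuous F -> continuous G ->
  cancel F G -> cancel G F -> F 0 = 0 ->
  (forall x, `|x| = r -> `|F x| < e) -> forall x, `|x| <= r -> `|F x| < e.
Proof.
move=> r0 e0 cF cG FK GK F0 HS x xr; rewrite ltNge; apply/negP => rF.
have [C C0 HC] := norm_bound_continuous r cF.
have Fx0 : 0 < `|F x| by exact: lt_le_trans e0 rF.
pose T := 1 + C / `|F x|.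
have T1 : 1 <= T by rewrite lerDl divr_ge0// ltW.
have [c cT cE] : exists2 c, c \in `[1, T] & `|G (c *: F x)| = r.
  apply: (@IVT _ (fun t => `|G (t *: F x)|)) => //.
    apply: continuous_subspaceT; apply: norm_curve_continuous => //.
    exact: line_continuous.
  rewrite scale1r FK ge_min xr /= le_max; apply/orP; right.
  rewrite leNgt; apply/negP => /ltW/HC; rewrite GK normrZ ger0_norm ?(le_trans ler01)//.
  by rewrite mulrDl mul1r divfK ?gt_eqF// leNgt ltrDr Fx0.
have := HS _ cE; rewrite GK normrZ ltNge => /negP; apply.
move: cT; rewrite in_itv /= => /andP[c1 _].
by rewrite ger0_norm ?(le_trans ler01)// (le_trans rF)// ler_peMl// ltW.
Qed.

(** The segment from 0 to [x] is pulled back by [G]: if the resulting path left the ball, it would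
    cross the sphere at a point that [F] sends to a point of norm at most [r]. *)
Lemma sphere_out_ball (F G : V -> V) (r : R) : 0 < r -> continuous G ->
  cancel F G -> cancel G F -> F 0 = 0 ->
  (forall x, `|x| = r -> r < `|F x|) -> forall x, `|x| <= r -> `|G x| < r.
Proof.
move=> r0 cG FK GK F0 HS x xr; rewrite ltNge; apply/negP => rG.
have G0 : G 0 = 0 by rewrite -F0 FK.
have [c c01 cE] : exists2 c, c \in `[0, 1] & `|G (c *: x)| = r.
  apply: (@IVT _ (fun t => `|G (t *: x)|)); first exact: ler01.
    apply: continuous_subspaceT; apply: norm_curve_continuous => //.
    exact: line_continuous.
  by rewrite scale0r G0 normr0 scale1r ge_min le_max rG orbT (ltW r0).
have := HS _ cE; rewrite GK normrZ ltNge => /negP; apply.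
move: c01; rewrite in_itv /= => /andP[c0 c1].
by rewrite ger0_norm// (le_trans _ xr)// ler_piMl.
Qed.

Definition properly_discontinuous (f : V -> V) := forall K : set V, compact K ->
  K `<=` @punctured R -> exists N, forall n z, (N <= n)%N -> K z -> ~ K (iter n f z).

(** Attraction to 0, uniform near each nonzero point; this local uniformity is what later makes the
    stabilised conjugacies smooth. *)
Definition absorbing (f : V -> V) := forall e : R, 0 < e -> forall z : V, z != 0 ->
  exists m0, \forall y \near z, forall m, (m0 <= m)%N -> `|iter m f y| < e.

(** Since [iter n f] preserves the ball, orbits stay bounded; leaving a compact annulus for good
    then means falling below its inner radius, chosen as the minimum of [e] and [a]. *)
Lemma annulus_absorbed (f g : V -> V) n (r : R) : continuous f -> cancel f g -> f 0 = 0 ->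
  properly_discontinuous f -> (0 < n)%N ->
  0 < r -> (forall x, `|x| <= r -> `|iter n f x| < r) ->
  forall e a : R, 0 < e -> 0 < a -> exists N, forall m x, (N <= m)%N -> a <= `|x| <= r ->
    `|iter m f x| < e.
Proof.
move=> cf fK f0 PD n0 r0 H e a e0 a0.
have [C C0 HC] : exists2 C, 0 < C & forall i x, (i < n)%N -> `|x| <= r -> `|iter i f x| <= C.
  elim: (n) => [|k [C C0 IH]]; first by exists 1.
  have [C' C'0 HC'] := norm_bound_continuous r (@iter_continuous f k cf).
  exists (C + C'); first exact: addr_gt0.
  move=> i x; rewrite ltnS leq_eqVlt => /predU1P[->|ik] xr.
    by rewrite (le_trans (HC' _ xr))// lerDr ltW.
  by rewrite (le_trans (IH _ _ ik xr))// lerDl ltW.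
pose b := Num.min e a.
have b0 : 0 < b by rewrite lt_min e0.
have [|N HN] := PD _ (@compact_annulus b (C + r)).
  by move=> x /= /andP[bx _]; rewrite /punctured /= -normr_gt0 (lt_le_trans b0).
exists N => m x Nm /andP[ax xr].
have bd : `|iter m f x| <= C.
  rewrite (divn_eq m n) addnC iterD; apply: HC; first exact: ltn_pmod.
  elim: (m %/ n)%N => //= k IH; rewrite mulSn iterD; exact/ltW/H/IH.
have h := HN m x Nm; rewrite ltNge; apply/negP => em; apply: h => /=.
  by rewrite (le_trans _ ax) ?ge_min ?lexx ?orbT//= (le_trans xr)// lerDr ltW.
by rewrite (le_trans _ em) ?ge_min ?lexx//= (le_trans bd)// lerDl ltW.
Qed.

(** Some power sends no point of the sphere of radius [r] back to it. As that sphere is connected,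
    it is pushed entirely inwards or entirely outwards, and [sphere_in_ball] or [sphere_out_ball]
    passes to the ball. *)
Lemma dichotomy (f g : V -> V) (r : R) : continuous f -> continuous g -> cancel f g -> cancel g f ->
  f 0 = 0 -> properly_discontinuous f -> 0 < r -> exists2 n, (0 < n)%N &
  ((forall z, `|z| <= r -> `|iter n f z| < r) \/ (forall z, `|z| <= r -> `|iter n g z| < r)).
Proof.
move=> cf cg fK gK f0 PD r0.
have [|N HN] := PD _ (@compact_annulus r r).
  by move=> x /= /andP[bx _]; rewrite /punctured /= -normr_gt0 (lt_le_trans r0).
exists N.+1 => //; set n := N.+1.
have ne x : `|x| = r -> `|iter n f x| != r.
  move=> xr; apply/eqP => h; apply: (HN n x (leqnSn _)) => /=; first by rewrite xr lexx.
  by rewrite h lexx.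
have F0 := iter0 n f0.
have [[x [xr xlt]]|] := pselect (exists x, `|x| = r /\ `|iter n f x| < r).
  left; refine (@sphere_in_ball (iter n f) (iter n g) r r r0 r0 (@iter_continuous f n cf) (@iter_continuous g n cg) (iterK _ fK) (iterK _ gK) F0 _).
  move=> y yr; rewrite ltNge; apply/negP => ry.
  have := @connected_continuous_connected _ _ _ (fun x : V => `|iter n f x|) (connected_sphere r0).
  have /[swap]/[apply] : {within [set x : V | `|x| = r], continuous (fun x : V => `|iter n f x|)}.
    apply: continuous_subspaceT => z.
    apply: (continuous_comp (@iter_continuous f n cf z)); exact: norm_continuous.
  move=> /connected_intervalP/(_ `|iter n f x| `|iter n f y|).
  have h u : `|u| = r -> [set `|iter n f x0| | x0 in [set x0 : V | `|x0| = r]] `|iter n f u| by move=> ur; exists u.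
  move=> /(_ (h _ xr) (h _ yr) r); rewrite (ltW xlt) ry => /(_ isT)[z /= zr] /eqP.
  exact/negP/ne.
move=> nx; right; refine (@sphere_out_ball (iter n f) (iter n g) r r0 (@iter_continuous g n cg) (iterK _ fK) (iterK _ gK) F0 _).
move=> x xr; rewrite lt_neqAle eq_sym ne//= leNgt; apply/negP => h; by apply: nx; exists x.
Qed.

Lemma absorbing_dichotomy (f g : V -> V) : continuous f -> continuous g -> cancel f g ->
  cancel g f -> f 0 = 0 -> properly_discontinuous f -> absorbing f \/ absorbing g.
Proof.
have key (f1 g1 : V -> V) : continuous f1 -> continuous g1 -> cancel f1 g1 ->
    cancel g1 f1 -> f1 0 = 0 -> properly_discontinuous f1 -> properly_discontinuous g1 ->
    (exists2 n, (0 < n)%N & forall z, `|z| <= 1 -> `|iter n f1 z| < 1) -> absorbing f1.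
  move=> cf cg fK gK f0 PD PD' [n n0 H] e e0 z z0.
  have g0 : g1 0 = 0 by rewrite -f0 fK.
  have z0' : 0 < `|z| by rewrite normr_gt0.
  pose r := `|z| + 1; have r0 : 0 < r by rewrite addr_gt0.
  have nz : \forall y \near z, `|z| / 2 <= `|y| <= r.
    have : \forall y \near z, `|y| \in `]`|z| / 2, r[.
      have /(_ (fun t => t \in `]`|z| / 2, r[)) := @norm_continuous R V z; apply; apply: near_in_itvoo.
      by rewrite in_itv /= ltrDl ltr01 andbT ltr_pdivrMr// ltr_pMr// ltrDl.
    by apply: filterS => y; rewrite in_itv /= => /andP[h1 h2]; rewrite !ltW.
  have [k k0 [Hf|Hg]] := dichotomy cf cg fK gK f0 PD r0.
    have [N HN] := annulus_absorbed cf fK f0 PD k0 r0 Hf e0 (divr_gt0 z0' (ltr0n _ 2)).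
    by exists N; apply: filterS nz => y hy m Nm; exact: HN.
  (* The unit ball shrinks under [f1] and a larger ball under [g1]. Then a common power of each
     sends the unit sphere strictly inside the unit ball, although the two powers are inverse to
     each other. *)
  exfalso.
  have [N HN] := annulus_absorbed cf fK f0 PD n0 ltr01 H ltr01 ltr01.
  have a0 : 0 < Num.min r 1 by rewrite lt_min r0 ltr01.
  have [N' HN'] := annulus_absorbed cg gK g0 PD' k0 r0 Hg ltr01 ltr01.
  pose m := maxn N N'.
  have hf x : `|x| = 1 -> `|iter m f1 x| < 1.
    by move=> x1; apply: HN; rewrite ?leq_maxl// x1 lexx.
  have hg x : `|x| = 1 -> `|iter m g1 x| < 1.
    by move=> x1; apply: HN'; rewrite ?leq_maxr// x1 lexx lerDr normr_ge0.
  have hg' : forall x, `|x| <= 1 -> `|iter m g1 x| < 1.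
    exact: (@sphere_in_ball (iter m g1) (iter m f1) 1 1 ltr01 ltr01 (@iter_continuous g1 m cg) (@iter_continuous f1 m cf) (iterK _ gK) (iterK _ fK) (iter0 m g0) hg).
  pose x : V := `|z|^-1 *: z.
  have x1 : `|x| = 1 by rewrite normrZ normfV normr_id mulVf ?gt_eqF.
  have := hg' _ (ltW (hf _ x1)); rewrite iterK// x1 ltxx//.
move=> cf cg fK gK f0 PD.
have PD' : properly_discontinuous g.
  move=> K cK K0; have [N HN] := PD K cK K0; exists N => n z Nn Kz Kg.
  by apply: (HN n _ Nn Kg); rewrite iterK.
have g0 : g 0 = 0 by rewrite -f0 fK.
have [n n0 [h|h]] := dichotomy cf cg fK gK f0 PD ltr01.
  by left; apply: (key f g) => //; exists n.
by right; apply: (key g f) => //; exists n.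
Qed.

End Dynamics.

Section ComplexMaps.
Variable R : realType.
Local Notation V := 'rV[R]_(2 + 2).
Local Notation J := (@mulI R 2).

Lemma coordD (x y : V) i : (x + y) 0 i = x 0 i + y 0 i. Proof. by rewrite mxE. Qed.
Lemma coordN (x : V) i : (- x) 0 i = - x 0 i. Proof. by rewrite mxE. Qed.
Lemma coordZ (a : R) (x : V) i : (a *: x) 0 i = a * x 0 i. Proof. by rewrite mxE. Qed.

Lemma conj_real_l (x : V) j : conj_real x 0 (lshift 2 j) = x 0 (lshift 2 j).
Proof. by rewrite /conj_real /realify real_coordsl !mxE /=. Qed.

Lemma conj_real_r (x : V) j : conj_real x 0 (rshift 2 j) = - x 0 (rshift 2 j).
Proof. by rewrite /conj_real /realify real_coordsr !mxE /=. Qed.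

Lemma row_eq_lr (x y : V) : (forall j, x 0 (lshift 2 j) = y 0 (lshift 2 j)) ->
  (forall j, x 0 (rshift 2 j) = y 0 (rshift 2 j)) -> x = y.
Proof.
move=> hl hr; apply/rowP => i.
by case: (splitP i) => j /= ij; [have -> : i = lshift 2 j by exact/val_inj|
  have -> : i = rshift 2 j by exact/val_inj].
Qed.

Lemma conj_realK : involutive (@conj_real R).
Proof.
by move=> x; apply: row_eq_lr => j; rewrite ?conj_real_l// !conj_real_r opprK.
Qed.

Lemma conj_real_linear : linear (@conj_real R).
Proof.
move=> a x y; apply: row_eq_lr => j.
  by rewrite conj_real_l !coordD !coordZ !conj_real_l.
by rewrite conj_real_r !coordD !coordZ !conj_real_r opprD mulrN.
Qed.

Lemma norm_conj_real (x : V) : `|conj_real x| = `|x|.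
Proof.
suff h (y : V) : `|conj_real y| <= `|y| by apply/eqP; rewrite eq_le h -{1}(conj_realK x) h.
have := @mx_norm_le R 1 (2 + 2) (conj_real y) `|y| (normr_ge0 _).
apply => i k; rewrite (ord1 i).
case: (splitP k) => j /= kj.
  have -> : k = lshift 2 j by exact/val_inj.
  by rewrite conj_real_l mx_norm_coord.
have -> : k = rshift 2 j by exact/val_inj.
by rewrite conj_real_r normrN mx_norm_coord.
Qed.

Lemma conj_real_continuous : continuous (@conj_real R).
Proof.
apply: (linear_bound_continuous (C := 1)) => //; first exact: conj_real_linear.
by move=> v; rewrite norm_conj_real mul1r.
Qed.

Lemma conj_realJ (x : V) : conj_real (J x) = - J (conj_real x).
Proof.
apply: row_eq_lr => j.
  rewrite conj_real_l (mulI_left x j) (coordN (J (conj_real x)) (lshift 2 j)).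
  by rewrite (mulI_left (conj_real x) j) conj_real_r opprK.
rewrite conj_real_r (mulI_right x j) (coordN (J (conj_real x)) (rshift 2 j)).
by rewrite (mulI_right (conj_real x) j) conj_real_l.
Qed.

Lemma conj_real0 : conj_real (0 : V) = 0.
Proof. by apply: row_eq_lr => j; rewrite ?conj_real_l// conj_real_r mxE oppr0. Qed.

Lemma conj_real_eq0 (x : V) : (conj_real x == 0) = (x == 0).
Proof. by rewrite -(inj_eq (can_inj conj_realK)) conj_realK conj_real0. Qed.

Lemma J_linear (a : R) x y : J (a *: x + y) = a *: J x + J y.
Proof. exact: mulI_linear. Qed.

Lemma JZ (a : R) x : J (a *: x) = a *: J x.
Proof.
apply: row_eq_lr => j.
  rewrite (mulI_left (a *: x) j) (coordZ a (J x) (lshift 2 j)) (mulI_left x j).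
  by rewrite (coordZ a x (rshift 2 j)) mulrN.
rewrite (mulI_right (a *: x) j) (coordZ a (J x) (rshift 2 j)) (mulI_right x j).
exact: coordZ.
Qed.

(* [e = 1] means holomorphic and [e = -1] antiholomorphic. *)
Definition CR (e : R) (T : V -> V) := Csmooth setT T /\
  forall z v, 'd T z (J v) = e *: J ('d T z v).

Lemma CR_diff e T : CR e T -> forall z, differentiable T z.
Proof. by move=> [h _] z; exact: (Ck_differentiable (h 0%N)). Qed.

Lemma CR_continuous e T : CR e T -> continuous T.
Proof. by move=> h z; apply: differentiable_continuous; exact: CR_diff h z. Qed.

Lemma diff_linear_at (T : V -> V) (z : V) : linear T -> continuous T ->
  is_diff z T T.
Proof.
move=> lT cT; pose l := GRing.isLinear.Build R V V *:%R T lT.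
pose L : {linear V -> V} := HB.pack T l.
have cL : continuous L by [].
have dL : differentiable L z by exact: linear_differentiable.
by apply: DiffDef => //; exact: (diff_lin z cL).
Qed.

Lemma CR_comp e e' T T' : CR e T -> CR e' T' -> CR (e * e') (T \o T').
Proof.
move=> hT hT'; split.
  move=> k; apply: (@Ck_comp _ k _ _ _ setT setT) => //; first exact: openT.
    exact: hT'.1.
  exact: hT.1.
move=> z v.
have ee w : 'd (T \o T') z w = 'd T (T' z) ('d T' z w) :=
  congr1 (fun f : V -> V => f w) (diff_comp (CR_diff hT' z) (CR_diff hT (T' z))).
have lZ w : 'd T (T' z) (e' *: w) = e' *: 'd T (T' z) w := linearZ _ _.
apply: (etrans (ee _)); apply: (etrans (congr1 ('d T (T' z)) (hT'.2 z v))).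
apply: (etrans (lZ _)); apply: (etrans (congr1 (fun x => e' *: x) (hT.2 _ _))).
apply: (etrans (scalerA _ _ _)); rewrite mulrC.
exact: (congr1 (fun x => (e * e') *: J x) (esym (ee v))).
Qed.

Lemma CR_id : CR 1 id.
Proof.
split=> [k|z v]; first exact: Ck_id.
by have [_ ->] := is_diff_id z; rewrite scale1r.
Qed.

Lemma CR_iter e T n : CR e T -> CR (e ^+ n) (iter n T).
Proof.
move=> h; elim: n => [|n IH]; first exact: CR_id.
by rewrite exprS; exact: (CR_comp h IH).
Qed.

Lemma CR_linear e (T : V -> V) : linear T -> continuous T -> (forall v, T (J v) = e *: J (T v)) ->
  CR e T.
Proof.
move=> lT cT h; split; first by move=> k; exact: Ck_linear.
by move=> z v; have [_ ->] := diff_linear_at z lT cT.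
Qed.

Lemma CR_conj : CR (-1) (@conj_real R).
Proof.
apply: CR_linear; [exact: conj_real_linear|exact: conj_real_continuous|].
by move=> v; rewrite scaleN1r conj_realJ.
Qed.

Lemma diff_coord (T : V -> V) z i v : differentiable T z ->
  differentiable (fun x => T x 0 i) z /\ 'd (fun x => T x 0 i) z v = 'd T z v 0 i.
Proof.
move=> dT.
have dc : is_diff (T z) (fun x : V => x 0 i) (fun x : V => x 0 i).
  have l : linear (fun x : V => x 0 i : R^o) by move=> a x y; rewrite !mxE.
  pose lm := GRing.isLinear.Build R V R^o *:%R (fun x : V => x 0 i : R^o) l.
  pose L : {linear V -> R^o} := HB.pack (fun x : V => x 0 i : R^o) lm.
  have cL : continuous L by move=> x; exact: coord_continuous.
  have dL : differentiable L (T z) by exact: linear_differentiable.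
  by apply: DiffDef => //; exact: (diff_lin (T z) cL).
have [dc1 dc2] := dc.
split; first exact: (@differentiable_comp _ _ _ _ T (fun x : V => x 0 i)).
by rewrite (@diff_comp _ _ _ _ T (fun x : V => x 0 i))//= dc2.
Qed.

Lemma CR_hol T j : CR 1 T ->
  hol J setT (fun x => T x 0 (lshift 2 j)) (fun x => T x 0 (rshift 2 j)).
Proof.
move=> hT z _; have dT := CR_diff hT z.
have h i v := (diff_coord i v dT).2.
split; [exact: (diff_coord _ 0 dT).1|exact: (diff_coord _ 0 dT).1|move=> v].
have e i := congr1 (fun y : V => y 0 i) (etrans (hT.2 z v) (scale1r _)).
split; apply: (etrans (h _ _)); apply: (etrans (e _)).
  exact: (etrans (mulI_left _ j) (esym (congr1 (fun x => - x) (h _ _)))).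
exact: (etrans (mulI_right _ j) (esym (h _ _))).
Qed.

Lemma hol_CR (T : V -> V) : (forall j, hol J setT (fun x => T x 0 (lshift 2 j)) (fun x => T x 0 (rshift 2 j))) ->
  CR 1 T.
Proof.
move=> hT.
have sT : Csmooth setT T.
  move=> k; apply: Ck_row; first exact: openT.
  move=> i; case: (splitP i) => j /= ij.
    have -> : i = lshift 2 j by exact/val_inj.
    by have [] := @hol_Ck R k V J 2 setT _ _ (@mulI_linear R 2) (ler1n _ 2) (@mulI_bound R 2) openT (hT j).
  have -> : i = rshift 2 j by exact/val_inj.
  by have [] := @hol_Ck R k V J 2 setT _ _ (@mulI_linear R 2) (ler1n _ 2) (@mulI_bound R 2) openT (hT j).
split => // z v; rewrite scale1r.
have dT : differentiable T z by exact: (Ck_differentiable (sT 0%N)).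
have h i w := (diff_coord i w dT).2.
apply: row_eq_lr => j; have [_ _ /(_ v)[h1 h2]] := hT j z I; apply: (etrans (esym (h _ _))).
  apply: (etrans h1); apply: (etrans (congr1 (fun x => - x) (h _ _))).
  exact: (esym (mulI_left _ j)).
by apply: (etrans h2); apply: (etrans (h _ _)); exact: (esym (mulI_right _ j)).
Qed.

End ComplexMaps.

(** * Extension of the lift across the origin *)

Section Extension.
Variable R : realType.
Local Notation V := 'rV[R]_(2 + 2).
Local Notation J := (@mulI R 2).

Definition extend0 (S : V -> V) (x : V) : V := if x == 0 then 0 else S x.

Lemma antihol_extension (S : V -> V) : antihol S ->
  exists c, CR 1 (fun x => if x == 0 then c else conj_real (S x)).
Proof.
move=> hS.
(* The discs are parallel to the first complex axis, and [u] leaves it along the second. The lower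
   bound 1/2 below holds because cos and sin cannot both be smaller in absolute value. *)
pose w : V := delta_mx 0 (lshift 2 0); pose u : V := delta_mx 0 (lshift 2 1).
have Jw (a b : R) j : disc J 0 w (a, b) 0 (lshift 2 j) = a * (j == 0)%:R /\
    disc J 0 w (a, b) 0 (rshift 2 j) = b * (j == 0)%:R.
  rewrite /disc /= addr0 !coordD !coordZ !mulI_left !mulI_right !mxE /=.
  rewrite (inj_eq (@lshift_inj 2 2)).
  by rewrite oppr0 !mulr0 addr0 add0r.
have hyp1 t : 1 / 2 <= `|disc J 0 w (circle 1 t)|.
  have h1 : disc J 0 w (circle 1 t) 0 (lshift 2 0) = cos t.
    by rewrite /circle; have [-> _] := Jw (1 * cos t) (1 * sin t) 0; rewrite eqxx mulr1 mul1r.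
  have h2 : disc J 0 w (circle 1 t) 0 (rshift 2 0) = sin t.
    by rewrite /circle; have [_ ->] := Jw (1 * cos t) (1 * sin t) 0; rewrite eqxx mulr1 mul1r.
  have l1 := mx_norm_coord (disc J 0 w (circle 1 t)) 0 (lshift 2 0).
  have l2 := mx_norm_coord (disc J 0 w (circle 1 t)) 0 (rshift 2 0).
  rewrite leNgt; apply/negP => lt.
  rewrite h1 in l1; rewrite h2 in l2.
  have c1 := le_lt_trans l1 lt; have c2 := le_lt_trans l2 lt.
  have := cos2Dsin2 t; move: c1 c2; rewrite !ltr_norml => /andP[a1 a2] /andP[b1 b2]; nra.
have hyp2 (t : R) v : t *: u = disc J 0 w v -> t = 0.
  case: v => a b e; have [h1 _] := Jw a b 1.
  by move: h1; rewrite -e !mxE !eqxx /= mulr1 mulr0.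
have ext j := @hartogs R V J 2 (ler1n _ 2) (@mulI_bound R 2) _ _ w u (1/2)
  ltac:(by rewrite divr_gt0) hyp1 hyp2 (hS j).
have [ab Hab] : exists ab : 'I_2 -> R * R, forall j,
    hol J setT (fun z => if z == 0 then (ab j).1 else conj_real (S z) 0 (lshift 2 j))
               (fun z => if z == 0 then (ab j).2 else conj_real (S z) 0 (rshift 2 j)).
  have : forall j, exists ab : R * R,
    hol J setT (fun z => if z == 0 then ab.1 else conj_real (S z) 0 (lshift 2 j))
               (fun z => if z == 0 then ab.2 else conj_real (S z) 0 (rshift 2 j)).
    by move=> j; have [a [b h]] := ext j; exists (a, b).
  by move=> /choice[ab h]; exists ab.
exists (row_mx (\row_j (ab j).1) (\row_j (ab j).2)).
apply: hol_CR => j; move: (Hab j); congr hol; apply/funext => z; case: ifP => // _.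
  by rewrite row_mxEl mxE.
by rewrite row_mxEr mxE.
Qed.

(** The value at 0 given by Hartogs must be 0. Otherwise [S x] tends to a nonzero [d] as [x] tends
    to 0, and by continuity of [S'] at [d] the points [x = S' (S x)] would stay away from 0. *)
Lemma antihol_extend0 (S S' : V -> V) : antihol S -> antihol S' ->
  (forall x, x != 0 -> S x != 0 /\ S' x != 0) ->
  (forall x, x != 0 -> S' (S x) = x) -> CR (-1) (extend0 S).
Proof.
move=> hS hS' nz SK.
have [c hc] := antihol_extension hS.
have [c' hc'] := antihol_extension hS'.
suff c0 : c = 0.
  have -> : extend0 S = (@conj_real R) \o (fun x => if x == 0 then c else conj_real (S x)).
    apply/funext => x; rewrite /extend0 /=; case: ifP => _; last by rewrite conj_realK.
    by rewrite c0; apply/esym/eqP; rewrite conj_real_eq0.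
  by rewrite -[X in CR X _]mulr1; exact: (CR_comp (CR_conj R) hc).
apply/eqP; apply: contrapT => /negP cn0.
pose d := conj_real c.
have d0 : d != 0 by rewrite conj_real_eq0.
pose w := conj_real (S' d).
have w0 : 0 < `|w| by rewrite normr_gt0 conj_real_eq0; have [] := nz _ d0.
have n1 : \forall y \near d, y != 0 /\ `|w| / 2 < `|S' y|.
  have n2 : \forall y \near d, y != 0.
    by apply: open_nbhs_nbhs; split => //; exact: open_neq0.
  pose g x := if x == 0 then c' else conj_real (S' x).
  have cg : {for d, continuous (fun y => `|g y|)}.
    by apply: (@continuous_comp _ _ _ g (fun x : V => `|x|)); [exact: CR_continuous hc' d|exact: norm_continuous].
  have n3 : \forall y \near d, `|w| / 2 < `|g y|.
    have /(_ [set t | `|w| / 2 < t]) := cg; apply.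
    rewrite /g /= (negbTE d0) -/w; apply: (@open_nbhs_nbhs _ _ [set t | `|w| / 2 < t]).
    by split; [exact: open_gt|rewrite /= ltr_pdivrMr// ltr_pMr// ltrDl].
  near=> y; have y0 : y != 0 by near: y.
  split => //; have : `|w| / 2 < `|g y| by near: y.
  by rewrite /g (negbTE y0) norm_conj_real.
pose g2 x := if x == 0 then c else conj_real (S x).
have cg2 : {for 0, continuous (fun y => conj_real (g2 y))}.
  by apply: (@continuous_comp _ _ _ g2 (@conj_real R)); [exact: CR_continuous hc 0|exact: conj_real_continuous].
have n4 : \forall x \near (0 : V), (fun y => y != 0 /\ `|w| / 2 < `|S' y|)
    (conj_real (g2 x)).
  have /(_ (fun y => y != 0 /\ `|w| / 2 < `|S' y|)) := cg2; apply.
  by rewrite /g2 /= eqxx.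
have /nbhs_ballP[e /= e0 eB] := n4.
pose r := Num.min (e / 2) (`|w| / 2).
have r0 : 0 < r by rewrite lt_min !divr_gt0.
pose v : V := const_mx 1.
have v1 : `|v| != 0.
  by rewrite normr_eq0; apply/eqP => /matrixP/(_ 0 0)/eqP; rewrite !mxE oner_eq0.
pose x := (r / `|v|) *: v.
have xr : `|x| = r by rewrite normrZ normrM normfV normr_id mulfVK// gtr0_norm.
have x0 : x != 0 by rewrite -normr_gt0 xr.
have := eB x; rewrite -ball_normE /= sub0r normrN xr /g2 (negbTE x0) conj_realK SK// xr.
have re : r < e by rewrite /r gt_min ltr_pdivrMr// ltr_pMr// ltrDl ltr01.
by move=> /(_ re)[_]; rewrite ltNge ge_min lexx orbT.
Unshelve. all: by end_near.
Qed.

End Extension.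

(** * Freeness and proper discontinuity of the deck group *)

Section Deck.
Variables (R : realType) (H : complex_surface R) (sigma : H -> H).
Local Notation V := 'rV[R]_(2 + 2).
Variables (S S' : V -> V) (P : V -> H).
Hypothesis L : real_lift sigma S S' P.
Local Notation T := (extend0 S).
Local Notation T' := (extend0 S').
Local Notation f := (T \o T).
Local Notation g := (T' \o T').

Lemma extend0_lift : [/\ CR (-1) T, CR (-1) T', cancel T T', cancel T' T & T 0 = 0].
Proof.
have [hS hS'] := lift_antihol L.
have nz := lift_neq0 L; have K := lift_inverse L.
split.
- by apply: (antihol_extend0 hS hS' nz) => x /K[].
- apply: (antihol_extend0 hS' hS); first by move=> x /nz[].
  by move=> x /K[].
- move=> x; rewrite /extend0; case: (eqVneq x 0) => [->|x0]; first by rewrite eqxx.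
  by have [h _] := nz _ x0; rewrite (negbTE h); have [] := K _ x0.
- move=> x; rewrite /extend0; case: (eqVneq x 0) => [->|x0]; first by rewrite eqxx.
  by have [_ h] := nz _ x0; rewrite (negbTE h); have [] := K _ x0.
- by rewrite /extend0 eqxx.
Qed.

Let T_neq0 x : x != 0 -> T x != 0.
Proof. by move=> x0; rewrite /extend0 (negbTE x0); have [] := lift_neq0 L x0. Qed.

Let fE n x : x != 0 -> iter n f x = iter n (S \o S) x /\ iter n f x != 0.
Proof.
move=> x0; elim: n => [|n [IH1 IH2]] //=; split; last by apply: T_neq0; apply: T_neq0.
rewrite -IH1 /extend0 (negbTE IH2); case: ifP => // /eqP h.
by have [] := lift_neq0 L IH2; rewrite h eqxx.
Qed.

Let cf : continuous f.
Proof. by have [h _ _ _ _] := extend0_lift; exact: (CR_continuous (CR_comp h h)). Qed.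

Let fiber x y : x != 0 -> y != 0 ->
  (P x = P y <-> exists n, iter n f x = y \/ iter n f y = x).
Proof.
move=> x0 y0; rewrite (lift_fiber L x0 y0).
by split=> -[n h]; exists n; move: h; rewrite (fE n x0).1 (fE n y0).1.
Qed.

Let Pf n x : x != 0 -> P (iter n f x) = P x.
Proof. by move=> x0; apply/esym/fiber => //; [exact: (fE n x0).2|exists n; left]. Qed.

Let fK n : cancel (iter n f) (iter n g).
Proof.
have [_ _ TK _ _] := extend0_lift.
by apply: iterK => x /=; rewrite !TK.
Qed.

Let sheet x : x != 0 -> exists U : set V, [/\ open U, U x, U `<=` @punctured R &
  forall u u', U u -> U u' -> P u = P u' -> u = u'].
Proof.
move=> x0; have [U [N [k [[oU Ux Up _ _] kP _ _ _]]]] := lift_section L x0.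
exists U; split=> // u u' Uu Uu' e.
by have [_ <-] := kP _ Uu; have [_ <-] := kP _ Uu'; rewrite e.
Qed.

(** Local inverses of [P] are locally bounded; compactness of [H], used as a near covering with the
    bound going to infinity, makes the bound global. *)
Lemma compact_fundamental_domain : compact [set: H] ->
  exists C : R, forall y, exists x, [/\ x != 0, P x = y & `|x| <= C].
Proof.
move=> /compact_near_coveringP ch.
have := ch R +oo (fun M y => exists x, [/\ x != 0, P x = y & `|x| <= M]) _.
case.
  move=> y _; have [x x0 Px] := lift_surj L y.
  have [U [N [k [[oU Ux Up oN Nx] kP Pk ck _]]]] := lift_section L x0.
  have Ny : N y by rewrite -Px.
  have ck1 : {for y, continuous k}.
    by move: (ck); rewrite continuous_open_subspace// => h; apply: h; rewrite inE.
  have ck2 : {for y, continuous (fun z => `|k z|)}.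
    by apply: (@continuous_comp _ _ _ k (fun x : V => `|x|)); [exact: ck1|exact: norm_continuous].
  have n1 : \forall z \near y, `|k z| < `|k y| + 1.
    have /(_ [set t | t < `|k y| + 1]) := ck2; apply.
    apply: open_nbhs_nbhs; split; first exact: open_lt.
    by rewrite /= ltrDl.
  have n2 : \forall z \near y, N z by exact: open_nbhs_nbhs.
  exists ([set z | N z /\ `|k z| < `|k y| + 1], [set M | `|k y| + 1 < M]).
    by split; [apply: filterI|exists (`|k y| + 1); split => //; exact: num_real].
  move=> [z M] /= [[Nz kz] hM]; have [Uk Pkz] := Pk _ Nz.
  by exists (k z); split=> //; [exact: Up|exact/ltW/(lt_trans kz)].
move=> M [_ h]; exists (M + 1) => y; have := h (M + 1) _ y I.
by apply; rewrite ltrDl.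
Qed.

(** The fixed points of [iter n f] form a closed set, and an open one because [P] is injective on
    sheets. By connectedness a single one makes this power the identity. Orbits then have at most
    [n] points, and each meets the ball given by compactness, so the whole punctured space would be
    bounded. *)
Lemma deck_free n z : compact [set: H] -> (0 < n)%N -> z != 0 -> iter n f z <> z.
Proof.
move=> /compact_fundamental_domain[C HC] n0 z0 fz.
pose B := [set x | punctured x /\ iter n f x = x].
have BE : B = @punctured R.
  apply: (@connected_punctured R).
  - by exists z.
  - exists [set x | nbhs x [set y | iter n f y = y]]; first exact: open_interior.
    apply/seteqP; split => [x [x0 fx]|x [x0 nx]]; split=> //; last exact: nbhs_singleton nx.
    have [U [oU Ux Up Uinj]] := sheet x0.
    have nU : nbhs x U by exact: open_nbhs_nbhs.
    have nfU : nbhs x (iter n f @^-1` U).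
      by apply: (@iter_continuous _ f n cf x); rewrite fx.
    apply: filterS (filterI nU nfU) => y [Uy Ufy] /=.
    by apply: Uinj => //; rewrite Pf//; exact: Up.
  - exists [set x | iter n f x = x]; last by apply/seteqP; split.
    have -> : [set x | iter n f x = x] = (fun x => `|iter n f x - x|) @^-1` [set t | t <= 0].
      by apply/seteqP; split => x /=; rewrite normr_le0 subr_eq0 => /eqP.
    apply: closed_comp; last exact: closed_le.
    move=> x _; apply: (@continuous_comp _ _ _ (fun x => iter n f x - x) (fun x : V => `|x|)).
      by apply: continuousB; [exact: (@iter_continuous _ f n cf x)|exact: cvg_id].
    exact: norm_continuous.
have fid x : x != 0 -> iter n f x = x by move=> x0; have [] : B x by rewrite BE.
have fidk k x : x != 0 -> iter (k * n) f x = x.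
  by move=> x0; elim: k => // k IH; rewrite mulSn iterD IH fid.
have [C' C'0 HC'] : exists2 C', 0 < C' & forall i x, (i < n)%N -> `|x| <= C -> `|iter i f x| <= C'.
  elim: (n) => [|k [C1 C10 IH]]; first by exists 1.
  have [C2 C20 HC2] := norm_bound_continuous C (@iter_continuous R f k cf).
  exists (C1 + C2); first exact: addr_gt0.
  move=> i x; rewrite ltnS leq_eqVlt => /predU1P[->|ik] xr.
    by rewrite (le_trans (HC2 _ xr))// lerDr ltW.
  by rewrite (le_trans (IH _ _ ik xr))// lerDl ltW.
have bd (x : V) : x != 0 -> `|x| <= C'.
  move=> x0; have [y [y0 Py yC]] := HC (P x).
  have [m [h|h]] := (fiber y0 x0).1 Py.
    rewrite -h (divn_eq m n) addnC iterD fidk// ; exact: HC' (ltn_pmod _ n0) yC.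
  have -> : x = iter (m * n - m)%N f y.
    rewrite -h -iterD subnK ?leq_pmulr// mulnC.
    by rewrite mulnC fidk.
  rewrite (divn_eq (m * n - m) n) addnC iterD fidk//; exact: HC' (ltn_pmod _ n0) yC.
have : `| ((C' + 1) / `|z|) *: z| <= C'.
  by apply: bd; rewrite scaler_eq0 negb_or z0 mulf_neq0 ?invr_eq0 ?normr_eq0// gt_eqF// addr_gt0.
rewrite normrZ normrM normfV normr_id mulfVK ?normr_eq0// gtr0_norm ?addr_gt0//.
by rewrite leNgt ltrDl ltr01.
Qed.

(** Argued near each pair (z, w) of points of [K]. In distinct fibres, the Hausdorff property of [H]
    separates all translates. In the same fibre, two points of one sheet with the same image
    coincide, and freeness excludes all large exponents. *)
Lemma deck_properly_discontinuous : compact [set: H] -> properly_discontinuous f.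
Proof.
move=> cH K cK Kp.
have := @compact_setX _ _ K K cK cK; move=> /compact_near_coveringP cKK.
have := cKK nat \oo (fun n zw => iter n f zw.1 != zw.2) _.
case; last first.
  move=> N _ hN; exists N => n z Nn Kz Kf.
  by have /= := hN n Nn (z, iter n f z) (conj Kz Kf); rewrite eqxx.
move=> [z w] [/= Kz Kw].
have z0 := Kp _ Kz; have w0 := Kp _ Kw.
have [e|ne] := pselect (P z = P w).
  have [U [oU Uz Up Uinj]] := sheet z0.
  have nU : nbhs z U by exact: open_nbhs_nbhs.
  have cg : continuous g.
    by have [_ h _ _ _] := extend0_lift; exact: (CR_continuous (CR_comp h h)).
  have [i [h|h]] := (fiber z0 w0).1 e.
    have nw : nbhs w (iter i g @^-1` U).
      by apply: (@iter_continuous _ g i cg w); rewrite -h fK.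
    exists ([set zw | U zw.1 /\ U (iter i g zw.2)], [set n | (i < n)%N]) => /=.
      split; last by exists i.+1.
      by exists (U, iter i g @^-1` U).
    move=> [[x y] n] /= [[Ux Uy] ni]; apply/eqP => fxy.
    have h2 : iter i g y = iter (n - i) f x.
      by rewrite -fxy -{1}(subnKC (ltnW ni)) iterD fK.
    have x0 := Up _ Ux.
    apply: (@deck_free (n - i) x cH _ x0); first by rewrite subn_gt0.
    by apply: Uinj => //; [rewrite -h2|rewrite Pf].
  have nw : nbhs w (iter i f @^-1` U).
    by apply: (@iter_continuous _ f i cf w); rewrite h.
  exists ([set zw | U zw.1 /\ U (iter i f zw.2)], [set n | (0 < n)%N]) => /=.
    split; last by exists 1%N.
    by exists (U, iter i f @^-1` U).
  move=> [[x y] n] /= [[Ux Uy] ni]; apply/eqP => fxy.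
  have x0 := Up _ Ux.
  apply: (@deck_free (i + n) x cH _ x0); first by rewrite addn_gt0 ni orbT.
  by rewrite iterD fxy; apply: Uinj => //; rewrite -fxy -iterD Pf.
have := surf_hausdorff (c := H); rewrite open_hausdorff => /(_ (P z) (P w)).
case; first exact/eqP.
move=> [A B] /= [Az Bw] [oA oB /eqP AB].
have nA : nbhs z (P @^-1` A).
  by apply: (lift_continuous L z0); apply: open_nbhs_nbhs; split => //; exact: set_mem.
have nB : nbhs w (P @^-1` B).
  by apply: (lift_continuous L w0); apply: open_nbhs_nbhs; split => //; exact: set_mem.
have nz : nbhs z (@punctured R) by apply: open_nbhs_nbhs; split => //; exact: open_punctured.
exists ([set zw | (punctured zw.1 /\ A (P zw.1)) /\ B (P zw.2)], setT) => /=.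
  split; last exact: filterT.
  by exists (@punctured R `&` P @^-1` A, P @^-1` B); [split => //; exact: filterI|move=> [x y] []].
move=> [[x y] n] /= [[[x0 Ax] By] _]; apply/eqP => fxy.
have : (A `&` B) (P x) by split => //; rewrite -(Pf n x0) fxy.
by rewrite AB.
Qed.

Lemma lift_absorbing : compact [set: H] -> absorbing T \/ absorbing T'.
Proof.
move=> cH; have [hT hT' TK T'K T0] := extend0_lift.
have cT := CR_continuous hT.
apply: (absorbing_dichotomy cT (CR_continuous hT') TK T'K T0).
move=> K cK Kp.
have cTK : compact (T @` K) by apply: continuous_compact => //; exact: continuous_subspaceT.
(* Adding the image of [K] under [T] absorbs the odd iterates: an odd power of [T] is a power of [f]
   applied after one more [T]. *)
have [||N HN] := @deck_properly_discontinuous cH (K `|` T @` K).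
- exact: compactU.
- by move=> x [/Kp//|[y /Kp y0 <-]]; exact: T_neq0.
have f2 k x : iter k f x = iter (k * 2) T x.
  by elim: k => //= k ->.
exists (N * 2)%N => m z Nm Kz Kf.
have Nd : (N <= m./2)%N by rewrite geq_half_double -muln2.
have mE := odd_double_half m.
case om: (odd m) mE => mE.
  apply: (HN m./2 (T z) Nd); first by right; exists z.
  by left; rewrite f2 muln2 -iterSr; have -> : (m./2.*2).+1 = m by rewrite -[RHS]mE.
apply: (HN m./2 z Nd); first by left.
by left; rewrite f2 muln2; have -> : m./2.*2 = m by rewrite -[RHS]mE.
Qed.

End Deck.

(** * Smooth inverses and cut-offs *)

Section InverseSmooth.
Variable R : realType.

Lemma Ck_det k (E : normedModType R) (D : set E) n (A : E -> 'M[R]_n) : open D ->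
  (forall i j, Ck k D (fun x => A x i j)) -> Ck k D (fun x => \det (A x)).
Proof.
move=> oD hA; rewrite /determinant.
apply: (@Ck_sum _ k E R) => // s; apply: CkM => //; first exact: Ck_cst.
by apply: Ck_prod.
Qed.

Lemma Ck_adj k (E : normedModType R) (D : set E) n (A : E -> 'M[R]_n) i j : open D ->
  (forall i j, Ck k D (fun x => A x i j)) -> Ck k D (fun x => (\adj (A x)) i j).
Proof.
move=> oD hA; under eq_fun do rewrite mxE /cofactor.
apply: CkM => //; first exact: Ck_cst.
by apply: Ck_det => // a b; under eq_fun do rewrite !mxE.
Qed.

Lemma Ck_invmx k (E : normedModType R) (D : set E) n (A : E -> 'M[R]_n) i j : open D ->
  (forall x, D x -> A x \in unitmx) ->
  (forall i j, Ck k D (fun x => A x i j)) -> Ck k D (fun x => (invmx (A x)) i j).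
Proof.
move=> oD uA hA.
apply: (@Ck_ext _ k _ _ _ (fun x => (\det (A x))^-1 * (\adj (A x)) i j)) => //.
  by move=> x Dx; rewrite /invmx (uA _ Dx) [RHS]mxE.
apply: CkM => //; last exact: Ck_adj.
apply: CkV => //; last exact: Ck_det.
by move=> x /uA; rewrite unitmxE unitfE.
Qed.

Variable n : nat.
Local Notation V := 'rV[R]_n.

Lemma Csmooth_diff (f : V -> V) v : Csmooth setT f -> Csmooth setT (fun x => 'd f x v).
Proof.
move=> hf k; apply: (@Ck_ext _ k _ _ _ ('D_v f)); first exact: openT.
  by move=> x _; rewrite deriveE//; exact: (Ck_differentiable (hf 0%N)).
by apply: Csmooth_derive => //; exact: openT.
Qed.

Lemma row_injective_unitmx (A : 'M[R]_n) : (forall v : V, v *m A = 0 -> v = 0) -> A \in unitmx.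
Proof.
move=> hA; rewrite -row_free_unit -kermx_eq0; apply/eqP/row_matrixP => i.
rewrite row0; apply: hA; rewrite -row_mul mulmx_ker row0//.
Qed.

Lemma mulmx_bound (A : 'M[R]_n) : exists2 C : R, 0 < C & forall v : V, `|v *m A| <= C * `|v|.
Proof.
exists (1 + \sum_i \sum_j `|A j i|).
  by rewrite ltr_pwDl// sumr_ge0// => i _; rewrite sumr_ge0.
move=> v.
have := @mx_norm_le R 1 n (v *m A) ((1 + \sum_i \sum_j `|A j i|) * `|v|).
apply.
  by rewrite mulr_ge0// addr_ge0// sumr_ge0// => i _; rewrite sumr_ge0.
move=> i k; rewrite mxE (le_trans (ler_norm_sum _ _ _))//.
have h : \sum_j `|v i j * A j k| <= (\sum_j `|A j k|) * `|v|.
  rewrite mulr_suml; apply: ler_sum => j _; rewrite normrM mulrC ler_wpM2l//.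
  exact: mx_norm_coord.
rewrite (le_trans h)// ler_wpM2r// [X in _ <= _ + X](bigD1 k)//=.
rewrite addrCA lerDl addr_ge0// sumr_ge0// => j _; exact: sumr_ge0.
Qed.

Lemma diff_lower_bound (f g : V -> V) C x h : differentiable f x -> cancel f g -> 0 < C ->
  (forall y y', `|g y - g y'| <= C * `|y - y'|) -> `|h| <= C * `|'d f x h|.
Proof.
move=> df fg C0 gC.
have [->|h0] := eqVneq h 0; first by rewrite normr0 mulr_ge0// ltW.
apply/ler_addgt0Pr => e e0.
have hp : 0 < `|h| by rewrite normr_gt0.
have e1 : 0 < e / (C * `|h|) by rewrite divr_gt0// mulr_gt0.
have [d d0 hd] := diff_eps_delta df e1.
pose t := d / 2 / `|h|.
have t0 : 0 < t by rewrite !divr_gt0.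
have th : `|t *: h| < d.
  by rewrite normrZ gtr0_norm// divfK ?gt_eqF// ltr_pdivrMr// ltr_pMr// ltr1n.
have := hd (x + t *: h); rewrite [x + _]addrC addrK => /(_ th) hh.
have := gC (f (t *: h + x)) (f x); rewrite !fg addrK => hg.
have dZ : 'd f x (t *: h) = t *: 'd f x h := linearZ _ _.
have b1 : `|f (t *: h + x) - f x| <= e / (C * `|h|) * `|t *: h| + `|t *: 'd f x h|.
  by rewrite -dZ -[f (t *: h + x) - f x](subrK ('d f x (t *: h))) (le_trans (ler_normD _ _))// lerD2r.
have := le_trans hg (ler_wpM2l (ltW C0) b1).
have nZ v : `|t *: v| = t * `|v| by rewrite normrZ gtr0_norm.
rewrite !nZ.
have -> : C * (e / (C * `|h|) * (t * `|h|) + t * `|'d f x h|) = t * (C * `|'d f x h| + e).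
  by field; rewrite !gt_eqF.
by rewrite ler_pM2l.
Qed.

(** A Lipschitz inverse replaces the inverse function theorem: the bound makes each differential of
    [f] injective with uniformly bounded inverse, so [g] is differentiable with the inverse matrix
    as differential. The entries of that matrix are smooth functions of [g] by the adjugate formula,
    which bootstraps the order. *)
Lemma inverse_Csmooth (f g : V -> V) C : Csmooth setT f -> cancel f g -> cancel g f -> 0 < C ->
  (forall y y', `|g y - g y'| <= C * `|y - y'|) -> Csmooth setT g.
Proof.
move=> sf fK gK C0 gC.
have df x : differentiable f x by exact: (Ck_differentiable (sf 0%N)).
pose M (x : V) : 'M[R]_n := lin1_mx ('d f x).
have ME x v : 'd f x v = v *m M x by rewrite mul_rV_lin1.
have uM x : M x \in unitmx.
  apply: row_injective_unitmx => v; rewrite -ME => h.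
  have := diff_lower_bound v (df x) fK C0 gC.
  by rewrite h normr0 mulr0 normr_le0 => /eqP.
have lM x (w : V) : `|w *m invmx (M x)| <= C * `|w|.
  have := diff_lower_bound (w *m invmx (M x)) (df x) fK C0 gC.
  by rewrite ME mulmxKV.
have dg y : is_diff y g (fun w : V => w *m invmx (M (g y))).
  pose l : {linear V -> V} := mulmxr (invmx (M (g y))).
  have cl : continuous l.
    by apply: (linear_bound_continuous (C := C)) => //; [exact: linearP|exact: ltW|exact: lM].
  apply: (diff_intro (l := l) cl) => e e0.
  have e1 : 0 < e / (C * C) by rewrite divr_gt0// mulr_gt0.
  have [d d0 hd] := diff_eps_delta (df (g y)) e1.
  near=> h.
  pose k := g (h + y) - g y.
  have kC : `|k| <= C * `|h| by rewrite (le_trans (gC _ _))// addrK.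
  have hdC : `|h| < d / C.
    near: h.
    have /nbhsx_ballx : 0 < d / C by rewrite divr_gt0.
    by move=> /(_ _ (0 : V)); apply: filterS => h; rewrite -ball_normE /= sub0r normrN.
  have kd : `|k| < d by rewrite (le_lt_trans kC)// mulrC -ltr_pdivlMr.
  have := hd (g (h + y)) kd; rewrite !gK addrK => hh.
  have -> : g (h + y) - g y - l h = - (h - 'd f (g y) k) *m invmx (M (g y)).
    by rewrite ME mulNmx mulmxBl mulmxK//= opprB.
  rewrite (le_trans (lM _ _))// normrN (le_trans (ler_wpM2l (ltW C0) hh))//.
  have -> : C * (e / (C * C) * `|k|) = e / C * `|k| by field; rewrite gt_eqF.
  by rewrite mulrAC ler_pdivrMr// -mulrA ler_pM2l// [`|h| * C]mulrC.
elim=> [|k IH]; first by move=> y _; have [] := dg y.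
split; first by move=> y _; have [] := dg y.
have oTT : open [set z : V * V | setT z.1] by exact: openT.
apply: Ck_row => // i.
apply: (@Ck_ext _ k _ _ _ (fun z : V * V => \sum_j z.2 0 j * invmx (M (g z.1)) j i)) => //.
  by move=> z _; have [_ ->] := dg z.1; rewrite mxE.
apply: Ck_sum => // j; apply: CkM => //.
  by apply: Ck_coord => //; exact: Ck_snd.
apply: (@Ck_invmx k _ _ n (fun z : V * V => M (g z.1))) => // a b.
apply: (@Ck_comp _ k _ _ _ _ setT (fun z : V * V => g z.1) (fun x => M x a b)) => //.
  apply: (@Ck_comp _ k _ _ _ _ setT fst g) => //; exact: Ck_fst.
apply: (@Ck_ext _ k _ _ _ (fun x => 'd f x (delta_mx 0 a) 0 b)); first exact: openT.
  by move=> x _; rewrite ME -rowE mxE.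
by apply: Ck_coord; [exact: openT|exact: Csmooth_diff].
Unshelve. all: by end_near.
Qed.

End InverseSmooth.

(** * Smooth steps and cut-off functions *)

Section Flat.
Variable R : realType.

(** The factor x^-n makes the span of this family closed under differentiation, so that the
    smoothness of the classical exp(-1/x), the case [n = 0], is a plain induction. *)
Definition flat (n : nat) (x : R) : R := if 0 < x then x^-1 ^+ n * expR (- x^-1) else 0.

Lemma expRN_inv_bound (m : nat) (x : R) : 0 < x -> expR (- x^-1) <= (m.+1%:R * x) ^+ m.+1.
Proof.
move=> x0.
have m0 : 0 < m.+1%:R :> R by rewrite ltr0n.
have -> : - x^-1 = - ((m.+1%:R * x)^-1) * m.+1%:R.
  by field; rewrite gt_eqF// gt_eqF.
rewrite expRM_natr.
have : 0 < m.+1%:R * x by exact: mulr_gt0.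
move: (_ * x) => u u0.
have hu : expR (- u^-1) <= u.
  rewrite expRN -[leRHS]invrK lef_pV2 ?posrE ?expR_gt0 ?invr_gt0//.
  by rewrite (le_trans _ (expR_ge1Dx _))// lerDr.
by rewrite lerXn2r// nnegrE ?expR_ge0// ltW.
Qed.

Lemma flat_bound n : exists2 C : R, 0 < C & forall x, 0 < x -> 0 <= flat n x <= C * x ^+ 2.
Proof.
exists (n.+2%:R ^+ n.+2); first by rewrite exprn_gt0.
move=> x x0; rewrite /flat x0 mulr_ge0 ?exprn_ge0 ?invr_ge0 ?expR_ge0 ?(ltW x0)//=.
have := expRN_inv_bound n.+1 x0; rewrite exprMn => h.
have h2 : 0 <= x^-1 ^+ n by rewrite exprn_ge0// invr_ge0 ltW.
rewrite (le_trans (ler_wpM2l h2 h))// mulrCA ler_wpM2l ?exprn_ge0//.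
by rewrite exprVn -addn2 exprD mulKf// expf_neq0// gt_eqF.
Qed.

Lemma flat_derive n (x : R) :
  is_derive x (1 : R) (flat n : R -> R) (flat n.+2 x - n%:R * flat n.+1 x).
Proof.
have [x0|x0] := ltP 0 x.
  pose u (x : R) := x^-1 ^+ n * expR (- x^-1).
  have du : is_derive x (1 : R) u (flat n.+2 x - n%:R * flat n.+1 x).
    have xn : x != 0 by rewrite gt_eqF.
    have d1 : is_derive x (1 : R) (fun y : R => y^-1) (- (x^-1 ^+ 2)) := is_derive_inv xn.
    have d2 : is_derive x (1 : R) (fun y : R => y^-1 ^+ n) (n%:R * x^-1 ^+ n.-1 * - (x^-1 ^+ 2)).
      have -> : (fun y : R => y^-1 ^+ n) = (fun y : R => y^-1) ^+ n.
        by apply/funext => y; elim: (n) => [|k IH]; rewrite ?expr0// !exprS IH.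
      exact: (is_derive_eq (is_deriveX n d1)).
    have d3 : is_derive x (1 : R) (fun y : R => expR (- y^-1)) (expR (- x^-1) * x^-1 ^+ 2).
      apply: (@is_derive_eq _ _ _ _ _ _ _ _ (@is_derive1_comp R expR (fun y => - y^-1) x _ _ _ (is_deriveN d1))).
      by rewrite opprK.
    apply: (is_derive_eq (is_deriveM d2 d3)).
    rewrite /flat x0 /GRing.scale /=; case: (n) => [|k] /=; first by ring.
    by rewrite !exprS; ring.
  have nu : \forall y \near x, u y = flat n y.
    have : \forall y \near x, 0 < y by apply: open_nbhs_nbhs; split => //; exact: open_gt.
    by apply: filterS => y y0; rewrite /flat y0.
  have [d1 d2] := is_derive_diff du.
  have [e1 e2] := near_eq_diff nu d1.
  apply: is_diff_derive => //.
  by rewrite e2 d2 /= /GRing.scale /= mul1r.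
have -> : flat n.+2 x - n%:R * flat n.+1 x = 0 by rewrite /flat ltNge x0 /= mulr0 subr0.
have [C C0 hC] := flat_bound n.
pose l0 := (fun _ : R => 0 : R).
have ll0 : linear l0 by move=> a b c; rewrite /l0 scaler0 addr0.
pose l : {linear R -> R} := HB.pack l0 (GRing.isLinear.Build R R R *:%R l0 ll0).
have dl : is_diff x (flat n : R -> R) l.
  apply: diff_intro; first exact: cst_continuous.
  move=> e e0; near=> h.
  have hC2 : `|h| < e / C.
    near: h.
    have /nbhsx_ballx : 0 < e / C by rewrite divr_gt0.
    by move=> /(_ _ (0 : R)); apply: filterS => h; rewrite -ball_normE /= sub0r normrN.
  have fx : flat n x = 0 by rewrite /flat ltNge x0.
  rewrite fx /= subr0 /l0 subr0.
  have [y0|y0] := ltP 0 (h + x); last by rewrite /flat ltNge y0 /= normr0 mulr_ge0// ltW.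
  have /andP[f0 f1] := hC _ y0; rewrite ger0_norm//.
  have hx : 0 < h by rewrite (lt_le_trans y0)// gerDl.
  rewrite (le_trans f1)//.
  have : (h + x) ^+ 2 <= h ^+ 2 by rewrite lerXn2r ?nnegrE ?(ltW hx) ?(ltW y0)// gerDl.
  move=> /(ler_wpM2l (ltW C0)) /le_trans; apply.
  move: hC2; rewrite ltr_pdivlMr// (gtr0_norm hx) => /ltW h2.
  by rewrite expr2 mulrA [C * h]mulrC; apply: ler_wpM2r; rewrite ?(ltW hx).
apply: is_diff_derive; first by have [] := dl.
by have [_ ->] := dl.
Unshelve. all: by end_near.
Qed.

Lemma flat_Ck k n : Ck k setT (flat n : R -> R).
Proof.
elim: k n => [|k IH] n.
  by move=> x _; have [] := is_derive_diff (flat_derive n x).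
apply: (@Ck_derive1 _ k setT _ (fun x => flat n.+2 x - n%:R * flat n.+1 x)); first exact: openT.
  by move=> x _; exact: flat_derive.
apply: CkB; [exact: openT|exact: IH|].
by apply: CkM; [exact: openT|exact: Ck_cst|exact: IH].
Qed.

Definition step (t : R) : R := flat 0 (2 - t) / (flat 0 (2 - t) + flat 0 (t - 1)).

Lemma flat0_ge0 x : 0 <= flat 0 x.
Proof. by rewrite /flat; case: ifP => // _; rewrite mul1r expR_ge0. Qed.

Lemma flat0_gt0 x : 0 < x -> 0 < flat 0 x.
Proof. by rewrite /flat => ->; rewrite mul1r expR_gt0. Qed.

Lemma step_denom t : 0 < flat 0 (2 - t) + flat 0 (t - 1).
Proof.
have [h|h] := ltP t 2; first by rewrite ltr_pwDl ?flat0_ge0// flat0_gt0// subr_gt0.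
by rewrite ltr_pwDr ?flat0_ge0// flat0_gt0// subr_gt0 (lt_le_trans _ h)// ltr1n.
Qed.

Lemma step_bound t : 0 <= step t <= 1.
Proof.
rewrite /step divr_ge0 ?flat0_ge0 ?(ltW (step_denom t))//= ler_pdivrMr ?step_denom//.
by rewrite mul1r lerDl flat0_ge0.
Qed.

Lemma step1 t : t <= 1 -> step t = 1.
Proof.
move=> t1; have e : flat 0 (t - 1) = 0 by rewrite /flat subr_gt0 ltNge t1.
have := step_denom t; rewrite /step e addr0 => h.
by rewrite divff// gt_eqF.
Qed.

Lemma step0 t : 2 <= t -> step t = 0.
Proof. by move=> t2; rewrite /step /flat subr_gt0 [t < 2]ltNge t2 mul0r. Qed.

Lemma step_Csmooth : Csmooth setT (step : R -> R).
Proof.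
move=> k; have oT := @openT R.
have c1 (a : R -> R) : Ck k setT a -> Ck k setT (fun t => flat 0 (a t)).
  by move=> ha; apply: (@Ck_comp _ k _ _ _ setT setT a (flat 0 : R -> R)) => //; exact: flat_Ck.
have c2 : Ck k setT (fun t : R => flat 0 (2 - t)).
  by apply: c1; apply: CkB => //; [exact: Ck_cst|exact: Ck_id].
have c3 : Ck k setT (fun t : R => flat 0 (t - 1)).
  by apply: c1; apply: CkB => //; [exact: Ck_id|exact: Ck_cst].
apply: CkM => //; apply: CkV => //; last exact: CkD.
by move=> x _; rewrite gt_eqF// step_denom.
Qed.

End Flat.

Lemma continuous_sum_seq (K : realType) (E : normedModType K) (x : E) (I : Type) (r : seq I)
    (f : I -> E -> K) : (forall i, {for x, continuous (f i)}) ->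
  {for x, continuous (fun y => \sum_(i <- r) f i y)}.
Proof.
move=> hf; elim: r => [|i r IH].
  have -> : (fun y => \sum_(i <- [::]) f i y) = cst 0 by apply/funext => y; rewrite big_nil.
  exact: cst_continuous.
have -> : (fun y => \sum_(j <- i :: r) f j y) = (fun y => f i y + \sum_(j <- r) f j y).
  by apply/funext => y; rewrite big_cons.
by apply: cvgD; [exact: hf|exact: IH].
Qed.

Section Cutoff.
Variable R : realType.
Local Notation V := 'rV[R]_(2 + 2).

(** It dominates the operator norm of the differential for the sup norm, and its continuity is
    immediate from that of the partial derivatives. *)
Definition partial_bound (f : V -> R) (x : V) : R := \sum_i `|'d f x (delta_mx 0 i)|.

Lemma partial_boundP (f : V -> R) x v : differentiable f x ->
  `|'d f x v| <= partial_bound f x * `|v|.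
Proof.
move=> df; rewrite {1}(row_sum_delta v) linear_sum /= mulr_suml.
rewrite (le_trans (ler_norm_sum _ _ _))//; apply: ler_sum => i _.
have -> : 'd f x (v 0 i *: delta_mx 0 i) = v 0 i *: 'd f x (delta_mx 0 i) by exact: linearZ.
by rewrite normrM mulrC ler_wpM2l//; exact: mx_norm_coord.
Qed.

Lemma partial_bound_continuous (f : V -> R) : Csmooth setT f -> continuous (partial_bound f).
Proof.
move=> sf x; 
apply: continuous_sum_seq => i.
have c1 : Csmooth setT (fun x => 'd f x (delta_mx 0 i : V)).
  move=> k; apply: (@Ck_ext _ k _ _ _ ('D_(delta_mx 0 i) f)); first exact: openT.
    by move=> y _; rewrite deriveE//; exact: (Ck_differentiable (sf 0%N)).
  by apply: Csmooth_derive => //; exact: openT.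
have c2 : {for x, continuous (fun x => 'd f x (delta_mx 0 i : V))}.
  exact: differentiable_continuous (Ck_differentiable (c1 0%N) I).
by apply: (@continuous_comp _ _ _ (fun x => 'd f x (delta_mx 0 i : V)) (fun t : R => `|t|)); 
  [exact: c2|exact: norm_continuous].
Qed.

(** The ambient sup norm is not differentiable, so the cut-off is a product over the coordinates,
    squared to remove signs. *)
Definition cutoff (x : V) : R := \prod_i step (x 0 i ^+ 2).

Lemma cutoff_Csmooth : Csmooth setT cutoff.
Proof.
move=> k; have oT := @openT V.
apply: (@Ck_prod _ k V setT _ (index_enum _) predT (fun i x => step (x 0 i ^+ 2))) => // i.
have := @Ck_comp R k V R R setT setT (fun x : V => x 0 i ^+ 2) (@step R) oT; apply => //.
  by apply: CkX => //; apply: (@Ck_coord _ k V _ setT id i) => //; exact: Ck_id.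
exact: step_Csmooth.
Qed.

Lemma cutoff_bound x : 0 <= cutoff x <= 1.
Proof.
rewrite /cutoff prodr_ge0 /=; last by move=> i _; have /andP[] := step_bound (x 0 i ^+ 2).
by apply: prodr_ile1 => i _; exact: step_bound.
Qed.

Lemma cutoff1 (x : V) : `|x| <= 1 -> cutoff x = 1.
Proof.
move=> x1; rewrite /cutoff big1// => i _; apply: step1.
rewrite -real_normK ?num_real// exprn_ile1//; exact: le_trans (mx_norm_coord _ _ _) x1.
Qed.

Lemma cutoff0 (x : V) : 2 <= `|x| -> cutoff x = 0.
Proof.
(* If all squared coordinates are below 2, the norm is at most 3/2, because (3/2)^2 exceeds 2; this
   contradicts the norm being at least 2. *)
move=> x2; have [[i hi]|/forallNP h] := pselect (exists i, 2 <= x 0 i ^+ 2).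
  by rewrite /cutoff (bigD1 i)//= step0// mul0r.
have : `|x| <= 3 / 2.
  have := @mx_norm_le R 1 (2 + 2) x (3 / 2); apply; first by rewrite divr_ge0.
  move=> i k; rewrite (ord1 i) leNgt; apply/negP => lt; apply: (h k).
  rewrite -real_normK ?num_real//.
  have : (3 / 2) ^+ 2 <= `|x 0 k| ^+ 2 by rewrite lerXn2r ?nnegrE ?divr_ge0// ltW.
  by apply: le_trans; lra.
by move=> /(le_trans x2); lra.
Qed.

Lemma diff_bound_lipschitz (f : V -> R) z r B : (forall x, differentiable f x) ->
  (forall x v, `|x - z| < r -> `|'d f x v| <= B * `|v|) ->
  forall x y, `|x - z| < r -> `|y - z| < r -> `|f x - f y| <= B * `|x - y|.
Proof.
move=> df hB x y xz yz.
have [|s s01 ->] := @mean_value _ _ f y x; first by move=> s _; exact: df.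
by apply: hB; exact: segment_ball.
Qed.

Lemma cutoff_lipschitz : exists2 B : R, 0 < B &
  forall x y, `|cutoff x - cutoff y| <= B * `|x - y|.
Proof.
have df x : differentiable cutoff x by exact: (Ck_differentiable (cutoff_Csmooth 0%N)).
have : compact [set partial_bound cutoff x | x in [set x : V | 0 <= `|x| <= 3]].
  apply: continuous_compact; last exact: compact_annulus.
  exact/continuous_subspaceT/partial_bound_continuous/cutoff_Csmooth.
move=> /compact_bounded[M [_ HM]].
have M1 : M < `|M| + 1 by rewrite (le_lt_trans (ler_norm M))// ltrDl.
have hB x v : `|'d cutoff x v| <= (`|M| + 1) * `|v|.
  have [x3|x3] := leP `|x| 3.
    rewrite (le_trans (partial_boundP v (df x)))// ler_wpM2r// (le_trans (ler_norm _))//.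
    by apply: (HM _ M1); exists x => //=; rewrite normr_ge0.
  have nx : \forall y \near x, cst 0 y = cutoff y.
    have : \forall y \near x, 2 < `|y|.
      have /(_ [set t | 2 < t]) := @norm_continuous R V x; apply.
      by apply: open_nbhs_nbhs; split; [exact: open_gt|rewrite /= (lt_trans _ x3)// ltr_nat].
    by apply: filterS => y /ltW y2; rewrite cutoff0.
  have [_ ->] := near_eq_diff nx (differentiable_cst (0 : R) x).
  by rewrite diff_cst /= normr0 mulr_ge0.
exists (`|M| + 1); first by rewrite ltr_wpDl.
move=> x y; pose r := `|x - y| + 1.
apply: (@diff_bound_lipschitz cutoff y r) => //.
  by rewrite ltrDl.
by rewrite subrr normr0 ltr_wpDl.
Qed.

Lemma map_lipschitz (T : V -> V) z r B : (forall i x v, `|x - z| < r ->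
    differentiable (fun x => T x 0 i : R) x /\ `|'d (fun x => T x 0 i : R) x v| <= B * `|v|) -> 0 <= B ->
  forall x y, `|x - z| < r -> `|y - z| < r -> `|T x - T y| <= B * `|x - y|.
Proof.
move=> hT B0 x y xz yz.
have := @mx_norm_le R 1 (2 + 2) (T x - T y) (B * `|x - y|) (mulr_ge0 B0 (normr_ge0 _)).
apply=> i k; rewrite (ord1 i) !mxE.
have [|s s01 ->] := @mean_value _ _ (fun x => T x 0 k : R) y x.
  by move=> s s01; exact: (hT k _ 0 (segment_ball yz xz s01)).1.
exact: (hT k _ _ (segment_ball yz xz s01)).2.
Qed.

(* The cut-off difference [s - L] has small Lipschitz constant at every scale
   because [s - L] vanishes at [0]. *)
Lemma cutoff_difference_lipschitz (B d r : R) (h : V -> V) : 0 < r -> 0 <= d -> 0 < B ->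
  (forall x y, `|cutoff x - cutoff y| <= B * `|x - y|) -> h 0 = 0 ->
  (forall x y, `|x| < 4 * r -> `|y| < 4 * r -> `|h x - h y| <= d * `|x - y|) ->
  forall x y, `|cutoff (r^-1 *: x) *: h x - cutoff (r^-1 *: y) *: h y| <=
    (3 * B + 2) * d * `|x - y|.
Proof.
move=> r0 d0 B0 hB h0 hh.
have sc (x : V) : `|r^-1 *: x| = `|x| / r by rewrite normrZ gtr0_norm ?invr_gt0// mulrC.
have out (x : V) : 2 * r <= `|x| -> cutoff (r^-1 *: x) = 0.
  by move=> x2; apply: cutoff0; rewrite sc ler_pdivlMr.
have hb (x : V) : `|x| < 4 * r -> `|h x| <= d * `|x|.
  by move=> xr; have := hh x 0 xr; rewrite normr0 h0 !subr0; apply; rewrite mulr_gt0.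
have c1 x : `|cutoff x| <= 1.
  by have /andP[a0 a1] := cutoff_bound x; rewrite ger0_norm.
have nn (x y : V) : 0 <= B * (d * `|x - y|) by rewrite !mulr_ge0// ltW.
have one (x y : V) : `|x| < 2 * r ->
    `|cutoff (r^-1 *: x) *: h x - cutoff (r^-1 *: y) *: h y| <= (3 * B + 2) * d * `|x - y|.
  move=> xr; have [yr|yr] := ltP `|y| (3 * r).
    have xr4 : `|x| < 4 * r by rewrite (lt_trans xr)// ltr_pM2r// ltr_nat.
    have yr4 : `|y| < 4 * r by rewrite (lt_trans yr)// ltr_pM2r// ltr_nat.
    have -> : cutoff (r^-1 *: x) *: h x - cutoff (r^-1 *: y) *: h y =
        (cutoff (r^-1 *: x) - cutoff (r^-1 *: y)) *: h y + cutoff (r^-1 *: x) *: (h x - h y).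
      by rewrite scalerBl scalerBr [RHS]addrC addrA subrK.
    rewrite (le_trans (ler_normD _ _))// !normrZ.
    have b1 := hB (r^-1 *: x) (r^-1 *: y); rewrite -scalerBr sc in b1.
    have b2 : `|h y| <= d * (3 * r) by rewrite (le_trans (hb _ yr4))// ler_wpM2l// ltW.
    have b3 := ler_pM (normr_ge0 _) (normr_ge0 _) b1 b2.
    have b4 := ler_pM (normr_ge0 _) (normr_ge0 _) (c1 (r^-1 *: x)) (hh _ _ xr4 yr4).
    rewrite (le_trans (lerD b3 b4))// mul1r.
    have -> : B * (`|x - y| / r) * (d * (3 * r)) = 3 * (B * (d * `|x - y|)).
      by field; rewrite gt_eqF.
    have : 0 <= d * `|x - y| by rewrite mulr_ge0.
    have := nn x y; move: `|x - y| => t; nra.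
  have yr2 : 2 * r <= `|y| by rewrite (le_trans _ yr)// ler_pM2r// ler_nat.
  rewrite (out y yr2) scale0r subr0 normrZ.
  have xr4 : `|x| < 4 * r by rewrite (lt_trans xr)// ltr_pM2r// ltr_nat.
  have b4 := ler_pM (normr_ge0 _) (normr_ge0 _) (c1 (r^-1 *: x)) (hb _ xr4).
  rewrite (le_trans b4)// mul1r.
  have b5 : r <= `|x - y|.
    have : `|y| <= `|x| + `|x - y|.
      by rewrite -{1}(subrK x y) addrC (le_trans (ler_normD _ _))// [`|y - x|]distrC.
    by move: xr yr; lra.
  have b6 : d * `|x| <= d * (2 * `|x - y|) by rewrite ler_wpM2l//; lra.
  rewrite (le_trans b6)//; have := nn x y; move: `|x - y| => t; nra.
move=> x y; have [xr|xr] := ltP `|x| (2 * r); first exact: one.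
have [yr|yr] := ltP `|y| (2 * r).
  by rewrite -normrN opprB [`|x - y|]distrC; exact: one.
rewrite !out// !scale0r subrr normr0.
have h1 := nn x y; have h2 : 0 <= d * `|x - y| by rewrite mulr_ge0.
by move: h1 h2; move: `|x - y| => t; nra.
Qed.

End Cutoff.

(** * Conjugacy by perturbation *)

Section Conjugacy.
Variable R : realType.
Local Notation V := 'rV[R]_(2 + 2).

Record smooth_auto (s s' : V -> V) : Prop := SmoothAuto {
  auto_smooth : Csmooth setT s;
  auto_smooth' : Csmooth setT s';
  autoK : cancel s s';
  autoK' : cancel s' s;
  auto0 : s 0 = 0
}.

Lemma auto_sym s s' : smooth_auto s s' -> smooth_auto s' s.
Proof. by case=> *; split=> //; rewrite -[in LHS](auto0 (s := s) (s' := s')). Qed.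

Lemma auto_neq0 s s' x : smooth_auto s s' -> x != 0 -> s x != 0.
Proof. by case=> _ _ K _ s0; apply: contra => /eqP h; rewrite -(K x) h -s0 K s0. Qed.

Lemma auto_iter_neq0 s s' n x : smooth_auto s s' -> x != 0 -> iter n s x != 0.
Proof. by move=> h x0; elim: n => //= n; exact: auto_neq0 h. Qed.

Lemma Csmooth_continuous (s : V -> V) : Csmooth setT s -> continuous s.
Proof. by move=> h x; apply: differentiable_continuous; exact: (Ck_differentiable (h 0%N)). Qed.

Definition punctured_diffeo (p p' : V -> V) := [/\ Csmooth (@punctured R) p,
  Csmooth (@punctured R) p', (forall x, x != 0 -> p x != 0 /\ p' x != 0) &
  forall x, x != 0 -> p' (p x) = x /\ p (p' x) = x].

Definition conjugate (s t : V -> V) := exists p p', punctured_diffeo p p' /\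
  forall x, x != 0 -> p (s x) = t (p x).

Lemma conjugate_trans s t u : conjugate s t -> conjugate t u -> conjugate s u.
Proof.
move=> [p [p' [[sp sp' np pK] ps]]] [q [q' [[sq sq' nq qK] qt]]].
exists (q \o p), (p' \o q'); split; first split.
- move=> k; apply: (Ck_comp _ _ (sp k) (sq k)); first exact: open_punctured.
  by move=> x /np[].
- move=> k; apply: (Ck_comp _ _ (sq' k) (sp' k)); first exact: open_punctured.
  by move=> x /nq[].
- by move=> x x0; split; [apply: (nq _ _).1; apply: (np _ _).1|apply: (np _ _).2; apply: (nq _ _).2].
- move=> x x0 /=; have [px _] := np _ x0; have [_ qx] := nq _ x0.
  by rewrite (qK _ px).1 (pK _ x0).1 (pK _ qx).2 (qK _ x0).2.
- by move=> x x0 /=; rewrite ps// qt//; have [] := np _ x0.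
Qed.

Lemma conjugate_inv s s' t t' : smooth_auto s s' -> smooth_auto t t' ->
  conjugate s' t' -> conjugate s t.
Proof.
move=> hs ht [p [p' [dp ps]]]; exists p, p'; split => // x x0.
have := ps _ (auto_neq0 hs x0); rewrite (autoK hs) => ->.
by rewrite (autoK' ht).
Qed.

Definition eventually_in (s : V -> V) (Q : set V) := forall z : V, z != 0 ->
  exists m0, \forall y \near z, forall m, (m0 <= m)%N -> Q (iter m s y).

Lemma Ck_iter k (s : V -> V) n : Csmooth setT s -> Ck k setT (iter n s).
Proof.
move=> hs; elim: n => [|n IH]; first exact: Ck_id.
by apply: (@Ck_comp _ k _ _ _ setT setT (iter n s) s) => //; exact: openT.
Qed.

(** Once the orbit stays in [Q], a further step of [s] is undone by the added step of [t']. The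
    index [mu z] works on a neighbourhood of [z], where the limit is therefore one finite composite
    of smooth maps. *)
Lemma eventual_map (s s' t t' : V -> V) Q : smooth_auto s s' -> smooth_auto t t' ->
  (forall x, Q x -> s x = t x) -> eventually_in s Q ->
  exists p : V -> V, Csmooth (@punctured R) p /\
    forall z, z != 0 -> exists N, forall n, (N <= n)%N -> p z = iter n t' (iter n s z).
Proof.
move=> hs ht hQ hev.
have [mu hmu] : exists mu : V -> nat, forall z : V, z != 0 ->
    \forall y \near z, forall m, (mu z <= m)%N -> Q (iter m s y).
  have : forall z : V, exists m0, z != 0 ->
      \forall y \near z, forall m, (m0 <= m)%N -> Q (iter m s y).
    by move=> z; have [->|z0] := eqVneq z 0; [exists 0%N|have [m h] := hev _ z0; exists m].
  by move=> /choice[mu h]; exists mu.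
have cst_ y m : (forall j, (m <= j)%N -> Q (iter j s y)) -> forall n, (m <= n)%N ->
    iter n t' (iter n s y) = iter m t' (iter m s y).
  move=> hm n /subnK <-; elim: (n - m)%N => // j IH.
  rewrite -[(j.+1 + m)%N]/(j + m).+1 iterSr iterS hQ ?(autoK ht)//.
  by apply: hm; rewrite leq_addl.
pose p z := iter (mu z) t' (iter (mu z) s z).
have pE z y : z != 0 -> y != 0 -> (forall m, (mu z <= m)%N -> Q (iter m s y)) ->
    p y = iter (mu z) t' (iter (mu z) s y).
  move=> z0 y0 h; have h' := nbhs_singleton (hmu _ y0).
  rewrite /p -(cst_ y _ h (maxn (mu z) (mu y))) ?leq_maxl//.
  by rewrite -(cst_ y _ h' (maxn (mu z) (mu y))) ?leq_maxr.
exists p; split; last first.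
  move=> z z0; exists (mu z) => n hn; apply/esym/cst_ => //.
  exact: nbhs_singleton (hmu _ z0).
move=> k; apply: Ck_local => z z0.
have nz : nbhs z (@punctured R) by apply: open_nbhs_nbhs; split => //; exact: open_punctured.
have nn : nbhs z [set y | y != 0 /\ forall m, (mu z <= m)%N -> Q (iter m s y)].
  by apply: filterI => //; exact: hmu.
have /nbhs_ballP[e /= e0 hU] := nn.
have oU : open (ball z e) by exact: ball_open.
have Uz : ball z e z by exact: ballxx.
exists (ball z e), (fun y => iter (mu z) t' (iter (mu z) s y)); split => //.
  apply: (@Ck_sub _ k _ _ setT) => //.
  apply: (@Ck_comp _ k _ _ _ setT setT (iter (mu z) s) (iter (mu z) t')) => //.
  - exact: openT.
  - exact/Ck_iter/(auto_smooth hs).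
  - exact/Ck_iter/(auto_smooth' ht).
by move=> y /hU[y0 h]; rewrite (pE z).
Qed.

(* If [s] and [t] agree where both dynamics end up, [t^-n s^n] stabilises. *)
Lemma eventual_conjugate (s s' t t' : V -> V) Q : smooth_auto s s' -> smooth_auto t t' ->
  (forall x, Q x -> s x = t x) -> eventually_in s Q -> eventually_in t Q -> conjugate s t.
Proof.
move=> hs ht hQ es et.
have [p [sp pE]] := eventual_map hs ht hQ es.
have [q [sq qE]] := eventual_map ht hs (fun x h => esym (hQ x h)) et.
have np x : x != 0 -> p x != 0.
  move=> x0; have [N h] := pE _ x0; rewrite (h N)//.
  by apply: (auto_iter_neq0 _ (auto_sym ht)); exact: auto_iter_neq0 hs _.
have nq x : x != 0 -> q x != 0.
  move=> x0; have [N h] := qE _ x0; rewrite (h N)//.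
  by apply: (auto_iter_neq0 _ (auto_sym hs)); exact: auto_iter_neq0 ht _.
exists p, q; split; first split => //.
- by move=> x x0; split; [exact: np|exact: nq].
- move=> x x0; split.
    have [N h] := pE _ x0; have [M h'] := qE _ (np _ x0).
    rewrite (h' (maxn N M)) ?leq_maxr// (h (maxn N M)) ?leq_maxl//.
    by rewrite (iterK _ (autoK' ht)) (iterK _ (autoK hs)).
  have [N h] := qE _ x0; have [M h'] := pE _ (nq _ x0).
  rewrite (h' (maxn N M)) ?leq_maxr// (h (maxn N M)) ?leq_maxl//.
  by rewrite (iterK _ (autoK' hs)) (iterK _ (autoK ht)).
- move=> x x0; have [N h] := pE _ x0; have [M h'] := pE _ (auto_neq0 hs x0).
  have hn : (N <= (maxn N M).+1)%N := leqW (leq_maxl _ _).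
  rewrite (h _ hn) iterS (autoK' ht).
  by rewrite (h' (maxn N M)) ?leq_maxr// iterSr.
Qed.

Definition contracting (s : V -> V) := forall e : R, 0 < e -> exists N, forall m x, (N <= m)%N ->
  `|iter m s x| <= e * `|x|.

Lemma contracting_eventually s (e : R) : 0 < e -> contracting s -> eventually_in s [set x | `|x| < e].
Proof.
move=> e0 cs z z0; have zp : 0 < `|z| by rewrite normr_gt0.
have e1 : 0 < e / 2 / `|z| / 2 by rewrite !divr_gt0.
have [N HN] := cs _ e1; exists N.
have : \forall y \near z, `|y| < 2 * `|z|.
  have /(_ [set t | t < 2 * `|z|]) := @norm_continuous R V z; apply.
  by apply: open_nbhs_nbhs; split; [exact: open_lt|rewrite /= ltr_pMl// ltr1n].
apply: filterS => y hy m Nm; rewrite /= (le_lt_trans (HN _ _ Nm))//.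
have : e / 2 / `|z| / 2 * `|y| < e / 2 / `|z| / 2 * (2 * `|z|) by rewrite ltr_pM2l.
move/lt_le_trans; apply.
have -> : e / 2 / `|z| / 2 * (2 * `|z|) = e / 2 by field; rewrite gt_eqF.
by rewrite ler_pdivrMr// ler_pMr// ler1n.
Qed.

Lemma contracting_eventually_inv s s' (r : R) : 0 < r -> cancel s' s -> contracting s ->
  eventually_in s' [set x | r < `|x|].
Proof.
move=> r0 K cs z z0; have zp : 0 < `|z| by rewrite normr_gt0.
have e1 : 0 < `|z| / 2 / r by rewrite !divr_gt0.
have [N HN] := cs _ e1; exists N.
have : \forall y \near z, `|z| / 2 < `|y|.
  have /(_ [set t | `|z| / 2 < t]) := @norm_continuous R V z; apply.
  by apply: open_nbhs_nbhs; split; [exact: open_gt|rewrite /= ltr_pdivrMr// ltr_pMr// ltr1n].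
apply: filterS => y hy m Nm /=.
have := HN m (iter m s' y) Nm; rewrite (iterK _ K) => /(lt_le_trans hy).
by rewrite mulrAC -mulrA ltr_pMr ?divr_gt0// ltr_pdivlMr// mul1r.
Qed.

(** Only a power contracts, since the norm is not adapted to the map. Division by [k] leaves fewer
    than [k] stray steps, at a cost of at most [C ^+ k], which the powers of [c] eventually
    absorb. *)
Lemma contracting_power s k c C : (0 < k)%N -> 0 <= c < 1 -> 1 <= C -> (forall x, `|s x| <= C * `|x|) ->
  (forall x, `|iter k s x| <= c * `|x|) -> contracting s.
Proof.
move=> k0 /andP[c0 c1] C1 hC hc e e0.
have C0 : 0 < C by exact: lt_le_trans C1.
have hCi i x : `|iter i s x| <= C ^+ i * `|x|.
  elim: i => [|i IH]; first by rewrite mul1r.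
  by rewrite exprS -mulrA (le_trans (hC _))// ler_wpM2l// ltW.
have hci i x : `|iter (i * k) s x| <= c ^+ i * `|x|.
  elim: i => [|i IH]; first by rewrite mul1r.
  by rewrite mulSn iterD exprS -mulrA (le_trans (hc _))// ler_wpM2l.
have [N HN] : exists N, forall i, (N <= i)%N -> c ^+ i <= e / C ^+ k.
  have /cvgrPdist_lt : (fun i => c ^+ i) @ \oo --> (0 : R) by apply: cvg_expr; rewrite ger0_norm.
  move=> /(_ (e / C ^+ k)); rewrite divr_gt0 ?exprn_gt0// => /(_ isT)[N _ HN].
  exists N => i /HN /=; rewrite sub0r normrN ger0_norm ?exprn_ge0//; exact: ltW.
exists (N * k)%N => m x Nm.
rewrite (divn_eq m k) addnC iterD (le_trans (hCi _ _))//.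
have h1 := hci (m %/ k)%N x.
have h2 : c ^+ (m %/ k)%N <= e / C ^+ k by apply: HN; rewrite leq_divRL.
have h3 : C ^+ (m %% k)%N <= C ^+ k by rewrite ler_weXn2l// ltnW// ltn_pmod.
have h4 := le_trans h1 (ler_wpM2r (normr_ge0 x) h2).
have h5 := ler_pM (exprn_ge0 _ (ltW C0)) (normr_ge0 _) h3 h4.
rewrite (le_trans h5)// mulrA mulrCA divff ?mulr1// expf_neq0// gt_eqF//.
Qed.

End Conjugacy.

Section Perturbation.
Variable R : realType.
Local Notation V := 'rV[R]_(2 + 2).

Lemma can_linear (L L' : V -> V) : linear L -> cancel L L' -> cancel L' L -> linear L'.
Proof.
move=> lL K K' a x y; apply: (can_inj K); rewrite K' lL !K'//.
Qed.

Lemma linear_0 (L : V -> V) : linear L -> L 0 = 0.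
Proof. by move=> lL; have := lL (-1) 0 0; rewrite scaler0 addr0 scaleN1r addNr. Qed.

Lemma linear_B (L : V -> V) x y : linear L -> L (x - y) = L x - L y.
Proof. by move=> lL; rewrite -[x - y]addrC -scaleN1r lL scaleN1r addrC. Qed.

Lemma linear_auto (L L' : V -> V) C : linear L -> cancel L L' -> cancel L' L -> 0 <= C ->
  (forall x, `|L x| <= C * `|x|) -> (forall x, `|L' x| <= C * `|x|) -> smooth_auto L L'.
Proof.
move=> lL K K' C0 LC LC'; have lL' := can_linear lL K K'.
have cL := linear_bound_continuous lL C0 LC.
have cL' := linear_bound_continuous lL' C0 LC'.
split=> //; last exact: linear_0.
- by move=> k; exact: Ck_linear.
- by move=> k; exact: Ck_linear.
Qed.

Lemma contraction_fixpoint (u : V -> V) (q : R) : 0 <= q -> q < 1 ->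
  (forall x y, `|u x - u y| <= q * `|x - y|) -> exists p, p = u p.
Proof.
move=> q0 q1 hu.
pose F : {fun [set: V] >-> [set: V]} := HB.pack u (isFun.Build V V setT setT u (fun x _ => I)).
pose cV := HB.pack_for (completeNormedModType R) V.
have ctr : is_contraction F by exists (NngNum q0); split => // -[x y] _; exact: hu.
have [p _ pF] := @banach_fixed_point R cV setT F ctr closedT (ex_intro _ 0 I).
by exists p.
Qed.

(** The error is explicit in [C], [K] and [k] because [perturbation] fixes [K] before the maps are
    known. *)
Lemma iter_perturbation (L eta : V -> V) (C K : R) k : linear L -> 1 <= C -> 0 <= K -> K <= 1 ->
  (forall x, `|L x| <= C * `|x|) -> (forall x, `|eta x| <= K * `|x|) ->
  forall x, `|iter k (fun x => L x + eta x) x| <= (C + 1) ^+ k * `|x| /\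
    `|iter k (fun x => L x + eta x) x - iter k L x| <= K * k%:R * (C + 1) ^+ k * `|x|.
Proof.
move=> lL C1 K0 K1 hL he; elim: k => [|k IH] x.
  by rewrite /= subrr normr0 expr0 mulr0 !mul0r mul1r lexx.
have C0 : 0 <= C + 1 by rewrite addr_ge0// (le_trans ler01).
have [h1 h2] := IH x; rewrite !iterS.
set y := iter k _ x in h1 h2 *; set z := iter k L x in h2 *.
have e1 := he y.
have e2 : K * `|y| <= `|y| by rewrite ler_piMl.
split.
  rewrite (le_trans (ler_normD _ _))// exprS -mulrA.
  apply: le_trans (ler_wpM2l C0 h1); rewrite mulrDl mul1r lerD//.
  exact: le_trans e1 e2.
have -> : L y + eta y - L z = L (y - z) + eta y by rewrite linear_B// addrAC.
rewrite (le_trans (ler_normD _ _))//.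
have e3 := le_trans (hL _) (ler_wpM2l (le_trans ler01 C1) h2).
have e4 := le_trans e1 (ler_wpM2l K0 h1).
rewrite (le_trans (lerD e3 e4))// exprS -natr1.
have p0 : 0 <= K * ((C + 1) ^+ k * `|x|) by rewrite !mulr_ge0// exprn_ge0.
have pk : 0 <= k%:R * (K * ((C + 1) ^+ k * `|x|)) by rewrite mulr_ge0.
rewrite -subr_ge0.
have -> : K * (k%:R + 1) * ((C + 1) * (C + 1) ^+ k) * `|x| -
    (C * (K * k%:R * (C + 1) ^+ k * `|x|) + K * ((C + 1) ^+ k * `|x|)) =
  k%:R * (K * ((C + 1) ^+ k * `|x|)) + C * (K * ((C + 1) ^+ k * `|x|)) by ring.
by rewrite addr_ge0// mulr_ge0// (le_trans ler01).
Qed.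

(** Solving L x + eta x = y is a fixed point problem for x |-> L' (y - eta x), a contraction of
    ratio 1/2. The same bound makes the inverse Lipschitz with constant [2 * C], as
    [inverse_Csmooth] requires. *)
Lemma lipschitz_perturbation_auto (L L' eta : V -> V) (C K : R) : linear L -> cancel L L' -> cancel L' L ->
  1 <= C -> (forall x, `|L x| <= C * `|x|) -> (forall x, `|L' x| <= C * `|x|) ->
  0 <= K -> K * C <= 2^-1 -> Csmooth setT eta -> eta 0 = 0 ->
  (forall x y, `|eta x - eta y| <= K * `|x - y|) ->
  exists s', smooth_auto (fun x => L x + eta x) s'.
Proof.
move=> lL LK LK' C1 hL hL' K0 KC se e0 he.
have C0 : 0 <= C by rewrite (le_trans ler01).
have lL' := can_linear lL LK LK'.
have sur y : exists x, L x + eta x = y.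
  have [|||p pE] := @contraction_fixpoint (fun x => L' (y - eta x)) 2^-1.
  - by rewrite invr_ge0.
  - by rewrite invf_lt1// ltr1n.
  - move=> a b; rewrite -linear_B//.
    have -> : y - eta a - (y - eta b) = eta b - eta a by rewrite opprB addrC subrKA.
    rewrite (le_trans (hL' _))// (le_trans (ler_wpM2l C0 (he b a)))// distrC mulrA ler_wpM2r//.
    by rewrite mulrC.
  by exists p; rewrite {1}pE LK' subrK.
have [s' hs'] := choice sur.
have low x x' : `|x - x'| <= 2 * C * `|(L x + eta x) - (L x' + eta x')|.
  have h1 : `|x - x'| <= C * `|L x - L x'|.
    by have := hL' (L x - L x'); rewrite linear_B// !LK.
  have h2 : `|L x - L x'| <= `|(L x + eta x) - (L x' + eta x')| + K * `|x - x'|.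
    have -> : L x - L x' = ((L x + eta x) - (L x' + eta x')) - (eta x - eta x').
      move: (L x) (L x') (eta x) (eta x') => a b u v.
      by apply/rowP => i; rewrite !mxE; ring.
    by rewrite (le_trans (ler_normB _ _))// lerD2l.
  have h3 := le_trans h1 (ler_wpM2l C0 h2).
  have h4 : C * (K * `|x - x'|) <= 2^-1 * `|x - x'| by rewrite mulrA [C * K]mulrC ler_wpM2r.
  set N := `|L x + eta x - _| in h2 h3 *.
  by move: h3 h4; clear h2; clearbody N; move: N `|x - x'| => a b; nra.
have sK : cancel (fun x => L x + eta x) s'.
  move=> x; apply/eqP; rewrite -subr_eq0 -normr_le0.
  by rewrite (le_trans (low _ _))// hs' subrr normr0 mulr0.
have sL : Csmooth setT L by move=> k; apply: Ck_linear => //; exact: (linear_bound_continuous lL C0 hL).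
have ss : Csmooth setT (fun x => L x + eta x) by move=> k; apply: CkD => //; exact: openT.
exists s'; split => //; last by rewrite e0 (linear_0 lL) addr0.
apply: (@inverse_Csmooth _ _ _ s' (2 * C) ss) => //.
  by rewrite mulr_gt0// (lt_le_trans ltr01).
by move=> y y'; rewrite (le_trans (low _ _))// !hs'.
Qed.

(** The intermediate map t = L + cutoff (s - L) agrees with [s] near 0 and with [L] near infinity.
    It is compared with [s] through forward orbits, which end near 0, and with [L] through the
    inverses, whose orbits end near infinity. The threshold is chosen from [C] and [k] alone, so
    that it can serve uniformly along a path. *)
Lemma perturbation (C : R) (k : nat) : 1 <= C -> (0 < k)%N -> exists2 d : R, 0 < d &
  forall s s' L L' : V -> V, smooth_auto s s' -> absorbing s -> linear L -> cancel L L' ->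
  cancel L' L -> (forall x, `|L x| <= C * `|x|) -> (forall x, `|L' x| <= C * `|x|) ->
  (forall x, `|iter k L x| <= 2^-1 * `|x|) ->
  (exists2 r, 0 < r & forall x y, `|x| < r -> `|y| < r ->
     `|(s x - L x) - (s y - L y)| <= d * `|x - y|) -> conjugate s L.
Proof.
move=> C1 k0; have [B B0 hB] := cutoff_lipschitz R.
have C0 : 0 < C by exact: lt_le_trans C1.
have Cp : 0 < C + 1 by rewrite addr_gt0.
have kp : 0 < k%:R :> R by rewrite ltr0n.
(* With this value the [k]-th powers of [t] and [L] differ by a ratio 1/4, so that of [t] contracts
   by 1/4 + 1/2 = 3/4; [K * C <= 2^-1], needed to invert [t], follows as well. *)
pose K := (4 * k%:R * (C + 1) ^+ k)^-1.
have Ck1 : C + 1 <= (C + 1) ^+ k by rewrite -[leLHS]expr1 ler_weXn2l// lerDr ltW.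
have D0 : 0 < 4 * k%:R * (C + 1) ^+ k by rewrite !mulr_gt0// exprn_gt0.
have K0 : 0 < K by rewrite invr_gt0.
have kk : 1 <= k%:R :> R by rewrite ler1n.
have Dl : 4 * (C + 1) <= 4 * k%:R * (C + 1) ^+ k.
  by rewrite -mulrA ler_pM2l// (le_trans Ck1)// ler_peMl// exprn_ge0// ltW.
have KC : K * C <= 2^-1.
  rewrite /K mulrC ler_pdivrMr// ler_pdivlMl//; apply: le_trans Dl; nra.
have K1 : K <= 1 by rewrite /K invf_le1//; apply: le_trans Dl; nra.
have Bp : 0 < 3 * B + 2 by rewrite addr_gt0// mulr_gt0.
(* The factor [3 * B + 2] is the loss in the Lipschitz constant caused by cutting off. *)
exists (K / (3 * B + 2)); first exact: divr_gt0.
move=> s s' L L' hs as_ lL LK LK' hL hL' hk [r r0 hr].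
pose h x := s x - L x.
pose c := (r / 4)^-1.
have r40 : 0 < r / 4 by rewrite divr_gt0.
pose eta x := cutoff (c *: x) *: h x.
have h0 : h 0 = 0 by rewrite /h (auto0 hs) linear_0// subrr.
have heta x y : `|eta x - eta y| <= K * `|x - y|.
  have -> : K = (3 * B + 2) * (K / (3 * B + 2)) by field; rewrite gt_eqF.
  apply: cutoff_difference_lipschitz => //; first by rewrite divr_ge0// ltW.
  by move=> a b; rewrite mulrCA divff// mulr1 => ar br; exact: hr.
have eta0 : eta 0 = 0 by rewrite /eta h0; exact: scaler0.
have hL_ := linear_auto lL LK LK' (ltW C0) hL hL'.
have seta : Csmooth setT eta.
  move=> j; have oT := @openT V; apply: Ck_row => // i.
  apply: (@Ck_ext _ j _ _ _ (fun x => cutoff (c *: x) * (s x 0 i - L x 0 i))) => //.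
    by move=> x _; rewrite /eta /h !mxE.
  apply: CkM => //.
    have := @Ck_comp R j V V R setT setT (fun x => c *: x) (@cutoff R) oT; apply => //.
      by apply: CkZ => //; exact: Ck_id.
    exact: cutoff_Csmooth.
  by apply: CkB => //; apply: Ck_coord => //; [exact: (auto_smooth hs)|exact: (auto_smooth hL_)].
have [t' ht] := lipschitz_perturbation_auto lL LK LK' C1 hL hL' (ltW K0) KC seta eta0 heta.
set t := (fun x => L x + eta x) in ht.
have heta' x : `|eta x| <= K * `|x| by have := heta x 0; rewrite eta0 !subr0.
have hit := iter_perturbation _ lL C1 (ltW K0) K1 hL heta'.
have cL : contracting L.
  apply: (@contracting_power _ L k 2^-1 C) => //.
  by rewrite invr_ge0 ler0n/= invf_lt1// ltr1n.
have ct : contracting t.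
  apply: (@contracting_power _ t k (3 / 4) (C + 1)) => //.
  - by apply/andP; split; lra.
  - by rewrite lerDr ltW.
  - by move=> x; have [h1 _] := hit 1%N x; move: h1; rewrite expr1.
  move=> x; have [_ h1] := hit k x; rewrite -/t in h1.
  have h2 : `|iter k t x| <= `|iter k t x - iter k L x| + `|iter k L x|.
    by rewrite -{1}(subrK (iter k L x) (iter k t x)) ler_normD.
  have h3 : K * k%:R * (C + 1) ^+ k = 4^-1.
    by rewrite /K; field; rewrite !gt_eqF// exprn_gt0.
  rewrite h3 in h1; have := hk x; move: h1 h2; move: `|iter k t x - _| `|iter k L x| `|iter k t x| `|x| => *; lra.
have cut1 x : `|x| < r / 4 -> t x = s x.
  move=> xr; rewrite /t /eta cutoff1; first by rewrite scale1r addrC subrK.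
  by rewrite /c normrZ gtr0_norm ?invr_gt0// mulrC ler_pdivrMr// mul1r ltW.
have cut2 x : 2 * (r / 4) <= `|x| -> t x = L x.
  move=> xr; rewrite /t /eta cutoff0; first by rewrite scale0r addr0.
  by rewrite /c normrZ gtr0_norm ?invr_gt0// mulrC ler_pdivlMr.
apply: (@conjugate_trans _ _ t).
  apply: (@eventual_conjugate _ s s' t t' [set x | `|x| < r / 4]) => //.
  - by move=> x /cut1.
  - exact: as_.
  - exact: contracting_eventually.
(* The maps [t] and [L] agree away from 0, where only their inverses bring orbits, hence the passage
   to [t'] and [L']. *)
apply: (conjugate_inv ht hL_).
have R0 : 0 < C * r by rewrite mulr_gt0.
apply: (@eventual_conjugate _ t' t L' L [set x | C * r < `|x|]).
- exact: auto_sym.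
- exact: auto_sym.
- move=> x /= hx; apply: (can_inj (autoK' (auto_sym ht))).
  rewrite (autoK' ht) cut2 ?LK'//.
  have h1 : `|x| <= C * `|L' x| by rewrite -{1}(LK' x).
  have h2 : C * r < C * `|L' x| by exact: lt_le_trans h1.
  by rewrite ltr_pM2l// in h2; move: h2; lra.
- exact: contracting_eventually_inv (autoK' ht) ct.
- exact: contracting_eventually_inv LK' cL.
Qed.

End Perturbation.

(** * Antilinear contractions *)

Lemma near_finite_forall (K : numFieldType) (E : normedModType K) (x : E) (I : finType)
    (P : I -> E -> Prop) : (forall i, \forall y \near x, P i y) ->
  \forall y \near x, forall i, P i y.
Proof. exact: filter_forall. Qed.

Section LinearMaps.
Variable R : realType.
Local Notation V := 'rV[R]_(2 + 2).
Local Notation J := (@mulI R 2).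

Lemma linear_matrix (L : V -> V) : linear L -> exists A : 'M[R]_(2 + 2), forall v, L v = v *m A.
Proof.
move=> lL; pose l : {linear V -> V} := HB.pack L (GRing.isLinear.Build R V V *:%R L lL).
by exists (lin1_mx l) => v; rewrite mul_rV_lin1.
Qed.

Lemma linear_bounded (L : V -> V) : linear L -> exists2 C : R, 1 <= C & forall v, `|L v| <= C * `|v|.
Proof.
move=> /linear_matrix[A hA]; have [C C0 hC] := mulmx_bound A.
exists (1 + C); first by rewrite lerDl ltW.
by move=> v; rewrite hA (le_trans (hC v))// ler_wpM2r// lerDr.
Qed.

Lemma linear_inverse (L : V -> V) : linear L -> (forall v, L v = 0 -> v = 0) ->
  exists L', cancel L L' /\ cancel L' L.
Proof.
move=> /linear_matrix[A hA] inj.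
have uA : A \in unitmx by apply: row_injective_unitmx => v; rewrite -hA; exact: inj.
exists (fun v => v *m invmx A); split=> v; rewrite hA; first by rewrite mulmxK.
by rewrite mulmxKV.
Qed.

Lemma scale_auto_bound (L : V -> V) a C x : (forall x, `|L x| <= C * `|x|) -> 0 <= a <= 1 -> 0 <= C ->
  `|a *: L x| <= C * `|x|.
Proof.
move=> hL /andP[a0 a1] C0; rewrite normrZ ger0_norm// (le_trans _ (hL x))//.
by rewrite ler_piMl.
Qed.

(** [perturbation] gives one threshold for the whole path, so [0, 1] can be cut into [N] pieces on
    which the maps move by at most that much, and the conjugacies are chained. *)
Lemma linear_path (L L' : R -> V -> V) (C : R) (k : nat) (D : R) : 1 <= C -> (0 < k)%N -> 0 < D ->
  (forall t, 0 <= t <= 1 -> [/\ linear (L t), cancel (L t) (L' t) & cancel (L' t) (L t)]) ->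
  (forall t x, 0 <= t <= 1 -> [/\ `|L t x| <= C * `|x|, `|L' t x| <= C * `|x| &
      `|iter k (L t) x| <= 2^-1 * `|x|]) ->
  (forall t u x, `|L t x - L u x| <= D * `|t - u| * `|x|) ->
  conjugate (L 0) (L 1).
Proof.
move=> C1 k0 D0 hl hb hD.
have C0 : 0 < C by exact: lt_le_trans C1.
have [d d0 hd] := @perturbation R C k C1 k0.
have au t : 0 <= t <= 1 -> smooth_auto (L t) (L' t).
  move=> t01; have [h1 h2 h3] := hl _ t01.
  by apply: (linear_auto h1 h2 h3 (ltW C0)) => x; have [] := hb t x t01.
have ab t : 0 <= t <= 1 -> absorbing (L t).
  move=> t01 e e0; apply: contracting_eventually => //.
  apply: (@contracting_power _ (L t) k 2^-1 C) => //.
  - by rewrite invr_ge0 ler0n/= invf_lt1// ltr1n.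
  - by move=> x; have [] := hb t x t01.
  - by move=> x; have [] := hb t x t01.
pose N := (Num.truncn (D / d)).+1.
have N0 : 0 < N%:R :> R by rewrite ltr0n.
have DN : D / N%:R <= d.
  rewrite ler_pdivrMr// mulrC -ler_pdivrMr//; apply/ltW.
  by have := truncnS_gt (D / d).
have in01 i : (i <= N)%N -> 0 <= (i%:R / N%:R : R) <= 1.
  by move=> iN; rewrite divr_ge0//= ler_pdivrMr// mul1r ler_nat.
have aux (a b c e : V) : a - b - (c - e) = a - c - (b - e).
  by apply/rowP => i; rewrite !mxE; ring.
have step t u : 0 <= t <= 1 -> 0 <= u <= 1 -> `|t - u| <= N%:R^-1 -> conjugate (L t) (L u).
  move=> t01 u01 tu; have [h1 h2 h3] := hl _ u01; have [g1 _ _] := hl _ t01.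
  apply: (hd _ _ _ _ (au _ t01) (ab _ t01) h1 h2 h3).
  - by move=> x; have [] := hb u x u01.
  - by move=> x; have [] := hb u x u01.
  - by move=> x; have [] := hb u x u01.
  exists 1 => // x y _ _.
  have -> : L t x - L u x - (L t y - L u y) = L t (x - y) - L u (x - y).
    rewrite (linear_B _ _ g1) (linear_B _ _ h1); exact: aux.
  rewrite (le_trans (hD _ _ _))// ler_wpM2r// (le_trans _ DN)// ler_pM2l//.
have : forall i, (i < N)%N -> conjugate (L 0) (L (i.+1%:R / N%:R)).
  elim=> [|i IH] iN.
    apply: step; [by rewrite lexx ler01|exact: in01|].
    by rewrite sub0r normrN ger0_norm ?divr_ge0// mul1r.
  apply: (conjugate_trans (IH (ltnW iN))); apply: step; [exact/in01/ltnW|exact: in01|].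
  have -> : i.+1%:R / N%:R - i.+2%:R / N%:R = - N%:R^-1 :> R.
    by rewrite -mulrBl -[i.+2%:R]natr1 opprD addrA subrr add0r mulN1r.
  by rewrite normrN ger0_norm.
move=> /(_ N.-1 (ltnSn _)); have -> : N.-1.+1 = N by []. 
by rewrite divff// gt_eqF.
Qed.

End LinearMaps.

(** * Conjugacy of an attracting map to its differential at the fixed point *)

Section Linearization.
Variable R : realType.
Local Notation V := 'rV[R]_(2 + 2).
Local Notation J := (@mulI R 2).
Variables (T T' : V -> V).
Hypotheses (hT : CR (-1) T) (aT : smooth_auto T T') (abT : absorbing T).
Local Notation A := ('d T 0 : V -> V).

Let dT x : differentiable T x. Proof. exact: CR_diff hT x. Qed.
Let T0 : T 0 = 0. Proof. exact: auto0 aT. Qed.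
Let lA : linear A. Proof. exact: linearP. Qed.

Lemma diff_iter n v : 'd (iter n T) 0 v = iter n A v /\ differentiable (iter n T) 0.
Proof.
have iT0 m : iter m T 0 = 0 by elim: m => //= m ->.
elim: n v => [|n IH] v.
  have [h1 h2] := is_diff_id (0 : V); split; last exact: h1.
  exact: (congr1 (fun f : V -> V => f v) h2).
have d1 : differentiable (iter n T) 0 by have [] := IH 0.
have d2 : differentiable T (iter n T 0) by exact: dT.
split; last exact: (differentiable_comp d1 d2).
have e := congr1 (fun f : V -> V => f v) (diff_comp d1 d2).
apply: (etrans e); rewrite /= iT0; congr ('d T 0 _); exact: (IH v).1.
Qed.

Lemma absorbing_uniform (e r : R) : 0 < e -> 0 < r -> exists N, forall m x, (N <= m)%N -> `|x| = r ->
  `|iter m T x| < e.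
Proof.
move=> e0 r0.
have /compact_near_coveringP cS := @compact_annulus R r r.
have := cS nat \oo (fun n x => forall m, (n <= m)%N -> `|iter m T x| < e) _.
case.
  move=> x /= /andP[rx _].
  have x0 : x != 0 by rewrite -normr_gt0 (lt_le_trans r0).
  have [N hN] := abT e0 x0.
  exists ([set y | forall m, (N <= m)%N -> `|iter m T y| < e], [set n | (N <= n)%N]) => /=.
    by split => //; exists N.
  by move=> [y n] /= [h Nn] m nm; apply: h; exact: leq_trans nm.
move=> N _ hN; exists N => m x Nm xr; apply: (hN N (leqnn N)) => //=.
by rewrite xr lexx.
Qed.

(** A high power of [T] maps the unit ball into a tiny one, and the Cauchy estimate at 0 turns this
    into a bound on its differential, which is the same power of [A]. *)
Lemma derivative_power_small : exists2 k, (0 < k)%N & forall v, `|iter k A v| <= 2^-1 * `|v|.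
Proof.
(* Matched to the Cauchy estimate with [C = 2] on the unit ball: [10 * 2 / 1 / 40] is one half. *)
have e0 : 0 < 40^-1 :> R by rewrite invr_gt0.
have [N hN] := absorbing_uniform e0 ltr01.
(* An even exponent makes the power of the antiholomorphic [T] holomorphic. *)
have [m [m0 Nm [l mE]]] : exists m, [/\ (0 < m)%N, (N <= m)%N & exists l, m = (2 * l)%N].
  exists (2 * N.+1)%N; split; [by []| |by exists N.+1].
  by rewrite mul2n -addnn (leq_trans (leqnSn N))// leq_addr.
have cT := CR_continuous hT.
have cT' : continuous T' by exact: Csmooth_continuous (auto_smooth' aT).
have small x : `|x| <= 1 -> `|iter m T x| < 40^-1.
  exact: (@sphere_in_ball R (iter m T) (iter m T') 1 40^-1 ltr01 e0 (@iter_continuous R T m cT)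
    (@iter_continuous R T' m cT') (iterK m (autoK aT)) (iterK m (autoK' aT)) (iter0 m T0)
    (fun y y1 => hN m y Nm y1)).
have hol_m : CR 1 (iter m T).
  by have := CR_iter m hT; rewrite mE exprM sqrrN expr1n expr1n.
exists m => // v; rewrite -(diff_iter m v).1.
have dm : differentiable (iter m T) 0 by exact: (diff_iter m 0).2.
have est j : `|'d (fun x => iter m T x 0 (lshift 2 j) : R) 0 v| <= 10 * 2 / 1 / 40 * `|v| /\
             `|'d (fun x => iter m T x 0 (rshift 2 j) : R) 0 v| <= 10 * 2 / 1 / 40 * `|v|.
  have h := CR_hol j hol_m.
  have hB i y : `|y - 0| < 1 -> `|iter m T y 0 i| <= 40^-1.
    by rewrite subr0 => /ltW/small/ltW; apply: le_trans; exact: mx_norm_coord.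
  have hBn i y : `|y - 0| < 1 -> `|- iter m T y 0 i| <= 40^-1 by rewrite normrN; exact: hB.
  have c1 := @cauchy_estimate R V J 2 setT _ _ 0 1 40^-1 (ler1n _ 2) (@mulI_bound R 2) h ltr01
    (fun y h => And3 I (hB _ _ h) (hB _ _ h)) v.
  have c2 := @cauchy_estimate R V J 2 setT _ _ 0 1 40^-1 (ler1n _ 2) (@mulI_bound R 2) (hol_rot h) ltr01
    (fun y h => And3 I (hB _ _ h) (hBn _ _ h)) v.
  exact: (conj c1 c2).
have e : 10 * 2 / 1 / 40 = 2^-1 :> R by field.
have le_half (x : R) : x <= 10 * 2 / 1 / 40 * `|v| -> x <= 2^-1 * `|v| by rewrite e.
have := @mx_norm_le R 1 (2 + 2) ('d (iter m T) 0 v) (2^-1 * `|v|) (mulr_ge0 _ (normr_ge0 _)).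
rewrite invr_ge0 ler0n => /(_ isT); apply => i k; rewrite (ord1 i) -(diff_coord k v dm).2.
case: (splitP k) => j /= kj.
  by have -> : k = lshift 2 j; [exact/val_inj|exact: le_half (est j).1].
by have -> : k = rshift 2 j; [exact/val_inj|exact: le_half (est j).2].
Qed.

Lemma derivative_auto : exists A', cancel A A' /\ cancel A' A.
Proof.
have dT' x : differentiable T' x by exact: (Ck_differentiable (auto_smooth' aT 0%N)).
apply: linear_inverse => // v hv.
have d : 'd (T' \o T) 0 v = v.
  have -> : T' \o T = id by apply/funext => x; exact: (autoK aT).
  have [_ h2] := is_diff_id (0 : V); exact: (congr1 (fun f : V -> V => f v) h2).
have e := congr1 (fun f : V -> V => f v) (diff_comp (dT 0) (dT' (T 0))).
apply: (etrans (esym d)); apply: (etrans e).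
apply: (etrans (congr1 ('d T' (T 0)) hv)); exact: linear0.
Qed.

(** The difference of [T] and [A] has zero differential at 0 and continuous partial derivatives, so
    its Lipschitz constant on small balls is below any threshold. *)
Lemma conjugate_derivative : conjugate T A.
Proof.
have [k k0 hk] := derivative_power_small.
have [A' [AK AK']] := derivative_auto.
have [C1 C11 hC1] := linear_bounded lA.
have [C2 C21 hC2] := linear_bounded (can_linear lA AK AK').
have C1p : 0 <= C1 by rewrite (le_trans ler01). have C2p : 0 <= C2 by rewrite (le_trans ler01).
have [|d d0 hd] := @perturbation R (C1 + C2) k _ k0; first by rewrite (le_trans C11)// lerDl.
apply: (hd _ _ _ _ aT abT lA AK AK') => //.
- by move=> x; rewrite (le_trans (hC1 x))// ler_wpM2r// lerDl.
- by move=> x; rewrite (le_trans (hC2 x))// ler_wpM2r// lerDr.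
have cA : continuous A := linear_bound_continuous lA C1p hC1.
pose h x := T x - A x.
have sh i : Csmooth setT (fun x => h x 0 i : R).
  move=> j; have oT := @openT V.
  apply: (@Ck_ext _ j _ _ _ (fun x => T x 0 i - A x 0 i)) => //; first by move=> x _; rewrite !mxE.
  by apply: CkB => //; apply: Ck_coord => //; [exact: (auto_smooth aT)|exact: Ck_linear].
have pb0 i : partial_bound (fun x => h x 0 i : R) 0 = 0.
  have dh : is_diff 0 h (fun v => A v - A v).
    have := @is_diffB _ _ _ T A A A 0 (differentiableP (dT 0)) (diff_linear_at 0 lA cA).
    exact.
  have [dh1 dh2] := dh.
  rewrite /partial_bound big1// => l _.
  by rewrite (diff_coord i _ dh1).2 dh2 subrr mxE normr0.
have near_small : forall i, \forall x \near (0 : V), partial_bound (fun x => h x 0 i : R) x < d.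
  move=> i; have /(_ [set t | t < d]) := partial_bound_continuous (sh i) (x := 0); apply.
  by rewrite pb0; apply: open_nbhs_nbhs; split; [exact: open_lt|].
have /nbhs_ballP[r /= r0 rB] : nbhs (0 : V) [set x | forall i, partial_bound (fun x => h x 0 i : R) x < d].
  exact: near_finite_forall near_small.
exists r => // x y xr yr.
apply: (@map_lipschitz R h 0 r d) => //; rewrite ?subr0//; last exact: ltW.
move=> i z v; rewrite subr0 => zr.
have dz : differentiable (fun x => h x 0 i : R) z by exact: (Ck_differentiable (sh i 0%N)).
split => //; rewrite (le_trans (partial_boundP v dz))// ler_wpM2r// ltW//.
by apply: (rB z); rewrite -ball_normE /= sub0r normrN.
Qed.

End Linearization.

Section NormalForm.
Variable R : realType.
Local Notation V := 'rV[R]_(2 + 2).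
Local Notation J := (@mulI R 2).

Lemma linear_Z (L : V -> V) a x : linear L -> L (a *: x) = a *: L x.
Proof. by move=> lL; have := lL a x 0; rewrite !addr0 (linear_0 lL) addr0. Qed.

Lemma linear_D (L : V -> V) x y : linear L -> L (x + y) = L x + L y.
Proof. by move=> lL; have := lL 1 x y; rewrite !scale1r. Qed.

Lemma linear_scale (L : V -> V) c : linear L -> linear (fun v => c *: L v).
Proof. by move=> lL a x y; rewrite lL scalerDr !scalerA mulrC. Qed.

Lemma iter_scale (L : V -> V) c k x : linear L -> iter k (fun v => c *: L v) x = c ^+ k *: iter k L x.
Proof.
move=> lL; elim: k => [|k IH]; first by rewrite scale1r.
by rewrite !iterS IH linear_Z// scalerA exprS.
Qed.

(** Along the segment between the two scalars the factor stays in (0, 1], which preserves the bound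
    on the [k]-th power, and above their minimum, which bounds the inverses. *)
Lemma conjugate_scale (A A' : V -> V) k a b : linear A -> cancel A A' -> cancel A' A ->
  (0 < k)%N -> (forall x, `|iter k A x| <= 2^-1 * `|x|) -> 0 < a <= 1 -> 0 < b <= 1 ->
  conjugate (fun v => a *: A v) (fun v => b *: A v).
Proof.
move=> lA AK AK' k0 hk /andP[a0 a1] /andP[b0 b1].
have lA' := can_linear lA AK AK'.
have [C1 C11 hC1] := linear_bounded lA; have [C2 C21 hC2] := linear_bounded lA'.
have C1p : 0 < C1 by exact: lt_le_trans C11. have C2p : 0 < C2 by exact: lt_le_trans C21.
pose m := Num.min a b.
have m0 : 0 < m by rewrite lt_min a0.
pose c t := a + t * (b - a).
have cm t : 0 <= t <= 1 -> m <= c t <= 1.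
  move=> /andP[t0 t1].
  have ma : m <= a by rewrite ge_min lexx.
  have mb : m <= b by rewrite ge_min lexx orbT.
  by apply/andP; split; rewrite /c; nra.
have cp t : 0 <= t <= 1 -> 0 < c t by move=> /cm/andP[h _]; exact: lt_le_trans h.
pose C := C1 + C2 / m.
have d0 : 0 < C2 / m by rewrite divr_gt0.
have := @linear_path R (fun t v => c t *: A v) (fun t v => A' ((c t)^-1 *: v)) C k (C1 * 2) _ k0.
have -> : (fun v => c 0 *: A v) = (fun v => a *: A v).
  by apply/funext => v; rewrite /c mul0r addr0.
have -> : (fun v => c 1 *: A v) = (fun v => b *: A v).
  by apply/funext => v; rewrite /c mul1r addrC subrK.
apply.
- by rewrite /C (le_trans C11)// lerDl ltW.
- by rewrite mulr_gt0.
- move=> t t01; have cn : c t != 0 by rewrite gt_eqF// cp.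
  split; [exact: linear_scale| |].
    by move=> v; rewrite scalerA mulVf// scale1r AK.
  by move=> v; rewrite AK' scalerA divff// scale1r.
- move=> t x t01; have /andP[mc c1] := cm _ t01; have cp' := cp _ t01; split.
  + rewrite (le_trans (scale_auto_bound x hC1 _ (ltW C1p)))//; first by rewrite c1 ltW.
    by rewrite ler_wpM2r// lerDl ltW.
  + rewrite (le_trans (hC2 _))// normrZ mulrA ler_wpM2r//.
    rewrite gtr0_norm ?invr_gt0// /C.
    have : C2 / c t <= C2 / m by rewrite ler_pM2l// lef_pV2 ?posrE.
    by move=> h; rewrite (le_trans h)// lerDr ltW.
  + rewrite iter_scale// normrZ normrX (gtr0_norm cp') (le_trans _ (hk x))//.
    by rewrite ler_piMl// exprn_ile1// ltW.
- move=> t u x; rewrite -scalerBl normrZ.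
  have -> : c t - c u = (t - u) * (b - a) by rewrite /c; ring.
  have h1 : `|b - a| <= 2 by rewrite ler_norml; apply/andP; split; lra.
  rewrite normrM -mulrA mulrC -mulrA [_ * (2 * _)]mulrA.
  have h2 := ler_pM (normr_ge0 (b - a)) (normr_ge0 (A x)) h1 (hC1 x).
  have := ler_wpM2l (normr_ge0 (t - u)) h2.
  by move: `|t - u| `|b - a| `|A x| `|x| => p q r s; nra.
Qed.

(** Compactness of [0, 1] times the unit sphere turns injectivity at each [t] into a uniform lower
    bound, which later bounds all inverses along the segment. *)
Lemma segment_lower_bound (A B : V -> V) : linear A -> linear B ->
  (forall (t : R) v, 0 <= t <= 1 -> (1 - t) *: A v + t *: B v = 0 -> v = 0) ->
  exists2 m : R, 0 < m & forall t v, 0 <= t <= 1 -> m * `|v| <= `|(1 - t) *: A v + t *: B v|.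
Proof.
move=> lA lB inj.
have [C1 C11 hC1] := linear_bounded lA; have [C2 C21 hC2] := linear_bounded lB.
have cA : continuous A := linear_bound_continuous lA (le_trans ler01 C11) hC1.
have cB : continuous B := linear_bound_continuous lB (le_trans ler01 C21) hC2.
pose F (z : R * V) := `|(1 - z.1) *: A z.2 + z.1 *: B z.2|.
have cF : continuous F.
  move=> z.
  have c1 : {for z, continuous (fun z : R * V => (1 - z.1) *: A z.2)}.
    apply: (@continuous_comp _ _ _ (fun z : R * V => (1 - z.1, A z.2)) (fun p : R * V => p.1 *: p.2) z);
      last exact: scale_continuous.
    apply: cvg_prod_pair; first by apply: cvgB; [exact: cvg_cst|exact: cvg_fst].
    by apply: (@continuous_comp _ _ _ snd A z); [exact: cvg_snd|exact: cA].
  have c2 : {for z, continuous (fun z : R * V => z.1 *: B z.2)}.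
    apply: (@continuous_comp _ _ _ (fun z : R * V => (z.1, B z.2)) (fun p : R * V => p.1 *: p.2) z);
      last exact: scale_continuous.
    apply: cvg_prod_pair; first exact: cvg_fst.
    by apply: (@continuous_comp _ _ _ snd B z); [exact: cvg_snd|exact: cB].
  apply: (@continuous_comp _ _ _ (fun z : R * V => (1 - z.1) *: A z.2 + z.1 *: B z.2)
     (fun x : V => `|x|) z); last exact: norm_continuous.
  by apply: cvgD; [exact: c1|exact: c2].
pose K : set (R * V) := [set z | z.1 \in `[(0 : R), 1]] `&` [set z | 1 <= `|z.2| <= 1].
have cK : compact K.
  have := compact_setX (@segment_compact R 0 1) (@compact_annulus R 1 1).
  by congr compact; apply/seteqP; split => [[t v] []|[t v] []].
move/compact_near_coveringP : cK => /(_ R (0^'+)%R (fun e z => e < F z) _)[].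
  move=> [t v] [/= t01 /andP[v1 _]].
  have Fp : 0 < F (t, v).
    rewrite normr_gt0; apply/eqP => h.
    have t01' : 0 <= t <= 1 by move: t01; rewrite in_itv.
    have v00 : v = 0 := inj _ _ t01' h.
    by move: v1; rewrite v00 normr0 ler10.
  exists ([set z | F (t, v) / 2 < F z], [set e | 0 < e < F (t, v) / 2]) => /=.
    split.
      have /(_ [set x | F (t, v) / 2 < x]) := cF (t, v); apply.
      apply: open_nbhs_nbhs; split; first exact: open_gt.
      by rewrite /= ltr_pdivrMr// ltr_pMr// ltr1n.
    have := @nbhs_right_lt R 0 (F (t, v) / 2); rewrite divr_gt0// => /(_ isT) h.
    have h0 := @nbhs_right_gt R 0.
    by apply: filterS (filterI h0 h) => e [e0 e1]; rewrite /= e0.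
  by move=> [z e] /= [hz /andP[_ he]]; exact: lt_trans hz.
move=> e /= e0 he.
have [m m0 hm] : exists2 m, 0 < m & K `<=` (fun z => m < F z).
  exists (e / 2); first exact: divr_gt0.
  move=> z Kz; apply: (he (e / 2)) => //=; last exact: divr_gt0.
  by rewrite sub0r normrN gtr0_norm ?divr_gt0// ltr_pdivrMr// ltr_pMr// ltr1n.
exists m => // t v t01; have [->|v0] := eqVneq v 0; first by rewrite normr0 mulr0.
have vp : 0 < `|v| by rewrite normr_gt0.
have : m < F (t, `|v|^-1 *: v).
  apply: hm; split => /=; first by rewrite in_itv.
  by rewrite normrZ normfV normr_id mulVf ?gt_eqF// lexx.
have e1 c : (1 - t) *: A (c *: v) + t *: B (c *: v) = c *: ((1 - t) *: A v + t *: B v).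
  rewrite (linear_Z _ _ lA) (linear_Z _ _ lB) scalerDr !scalerA.
  by congr (_ *: _ + _ *: _); exact: mulrC.
rewrite /F /= e1 normrZ normfV normr_id.
by rewrite mulrC ltr_pdivlMr// => /ltW.
Qed.

(** The maps of the segment need not contract; scaling by [r] makes each of them contract by 1/2 in
    a single step, so the path argument runs with [k = 1]. The bound [r <= 2^-1] serves when [2 * r]
    is later used as a scale in (0, 1]. *)
Lemma conjugate_segment (A B : V -> V) : linear A -> linear B ->
  (forall (t : R) v, 0 <= t <= 1 -> (1 - t) *: A v + t *: B v = 0 -> v = 0) ->
  exists2 r : R, 0 < r <= 2^-1 & conjugate (fun v => r *: A v) (fun v => r *: B v).
Proof.
move=> lA lB inj.
have [C1 C11 hC1] := linear_bounded lA; have [C2 C21 hC2] := linear_bounded lB.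
have [m m0 hm] := segment_lower_bound lA lB inj.
pose r := (2 * (C1 + C2))^-1.
have Cp : 0 < C1 + C2 by rewrite addr_gt0// (lt_le_trans ltr01).
have r0 : 0 < r by rewrite invr_gt0 mulr_gt0.
have r1 : r <= 1 by rewrite invf_le1 ?mulr_gt0//; lra.
exists r; first by rewrite r0 /= lef_pV2 ?posrE ?mulr_gt0//; lra.
pose L t v := r *: ((1 - t) *: A v + t *: B v).
have lL t : linear (L t).
  move=> a x y; rewrite /L lA lB; apply/rowP => i; rewrite !mxE; ring.
have low t v : 0 <= t <= 1 -> r * m * `|v| <= `|L t v|.
  by move=> t01; rewrite normrZ gtr0_norm// -mulrA ler_pM2l// hm.
have rm0 : 0 < r * m by rewrite mulr_gt0.
have inv_ : forall t : R, exists L', 0 <= t <= 1 -> cancel (L t) L' /\ cancel L' (L t).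
  move=> t; have [t01|nt] := pselect (0 <= t <= 1); last by exists id.
  have [|L' h] := linear_inverse (lL t); last by exists L'.
  move=> v h; have := low t v t01; rewrite h normr0 pmulr_rle0// normr_le0.
  by move/eqP.
have [L' hL'] := choice inv_.
have up t v : 0 <= t <= 1 -> `|L t v| <= 2^-1 * `|v|.
  move=> /andP[t0 t1]; rewrite normrZ gtr0_norm//.
  have h1 : `|(1 - t) *: A v + t *: B v| <= (C1 + C2) * `|v|.
    rewrite (le_trans (ler_normD _ _))// mulrDl lerD//.
      by apply: scale_auto_bound => //; [lra|rewrite (le_trans ler01)].
    by apply: scale_auto_bound => //; [rewrite t0|rewrite (le_trans ler01)].
  rewrite (le_trans (ler_wpM2l (ltW r0) h1))// mulrA ler_wpM2r//.
  by rewrite /r invfM -mulrA mulVf ?mulr1// gt_eqF.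
have := @linear_path R L L' (1 + (r * m)^-1) 1 (C1 + C2) _ (ltnSn 0) Cp.
have -> : L 0 = (fun v => r *: A v).
  by apply/funext => v; rewrite /L subr0 scale1r scale0r addr0.
have -> : L 1 = (fun v => r *: B v).
  by apply/funext => v; rewrite /L subrr scale1r scale0r add0r.
apply.
- by rewrite lerDl invr_ge0 ltW.
- by move=> t t01; have [h1 h2] := hL' t t01; split => //; exact: lL.
- move=> t x t01; split; last exact: up.
    rewrite (le_trans (up t x t01))// ler_wpM2r//.
    have : 0 <= (r * m)^-1 by rewrite invr_ge0 ltW.
    by move=> ?; lra.
  have [_ K] := hL' t t01; have := low t (L' t x) t01; rewrite K => h.
  rewrite mulrDl mul1r (le_trans (_ : _ <= (r * m)^-1 * `|x|))//; last by rewrite lerDr.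
  by rewrite ler_pdivlMl.
- move=> t u x.
  have -> : L t x - L u x = (r * (t - u)) *: (B x - A x).
    by rewrite /L; apply/rowP => i; rewrite !mxE; ring.
  rewrite normrZ normrM (gtr0_norm r0).
  have h1 : `|B x - A x| <= (C1 + C2) * `|x|.
    by rewrite (le_trans (ler_normB _ _))// mulrDl addrC lerD.
  have h2 : r * `|t - u| <= `|t - u| by rewrite ler_piMl.
  rewrite [X in _ <= X * _]mulrC -[leRHS]mulrA; apply: ler_pM => //.
  by rewrite mulr_ge0// ltW.
Qed.

End NormalForm.

(** * Choice of a rotated conjugation and reduction to half of conjugation *)

Section Rotation.
Variable R : realType.
Local Notation V := 'rV[R]_(2 + 2).
Local Notation J := (@mulI R 2).

Definition rot (a b : R) (v : V) : V := a *: v + b *: J v.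

Lemma JJ (v : V) : J (J v) = - v.
Proof.
by apply: row_eq_lr => j; rewrite ?mulI_left ?mulI_right coordN ?mulI_right// mulI_left.
Qed.

Lemma rot_linear a b : linear (rot a b).
Proof.
move=> c x y; rewrite /rot J_linear; move: (J x) (J y) => u w.
by apply/rowP => i; rewrite !mxE; ring.
Qed.

Lemma rot_rot a b c d v : rot c d (rot a b v) = rot (c * a - d * b) (c * b + d * a) v.
Proof.
rewrite /rot J_linear JZ JJ; move: (J v) => w.
by apply/rowP => i; rewrite !mxE; ring.
Qed.

Lemma rot10 v : rot 1 0 v = v.
Proof. by rewrite /rot scale1r scale0r addr0. Qed.

Lemma rotK a b v : a ^+ 2 + b ^+ 2 = 1 -> rot a (- b) (rot a b v) = v.
Proof.
move=> ab; rewrite rot_rot -[RHS]rot10; congr (rot _ _ v); first by rewrite -ab; ring.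
by ring.
Qed.

Lemma conj_rot a b v : conj_real (rot a b v) = rot a (- b) (conj_real v).
Proof.
rewrite /rot (linear_D _ _ (@conj_real_linear R)) !(linear_Z _ _ (@conj_real_linear R)).
by rewrite conj_realJ scalerN scaleNr.
Qed.

Lemma real_coords_scale (a : R[i]) (z : Cn R 2) :
  real_coords (a *: z) = rot (complex.Re a) (complex.Im a) (real_coords z).
Proof.
case: a => a b; have e j : ((a +i* b) *: z) 0 j = (a +i* b) * z 0 j by rewrite mxE.
apply: row_eq_lr => j; rewrite /rot coordD !coordZ.
  rewrite mulI_left !real_coordsl real_coordsr e; case: (z 0 j) => c d /=.
  by rewrite mulrN.
rewrite mulI_right !real_coordsr real_coordsl e; case: (z 0 j) => c d /=.
by rewrite addrC.
Qed.

(** Commutation with [J] makes [B] a complex 2 x 2 matrix on C^2; the listed numbers are roots of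
    its characteristic polynomial, of degree 2. *)
Lemma complex_eigenvalues (B : V -> V) (l : seq R[i]) : linear B -> (forall v, B (J v) = J (B v)) ->
  uniq l -> (forall a, a \in l -> exists2 v, v != 0 & B v = rot (complex.Re a) (complex.Im a) v) ->
  (size l < 3)%N.
Proof.
move=> lB BJ ul hl.
have Brot a b v : B (rot a b v) = rot a b (B v).
  by rewrite /rot (linear_D _ _ lB) !(linear_Z _ _ lB) BJ.
pose g (z : 'rV[R[i]]_2) : 'rV[R[i]]_2 := complex_coords (B (real_coords (z : Cn R 2))).
have rg z : real_coords (g z : Cn R 2) = B (real_coords (z : Cn R 2)) by rewrite /g complex_coordsK.
have lg : linear g.
  move=> a z w; apply: (can_inj (@real_coordsK R 2)).
  rewrite rg (real_coordsD (a *: (z : Cn R 2)) w) (real_coords_scale a z) (linear_D _ _ lB) Brot.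
  by rewrite (real_coordsD (a *: (g z : Cn R 2)) (g w)) (real_coords_scale a (g z)) !rg.
pose L : {linear 'rV[R[i]]_2 -> 'rV[R[i]]_2} :=
  HB.pack g (GRing.isLinear.Build R[i] 'rV[R[i]]_2 'rV[R[i]]_2 *:%R g lg).
pose M := lin1_mx L.
have szM : size (char_poly M) = 3%N by exact: size_char_poly.
rewrite -szM; apply: max_poly_roots => //.
  by rewrite -size_poly_eq0 szM.
apply/allP => a /hl[v v0 hv]; rewrite -eigenvalue_root_char.
apply/eigenvalueP; exists (complex_coords v); last by rewrite complex_coords_eq0.
rewrite mul_rV_lin1 /= /g complex_coordsK hv.
apply: (can_inj (@real_coordsK R 2)).
by rewrite complex_coordsK (real_coords_scale a (complex_coords v)) complex_coordsK.
Qed.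

(** Composed with conjugation, [A] becomes a complex linear [B]. If the segment towards the
    conjugation rotated by rho degenerates, then [B] has an eigenvalue on the open ray opposite to
    rho. Three directions give three distinct rays, hence too many eigenvalues. The direction is
    written as the square of a + i b because a square root of it is used to undo the rotation. *)
Lemma conj_direction (A : V -> V) : linear A -> (forall v, A (J v) = - J (A v)) ->
  (forall v, A v = 0 -> v = 0) -> exists a b, a ^+ 2 + b ^+ 2 = 1 /\
  forall (t : R) v, 0 <= t <= 1 ->
    (1 - t) *: A v + t *: rot (a ^+ 2 - b ^+ 2) (2 * a * b) (conj_real v) = 0 -> v = 0.
Proof.
move=> lA AJ inj.
pose B v := A (conj_real v).
have lB : linear B by move=> c x y; rewrite /B conj_real_linear lA.
have BJ v : B (J v) = J (B v).
  by rewrite /B conj_realJ -scaleN1r (linear_Z _ _ lA) AJ scaleN1r opprK.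
have key (a b : R) : a ^+ 2 + b ^+ 2 = 1 ->
    (forall (t : R) v, 0 <= t <= 1 ->
      (1 - t) *: A v + t *: rot (a ^+ 2 - b ^+ 2) (2 * a * b) (conj_real v) = 0 -> v = 0) \/
    exists2 s : R, 0 < s & exists2 v, v != 0 &
      B v = rot (- s * (a ^+ 2 - b ^+ 2)) (- s * (2 * a * b)) v.
  move=> ab; set c := a ^+ 2 - b ^+ 2; set d := 2 * a * b.
  have cd : c ^+ 2 + d ^+ 2 = 1.
    have -> : c ^+ 2 + d ^+ 2 = (a ^+ 2 + b ^+ 2) ^+ 2 by rewrite /c /d; ring.
    by rewrite ab expr1n.
  have [h|] := pselect (forall (t : R) v, 0 <= t <= 1 ->
      (1 - t) *: A v + t *: rot c d (conj_real v) = 0 -> v = 0); first by left.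
  move=> /existsNP[t /existsNP[v /not_implyP[/andP[t0 t1] /not_implyP[e v0]]]]; right.
  have v0' : v != 0 by exact/eqP.
  have tn1 : t != 1.
    apply/eqP => t1'; move: e; rewrite t1' subrr scale0r add0r scale1r => h.
    apply: v0; have := rotK (conj_real v) cd; rewrite h (linear_0 (rot_linear _ _)) => /esym/eqP.
    by rewrite conj_real_eq0 => /eqP.
  have tn0 : t != 0.
    apply/eqP => t0'; move: e; rewrite t0' scale0r addr0 subr0 scale1r => h.
    by apply: v0; exact: inj.
  have t1p : 0 < 1 - t by rewrite subr_gt0 lt_neqAle tn1.
  exists (t / (1 - t)); first by rewrite divr_gt0// lt_neqAle eq_sym tn0.
  exists (conj_real v); first by rewrite conj_real_eq0.
  rewrite /B conj_realK.
  have -> : A v = - (t / (1 - t)) *: rot c d (conj_real v).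
    have h : (1 - t)^-1 *: ((1 - t) *: A v + t *: rot c d (conj_real v)) = 0 by rewrite e scaler0.
    move: h; rewrite scalerDr !scalerA mulVf ?gt_eqF// scale1r => /eqP.
    by rewrite addr_eq0 => /eqP ->; rewrite scaleNr [t / _]mulrC.
  by rewrite /rot scalerDr !scalerA.
apply: contrapT => no.
have bad (a b : R) : a ^+ 2 + b ^+ 2 = 1 -> exists2 s : R, 0 < s & exists2 v, v != 0 &
      B v = rot (- s * (a ^+ 2 - b ^+ 2)) (- s * (2 * a * b)) v.
  by move=> ab; have [h|//] := key _ _ ab; exfalso; apply: no; exists a, b.
(* The square roots 1, i and (3 + 4i)/5 give the directions 1, -1 and (-7 + 24i)/25; rational
   coordinates leave the distinctness of the three rays to [lra]. *)
have [|s1 s10 h1] := bad 1 0; first by ring.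
have [|s2 s20 h2] := bad 0 1; first by ring.
have [|s3 s30 h3] := bad (3 / 5) (4 / 5); first by field.
pose l : seq R[i] := [:: (- s1) +i* 0; s2 +i* 0; (s3 * 7 / 25) +i* (- s3 * 24 / 25)].
have : (size l < 3)%N; last by [].
apply: (complex_eigenvalues lB BJ).
  rewrite /= !inE !negb_or !andbT; apply/andP; split; first (apply/andP; split).
  - by apply/eqP => -[] ?; lra.
  - by apply/eqP => -[] ? ?; lra.
  - by apply/eqP => -[] ? ?; lra.
move=> z; rewrite !inE => /or3P[] /eqP -> /=.
- by have [v v0 hv] := h1; exists v => //; rewrite hv; congr (rot _ _ v); ring.
- by have [v v0 hv] := h2; exists v => //; rewrite hv; congr (rot _ _ v); ring.
- by have [v v0 hv] := h3; exists v => //; rewrite hv; congr (rot _ _ v); field.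
Qed.

(** With alpha = a + i b of modulus 1, multiplication by conj(alpha) is the conjugacy: conj(alpha)
    alpha^2 conj(v) = alpha conj(v) = conj(conj(alpha) v). *)
Lemma conjugate_rotated_conj (r a b : R) : a ^+ 2 + b ^+ 2 = 1 ->
  conjugate (fun v => r *: rot (a ^+ 2 - b ^+ 2) (2 * a * b) (conj_real v))
    (fun v => r *: conj_real v).
Proof.
move=> ab; exists (rot a (- b)), (rot a b).
have ab' : a ^+ 2 + (- b) ^+ 2 = 1 by rewrite sqrrN.
have sm c d : Csmooth (@punctured R) (rot c d).
  move=> k; have [C C1 hC] := linear_bounded (@rot_linear c d).
  by apply: Ck_linear; [exact: rot_linear|exact: (linear_bound_continuous (@rot_linear c d) (le_trans ler01 C1) hC)].
have K v : rot a b (rot a (- b) v) = v by have := rotK v ab'; rewrite opprK.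
split; first split => //.
- move=> x x0; split; apply: contra x0 => /eqP h.
    by rewrite -(K x) h (linear_0 (rot_linear _ _)).
  by rewrite -(rotK x ab) h (linear_0 (rot_linear _ _)).
- by move=> x x0; rewrite K rotK.
- move=> x x0; rewrite conj_rot opprK (linear_Z _ _ (@rot_linear a (- b))) rot_rot.
  congr (_ *: rot _ _ _).
    have -> : a * (a ^+ 2 - b ^+ 2) - - b * (2 * a * b) = a * (a ^+ 2 + b ^+ 2) by ring.
    by rewrite ab mulr1.
  have -> : a * (2 * a * b) + - b * (a ^+ 2 - b ^+ 2) = b * (a ^+ 2 + b ^+ 2) by ring.
  by rewrite ab mulr1.
Qed.

Lemma CR_conjugate_conj (T T' : V -> V) : CR (-1) T -> smooth_auto T T' -> absorbing T ->
  conjugate T (fun v => 2^-1 *: conj_real v).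
Proof.
move=> hT aT abT.
pose A : V -> V := 'd T 0.
have lA : linear A by exact: linearP.
have AJ v : A (J v) = - J (A v) by have := hT.2 0 v; rewrite scaleN1r.
have [A' [AK AK']] := derivative_auto hT aT.
have injA v : A v = 0 -> v = 0.
  move=> h; have e1 := AK v; have e2 := AK 0.
  by rewrite -/(A v) h in e1; rewrite -/(A 0) (linear_0 lA) in e2; rewrite -e1 e2.
have [k k0 hk] := derivative_power_small hT aT abT.
have [a [b [ab hdir]]] := conj_direction lA AJ injA.
have lB : linear (fun v => rot (a ^+ 2 - b ^+ 2) (2 * a * b) (conj_real v)).
  by move=> c x y; rewrite conj_real_linear rot_linear.
have [r r01 hr] := conjugate_segment lA lB hdir.
have c1 : conjugate T A := conjugate_derivative hT aT abT.
have e1 : A = (fun v => 1 *: A v) by apply/funext => v; rewrite scale1r.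
have c2 : conjugate A (fun v => r *: A v).
  by rewrite {1}e1; apply: (conjugate_scale lA AK AK' k0 hk) => //;
    have /andP[r0 r1] := r01; apply/andP; split; lra.
have c3 := conjugate_rotated_conj r ab.
apply: (conjugate_trans c1); apply: (conjugate_trans c2); apply: (conjugate_trans hr).
apply: (conjugate_trans c3).
have lc := linear_scale 2^-1 (@conj_real_linear R).
have cc : cancel (fun v : V => 2^-1 *: conj_real v) (fun v => 2 *: conj_real v).
  by move=> v; rewrite (linear_Z _ _ (@conj_real_linear R)) conj_realK scalerA divff ?scale1r// pnatr_eq0.
have cc' : cancel (fun v : V => 2 *: conj_real v) (fun v => 2^-1 *: conj_real v).
  by move=> v; rewrite (linear_Z _ _ (@conj_real_linear R)) conj_realK scalerA mulVf ?scale1r// pnatr_eq0.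
have /andP[r0 r1] := r01.
(* The scaled conjugation is seen as [2 * r] times half of conjugation, because the latter contracts
   as [conjugate_scale] demands. *)
have := @conjugate_scale R _ _ 1 (2 * r) 1 lc cc cc' isT.
have -> : (fun v : V => (2 * r) *: (2^-1 *: conj_real v)) = (fun v => r *: conj_real v).
  by apply/funext => v; rewrite scalerA mulrAC divff ?mul1r// pnatr_eq0.
have -> : (fun v : V => 1 *: (2^-1 *: conj_real v)) = (fun v => 2^-1 *: conj_real v).
  by apply/funext => v; rewrite scale1r.
apply; last by rewrite ltr01 lexx.
  by move=> x; rewrite /= normrZ norm_conj_real ger0_norm.
by apply/andP; split; lra.
Qed.

End Rotation.

(** * Charts of the spheres and the diffeomorphism *)

Section SphereCoords.
Variables (R : realType) (n : nat).
Local Notation E := 'rV[R]_(n + n).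

Definition sqnorm m (x : 'rV[R]_m) : R := \sum_i x 0 i ^+ 2.

Lemma sqnorm_real_coords (z : Cn R n) :
  \sum_j `|z 0 j| ^+ 2 = (sqnorm (real_coords z))%:C%C.
Proof.
rewrite /sqnorm big_split_ord /= -big_split /= rmorph_sum /=; apply: eq_bigr => j _.
rewrite real_coordsl real_coordsr; case: (z 0 j) => a b /=.
by rewrite normc_def /= -rmorphXn /= sqr_sqrtr// addr_ge0// sqr_ge0.
Qed.

Definition sphere_coords (z : sphere R n) : E := real_coords (set_val z : Cn R n).

Lemma sqnorm_sphere z : sqnorm (sphere_coords z) = 1.
Proof.
have : unit_sphere (set_val z : Cn R n) by exact: set_valP.
by rewrite /unit_sphere /= sqnorm_real_coords => /complexI.
Qed.

Lemma unit_sphere_complex_coords (x : E) : sqnorm x = 1 -> unit_sphere (complex_coords x).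
Proof. by move=> h; rewrite /unit_sphere /= sqnorm_real_coords complex_coordsK h. Qed.

Definition sphere_of (x : E) (h : sqnorm x = 1) : sphere R n :=
  exist _ (complex_coords x) (mem_set (unit_sphere_complex_coords h)).

Lemma sphere_ofK x (h : sqnorm x = 1) : sphere_coords (sphere_of h) = x.
Proof. by rewrite /sphere_coords /sphere_of set_valE /= complex_coordsK. Qed.

Lemma sphere_coords_inj : injective sphere_coords.
Proof.
move=> z w e; apply: val_inj => /=; rewrite -!set_valE.
exact: (can_inj (@real_coordsK R n)).
Qed.

Lemma sphere_coords_continuous : continuous sphere_coords.
Proof.
move=> z; apply: (@continuous_comp _ _ _ (set_val : sphere R n -> Cn R n) (@real_coords R n) z).
  exact: initial_continuous.
exact: real_coords_continuous.
Qed.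

Lemma sphere_nbhs (z : sphere R n) (O : set (sphere R n)) : nbhs z O ->
  exists W : set E, [/\ open W, W (sphere_coords z) & forall w, W (sphere_coords w) -> O w].
Proof.
rewrite nbhsE => -[_ [[B oB <-] Bz] BO].
exists (@complex_coords R n @^-1` B); split.
- by apply: open_comp => // x _; exact: complex_coords_continuous.
- by rewrite /= /sphere_coords real_coordsK.
- by move=> w /=; rewrite /sphere_coords real_coordsK => Bw; exact: BO.
Qed.

Lemma sphere_continuous (T : topologicalType) (f : T -> sphere R n) x :
  {for x, continuous (sphere_coords \o f)} -> {for x, continuous f}.
Proof.
move=> cf O /sphere_nbhs[W [oW Wx WO]].
have : nbhs x ((sphere_coords \o f) @^-1` W) by apply: cf; exact: open_nbhs_nbhs.
by apply: filterS => y /WO.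
Qed.

Section Hemisphere.
Variables (s : bool) (k : 'I_(n + n)).
Local Notation F := 'rV[R]_(n + n).-1.

(** The inverse of the hemisphere chart: the missing [k]-th coordinate is recovered from the norm
    and the sign. It is meaningful on the open unit ball only. *)
Definition unhemi (y : F) : E :=
  \row_i (if unlift k i is Some j then y 0 j else (-1) ^+ s * Num.sqrt (1 - sqnorm y)).

Lemma sqnorm_col' (x : E) : sqnorm x = x 0 k ^+ 2 + sqnorm (col' k x).
Proof. by rewrite /sqnorm (bigD1_ord k)//=; congr (_ + _); apply: eq_bigr => j _; rewrite mxE. Qed.

Lemma unhemi_k y : unhemi y 0 k = (-1) ^+ s * Num.sqrt (1 - sqnorm y).
Proof. by rewrite mxE unlift_none. Qed.

Lemma col'_unhemi y : col' k (unhemi y) = y.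
Proof. by apply/rowP => j; rewrite !mxE liftK. Qed.

Lemma unhemiP y : sqnorm y < 1 -> sqnorm (unhemi y) = 1 /\ 0 < (-1) ^+ s * unhemi y 0 k.
Proof.
move=> y1; have p : 0 < 1 - sqnorm y by rewrite subr_gt0.
rewrite sqnorm_col' col'_unhemi unhemi_k mulrA -expr2 sqrr_sign mul1r sqrtr_gt0; split => //.
by rewrite exprMn sqrr_sign mul1r sqr_sqrtr ?subrK// ltW.
Qed.

Lemma unhemiK (x : E) : sqnorm x = 1 -> 0 < (-1) ^+ s * x 0 k ->
  unhemi (col' k x) = x /\ sqnorm (col' k x) < 1.
Proof.
move=> x1 xk; have e := sqnorm_col' x; rewrite x1 in e.
have xk0 : x 0 k != 0 by apply/eqP => h; move: xk; rewrite h mulr0 ltxx.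
have e2 : 1 - sqnorm (col' k x) = x 0 k ^+ 2 by rewrite e addrK.
split; last by rewrite -subr_gt0 e2 lt_neqAle sqr_ge0 eq_sym sqrf_eq0 xk0.
apply/rowP => i; rewrite mxE; case: unliftP => [j ->|->]; first by rewrite mxE.
have -> : Num.sqrt (1 - sqnorm (col' k x)) = (-1) ^+ s * x 0 k.
  rewrite e2 sqrtr_sqr; have -> : `|x 0 k| = `|(-1) ^+ s * x 0 k| by rewrite normrM normr_sign mul1r.
  by rewrite gtr0_norm.
by rewrite mulrA -expr2 sqrr_sign mul1r.
Qed.

Lemma sqnorm_Csmooth m (D : set 'rV[R]_m) : open D -> Csmooth D (@sqnorm m).
Proof.
move=> oD j; apply: Ck_sum => // i; apply: CkX => //.
by apply: (@Ck_coord _ j _ _ _ id i) => //; exact: Ck_id.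
Qed.

Lemma sqnorm_continuous m : continuous (@sqnorm m).
Proof.
move=> x; apply: differentiable_continuous.
by apply: (Ck_differentiable (sqnorm_Csmooth (@openT _) 0%N)).
Qed.

Definition unit_ball : set F := [set y | sqnorm y < 1].

Lemma open_unit_ball : open unit_ball.
Proof.
apply: (@open_comp _ _ (@sqnorm _) [set t | t < 1]); last exact: open_lt.
by move=> x _; exact: sqnorm_continuous.
Qed.

Lemma unhemi_Csmooth : Csmooth unit_ball unhemi.
Proof.
move=> j; have oB := open_unit_ball; apply: Ck_row => // i; rewrite /unhemi.
case: (unliftP k i) => [l il|ik].
  apply: (@Ck_ext _ j _ _ _ (fun y : F => y 0 l)) => //.
    by move=> y _; rewrite mxE il liftK.
  by apply: (@Ck_coord _ j _ _ _ id l) => //; exact: Ck_id.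
apply: (@Ck_ext _ j _ _ _ (fun y : F => (-1) ^+ s * Num.sqrt (1 - sqnorm y))) => //.
  by move=> y _; rewrite mxE ik unlift_none.
apply: CkM => //; first exact: Ck_cst.
apply: (@Ck_comp _ j _ _ _ unit_ball [set t : R | 0 < t] (fun y : F => 1 - sqnorm y)) => //.
- by move=> y; rewrite /unit_ball /= subr_gt0.
- by apply: CkB => //; [exact: Ck_cst|exact: sqnorm_Csmooth].
- by apply: Ck_sqrt => //; exact: open_gt.
Qed.

Lemma col'_Csmooth (D : set E) : open D -> Csmooth D (fun x => col' k x).
Proof.
move=> oD j; apply: Ck_row => // i.
apply: (@Ck_ext _ j _ _ _ (fun x : E => x 0 (lift k i))) => //.
  by move=> x _; rewrite mxE.
by apply: (@Ck_coord _ j _ _ _ id (lift k i)) => //; exact: Ck_id.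
Qed.

End Hemisphere.

End SphereCoords.

Section Circle.
Variable R : realType.
Local Notation E := 'rV[R]_(1 + 1).

Definition cis (t : R) : E := row_mx (const_mx (cos t)) (const_mx (sin t)).

Lemma cis_l t : cis t 0 (lshift 1 0) = cos t.
Proof. by rewrite row_mxEl mxE. Qed.

Lemma cis_r t : cis t 0 (rshift 1 0) = sin t.
Proof. by rewrite row_mxEr mxE. Qed.

Lemma circle_row_eq (x y : E) : x 0 (lshift 1 0) = y 0 (lshift 1 0) ->
  x 0 (rshift 1 0) = y 0 (rshift 1 0) -> x = y.
Proof.
move=> hl hr; apply/rowP => i; case: (splitP i) => j ij; rewrite (ord1 j) in ij.
  by have -> : i = lshift 1 0 by exact/val_inj.
by have -> : i = rshift 1 0 by exact/val_inj.
Qed.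

Lemma sqnorm_circle (x : E) : sqnorm x = x 0 (lshift 1 0) ^+ 2 + x 0 (rshift 1 0) ^+ 2.
Proof. by rewrite /sqnorm big_split_ord /= !big_ord1. Qed.

Lemma sqnorm_cis t : sqnorm (cis t) = 1.
Proof. by rewrite sqnorm_circle cis_l cis_r cos2Dsin2. Qed.

Lemma cis_surj (x : E) : sqnorm x = 1 -> exists t, x = cis t.
Proof.
rewrite sqnorm_circle => /angle_exists[t [h1 h2]]; exists t.
by apply: circle_row_eq; rewrite ?cis_l ?cis_r.
Qed.

Lemma cisDpi t : cis (t + pi) = - cis t.
Proof.
by apply: circle_row_eq; rewrite [RHS]mxE ?cis_l ?cis_r ?cosDpi ?sinDpi.
Qed.

Lemma cisBpi t : cis (t - pi) = - cis t.
Proof. by rewrite -[t in RHS](subrK pi) cisDpi opprK. Qed.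

Lemma cis_Csmooth (D : set R) : open D -> Csmooth D cis.
Proof.
move=> oD k; have [hs hc] := Ck_sin_cos k oD.
apply: Ck_row => // i; case: (splitP i) => j ij; rewrite (ord1 j) in ij.
  have -> : i = lshift 1 0 by exact/val_inj.
  by apply: (@Ck_ext _ k _ _ _ cos) => // t _; rewrite cis_l.
have -> : i = rshift 1 0 by exact/val_inj.
by apply: (@Ck_ext _ k _ _ _ sin) => // t _; rewrite cis_r.
Qed.

Lemma cos_sin_atan (u v : R) : 0 < u -> u ^+ 2 + v ^+ 2 = 1 ->
  cos (atan (v / u)) = u /\ sin (atan (v / u)) = v.
Proof.
move=> u0 uv.
have c : cos (atan (v / u)) = u.
  rewrite cos_atan; have -> : 1 + (v / u) ^+ 2 = (u^-1) ^+ 2.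
    have -> : 1 + (v / u) ^+ 2 = (u ^+ 2 + v ^+ 2) / u ^+ 2 by field; rewrite gt_eqF.
    by rewrite uv mul1r exprVn.
  by rewrite sqrtr_sqr ger0_norm ?invrK// invr_ge0 ltW.
split => //; have := atanK (v / u); rewrite /tan c => h.
by move/(congr1 (fun t => t * u)): h; rewrite !divfK// gt_eqF.
Qed.

Lemma circle_angle (t0 : R) : exists (U : set E) (a : E -> R),
  [/\ open U, U (cis t0), Csmooth U a & forall x, U x -> sqnorm x = 1 -> cis (a x) = x].
Proof.
pose c := cos t0; pose s := sin t0.
have cs1 : c ^+ 2 + s ^+ 2 = 1 by exact: cos2Dsin2.
pose u (x : E) := x 0 (lshift 1 0) * c + x 0 (rshift 1 0) * s.
pose v (x : E) := x 0 (rshift 1 0) * c - x 0 (lshift 1 0) * s.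
have su : Csmooth setT u.
  move=> k; have oT := @openT E.
  by apply: CkD => //; apply: CkM => //; (try exact: Ck_cst);
    apply: (@Ck_coord _ k _ _ _ id _) => //; exact: Ck_id.
have sv : Csmooth setT v.
  move=> k; have oT := @openT E.
  by apply: CkB => //; apply: CkM => //; (try exact: Ck_cst);
    apply: (@Ck_coord _ k _ _ _ id _) => //; exact: Ck_id.
pose U := [set x | 0 < u x].
have oU : open U.
  apply: (@open_comp _ _ u [set t | 0 < t]); last exact: open_gt.
  by move=> x _; apply: differentiable_continuous; exact: (Ck_differentiable (su 0%N)).
exists U, (fun x => t0 + atan (v x / u x)); split => //.
- by rewrite /U /= /u cis_l cis_r -!expr2 cs1 ltr01.
- move=> k; apply: CkD => //; first exact: Ck_cst.
  apply: (@Ck_comp _ k _ _ _ U setT (fun x => v x / u x) (@atan R)) => //.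
    apply: CkM => //; first exact: (Ck_sub _ (sv k)).
    by apply: CkV => //; [move=> x; rewrite /U /= => h; rewrite gt_eqF|exact: (Ck_sub _ (su k))].
  by apply: Ck_atan; exact: openT.
- move=> x Ux x1; rewrite sqnorm_circle in x1.
  have uv : u x ^+ 2 + v x ^+ 2 = 1.
    rewrite /u /v; move: (x 0 (lshift 1 0)) (x 0 (rshift 1 0)) x1 => a b x1.
    have -> : (a * c + b * s) ^+ 2 + (b * c - a * s) ^+ 2 = (a ^+ 2 + b ^+ 2) * (c ^+ 2 + s ^+ 2) by ring.
    by rewrite x1 cs1 mulr1.
  have [h1 h2] := cos_sin_atan Ux uv.
  apply: circle_row_eq; rewrite ?cis_l ?cis_r ?cosD ?sinD h1 h2 -/c -/s /u /v.
    rewrite [RHS](_ : _ = x 0 (lshift 1 0) * (c ^+ 2 + s ^+ 2)); last by rewrite cs1 mulr1.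
    ring.
  rewrite [RHS](_ : _ = x 0 (rshift 1 0) * (c ^+ 2 + s ^+ 2)); last by rewrite cs1 mulr1.
  ring.
Qed.

End Circle.

(** Spares a proof that images under charts are open: the points near which [g] has a smooth model
    form an open set containing [D]. *)
Lemma locally_smooth_on (R : realType) (E F : normedModType R) (D : set E) (g : E -> F) :
  (forall y, D y -> exists U f, [/\ open U, U y, Csmooth U f & forall x, U x -> f x = g x]) ->
  @smooth_on R E F D g.
Proof.
move=> H.
pose D' := [set y | exists U f, [/\ open U, U y, Csmooth U f & forall x, U x -> f x = g x]].
have oD' : open D'.
  rewrite openE => y [U [f [oU Uy sf fg]]]; rewrite /interior.
  have : nbhs y U by exact: open_nbhs_nbhs.
  by apply: filterS => z Uz; exists U, f.
have : Csmooth D' g.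
  by move=> k; apply: Ck_local => y [U [f [oU Uy sf fg]]]; exists U, f; split.
by move=> /(Csmooth_smooth_on oD') h vs x /H Dx; exact: h.
Qed.

Lemma near_eq_continuous (T U : topologicalType) (f g : T -> U) x :
  (\forall y \near x, f y = g y) -> {for x, continuous f} -> {for x, continuous g}.
Proof.
move=> fg cf B; rewrite -(nbhs_singleton fg) => /cf; rewrite /= => h.
by apply: filterS (filterI fg h) => y [] /= <-.
Qed.

(** * Polar coordinates for half of conjugation *)

Section Model.
Variable R : realType.
Local Notation V := 'rV[R]_(2 + 2).

(** The ambient norm is the sup norm; the Euclidean one is needed both for smoothness off 0 and for
    directions to lie on the sphere. *)
Definition enorm (x : V) : R := Num.sqrt (sqnorm x).
(** Minus the logarithm in base 2, so that half of conjugation adds 1. *)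
Definition log_radius (x : V) : R := - ln (enorm x) / ln 2.
Definition phase (x : V) := cis (pi * log_radius x).
Definition direction (x : V) : V := (enorm x)^-1 *: x.
Definition from_polar (t : R) (z : V) : V := expR (- t * ln 2) *: z.

Lemma ln2_gt0 : 0 < ln (2 : R).
Proof. by rewrite ln_gt0// ltr1n. Qed.

Lemma sqnorm_gt0 (x : V) : x != 0 -> 0 < sqnorm x.
Proof.
move=> x0; rewrite lt_neqAle eq_sym sumr_ge0 ?andbT; last by move=> i _; exact: sqr_ge0.
apply: contra x0 => h; apply/eqP/rowP => i; rewrite mxE; apply/eqP.
move: h; rewrite psumr_eq0; last by move=> j _; exact: sqr_ge0.
by move=> /allP/(_ i (mem_index_enum _)); rewrite /= sqrf_eq0.
Qed.

Lemma enorm_gt0 x : x != 0 -> 0 < enorm x.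
Proof. by move=> /sqnorm_gt0; rewrite sqrtr_gt0. Qed.

Lemma sqnormZ c (x : V) : sqnorm (c *: x) = c ^+ 2 * sqnorm x.
Proof. by rewrite /sqnorm mulr_sumr; apply: eq_bigr => i _; rewrite mxE exprMn. Qed.

Lemma enormZ c x : 0 <= c -> enorm (c *: x) = c * enorm x.
Proof. by move=> c0; rewrite /enorm sqnormZ sqrtrM ?sqr_ge0// sqrtr_sqr ger0_norm. Qed.

Lemma sqnorm_conj (x : V) : sqnorm (conj_real x) = sqnorm x.
Proof.
rewrite /sqnorm !big_split_ord /=; congr (_ + _); apply: eq_bigr => j _.
  by rewrite conj_real_l.
by rewrite conj_real_r sqrrN.
Qed.

Lemma sqnorm_direction x : x != 0 -> sqnorm (direction x) = 1.
Proof.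
move=> x0; have s0 := sqnorm_gt0 x0; rewrite sqnormZ exprVn sqr_sqrtr ?ltW//.
by rewrite mulVf// gt_eqF.
Qed.

Lemma from_polarK x : x != 0 -> from_polar (log_radius x) (direction x) = x.
Proof.
move=> /enorm_gt0 n0; rewrite /from_polar /log_radius.
have -> : - (- ln (enorm x) / ln 2) * ln 2 = ln (enorm x) by field; rewrite gt_eqF// ln2_gt0.
by rewrite lnK ?posrE// /direction scalerA divff ?scale1r// gt_eqF.
Qed.

Lemma from_polar_neq0 t (z : V) : z != 0 -> from_polar t z != 0.
Proof. by move=> z0; rewrite scaler_eq0 negb_or z0 andbT gt_eqF// expR_gt0. Qed.

Lemma enorm1 (z : V) : sqnorm z = 1 -> enorm z = 1.
Proof. by rewrite /enorm => ->; rewrite sqrtr1. Qed.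

Lemma sqnorm1_neq0 (z : V) : sqnorm z = 1 -> z != 0.
Proof.
move=> h; apply/eqP => z0; move: h; rewrite z0 /sqnorm big1; last by move=> i _; rewrite mxE expr0n.
by move/eqP; rewrite eq_sym oner_eq0.
Qed.

Lemma polar_from_polar t (z : V) : sqnorm z = 1 ->
  log_radius (from_polar t z) = t /\ direction (from_polar t z) = z.
Proof.
move=> z1; rewrite /log_radius /direction enormZ ?expR_ge0// (enorm1 z1) mulr1 expRK; split.
  by field; rewrite gt_eqF// ln2_gt0.
by rewrite scalerA mulVf ?scale1r// gt_eqF// expR_gt0.
Qed.

(** One full turn of the circle coordinate is one application of the square of half of
    conjugation. *)
Lemma from_polarD2 t (z : V) : from_polar (t + 2) z = 4^-1 *: from_polar t z.
Proof.
rewrite /from_polar scalerA; congr (_ *: _).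
have -> : - (t + 2) * ln 2 = - t * ln 2 - (ln 2 *+ 2) by rewrite mulr2n; ring.
rewrite expRD mulrC; congr (_ * _).
rewrite -lnXn// -lnV ?posrE ?exprn_gt0// lnK ?posrE ?invr_gt0 ?exprn_gt0//.
by congr (_^-1); ring.
Qed.

Lemma log_radius_conj (x : V) (c : R) : x != 0 -> 0 < c ->
  log_radius (c *: conj_real x) = log_radius x - ln c / ln 2 /\
  direction (c *: conj_real x) = conj_real (direction x).
Proof.
move=> x0 c0; have n0 := enorm_gt0 x0.
have e : enorm (c *: conj_real x) = c * enorm x by rewrite enormZ ?ltW// /enorm sqnorm_conj.
rewrite /log_radius /direction e; split.
  by rewrite lnM ?posrE//; field; rewrite gt_eqF// ln2_gt0.
rewrite (linear_Z _ _ (@conj_real_linear R)) scalerA; congr (_ *: _).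
by field; rewrite !gt_eqF.
Qed.

(** Factors 2 and 1/2 move [log_radius] by 1 in opposite directions, and half turns in either
    direction agree; so an attracting and a repelling lift have the same model. *)
Lemma phase_conj (x : V) (c : R) : x != 0 -> c = 2 \/ c = 2^-1 ->
  phase (c *: conj_real x) = - phase x.
Proof.
move=> x0 hc; have c0 : 0 < c by case: hc => ->; rewrite ?invr_gt0.
rewrite /phase (log_radius_conj x0 c0).1 mulrBr; case: hc => ->.
  by rewrite divff ?gt_eqF ?ln2_gt0// mulr1 cisBpi.
by rewrite lnV ?posrE// mulNr divff ?gt_eqF ?ln2_gt0// mulrN1 opprK cisDpi.
Qed.

Lemma enorm_Csmooth : Csmooth (@punctured R) enorm.
Proof.
move=> k; have oP := @open_punctured R.
apply: (@Ck_comp _ k _ _ _ (@punctured R) [set t : R | 0 < t] (@sqnorm R _) (@Num.sqrt R)) => //.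
- by move=> x /= x0; exact: sqnorm_gt0.
- exact: sqnorm_Csmooth.
- by apply: Ck_sqrt => //; exact: open_gt.
Qed.

Lemma phase_Csmooth : Csmooth (@punctured R) phase.
Proof.
move=> k; have oP := @open_punctured R.
apply: (@Ck_comp _ k _ _ _ (@punctured R) setT (fun x => pi * log_radius x) (@cis R)) => //.
  apply: CkM => //; first exact: Ck_cst.
  apply: CkM => //; last exact: Ck_cst.
  apply: CkN => //.
  apply: (@Ck_comp _ k _ _ _ (@punctured R) [set t : R | 0 < t] enorm (@ln R)) => //.
  - by move=> x /= x0; exact: enorm_gt0.
  - exact: enorm_Csmooth.
  - by apply: Ck_ln => //; exact: open_gt.
by apply: cis_Csmooth; exact: openT.
Qed.

Lemma Ck_scale_row k (E : normedModType R) (D : set E) m (a : E -> R) (f : E -> 'rV[R]_m) : open D ->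
  Ck k D a -> Ck k D f -> Ck k D (fun x => a x *: f x).
Proof.
move=> oD ha hf; apply: Ck_row => // i.
apply: (@Ck_ext _ k _ _ _ (fun x => a x * f x 0 i)) => //; first by move=> x _; rewrite mxE.
by apply: CkM => //; exact: Ck_coord.
Qed.

Lemma direction_Csmooth : Csmooth (@punctured R) direction.
Proof.
move=> k; have oP := @open_punctured R.
apply: Ck_scale_row => //; last exact: Ck_id.
by apply: CkV => //; [move=> x x0; rewrite gt_eqF// enorm_gt0|exact: enorm_Csmooth].
Qed.

Lemma periodic_int (X : Type) (f : R -> X) : (forall t, f (t + 2) = f t) ->
  forall (m : int) t, f (t + 2 * m%:~R) = f t.
Proof.
move=> hf; have hn (n : nat) t : f (t + 2 * n%:R) = f t.
  elim: n => [|n IH]; first by rewrite mulr0 addr0.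
  by rewrite -[n.+1%:R]natr1 mulrDr mulr1 addrA hf.
move=> [] n t; first exact: hn.
by rewrite -[in RHS](hn n.+1) NegzE mulrNz mulrN -[in LHS](hn n.+1 (t - _)) subrK hn.
Qed.

(** A function of period 2 factors through the circle: equal points force [t - t'] to be an even
    integer, because the fractional part [d] of half of it satisfies sin (pi d) = 0 with 0 <= d <
    1. *)
Lemma cis_eq_periodic (X : Type) (f : R -> X) : (forall t, f (t + 2) = f t) ->
  forall t t', cis (pi * t) = cis (pi * t') -> f t = f t'.
Proof.
move=> hf t t' e.
have hc : cos (pi * t) = cos (pi * t') by rewrite -!cis_l e.
have hs : sin (pi * t) = sin (pi * t') by rewrite -!cis_r e.
pose m := Num.floor ((t - t') / 2).
pose d := (t - t') / 2 - m%:~R.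
have d0 : 0 <= d by rewrite subr_ge0 floor_le.
have d1 : d < 1 by rewrite ltrBlDl; have := floorD1_gt ((t - t') / 2); rewrite intrD.
have te : t = (t' + 2 * d) + 2 * m%:~R by rewrite /d; field.
suff dz : d = 0 by rewrite te dz mulr0 addr0 periodic_int.
have c2 : cos (pi * (t - t')) = 1 by rewrite mulrBr cosB hc hs -!expr2 cos2Dsin2.
have per (s : R) : cos (pi * (s + 2)) = cos (pi * s).
  by rewrite mulrDr mulr_natr mulr2n addrA !cosDpi opprK.
have c3 : cos (pi * (2 * d)) = 1.
  rewrite -(periodic_int (f := fun s => cos (pi * s)) per m) -[RHS]c2; congr (cos (pi * _)).
  by rewrite te; clearbody d; move: (m%:~R : R) => b; ring.
have c4 : sin (pi * d) = 0.
  move: c3; have -> : pi * (2 * d) = (pi * d) *+ 2 by rewrite mulr2n; ring.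
  rewrite cos_mulr2n => h; apply/eqP; rewrite -sqrf_eq0 sin2cos2 subr_eq0 eq_sym.
  by apply/eqP; move: h; rewrite mulr2n; lra.
apply/eqP; rewrite eq_le d0 andbT leNgt; apply/negP => dp.
have := @sin_gt0_pi R (pi * d); rewrite mulr_gt0 ?pi_gt0// gtr_pMr ?pi_gt0// d1 => /(_ isT).
by rewrite c4 ltxx.
Qed.

End Model.

Lemma sphere_coords_opp (R : realType) n (z : sphere R n) :
  sphere_coords (sphere_opp z) = - sphere_coords z.
Proof. exact: real_coordsN. Qed.

Lemma sphere_coords_bar (R : realType) (z : sphere R 2) :
  sphere_coords (sphere_bar z) = conj_real (sphere_coords z).
Proof. by rewrite /conj_real /realify /sphere_coords real_coordsK. Qed.

(** * Descent of the conjugacy to the quotient *)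

Section Equivalence.
Variables (R : realType) (H : complex_surface R) (sigma : H -> H).
Local Notation V := 'rV[R]_(2 + 2).
Local Notation target := (sphere R 1 * sphere R 2)%type.
Variables (S S' : V -> V) (P : V -> H).
Hypothesis L : real_lift sigma S S' P.
Variables (phi phi' : V -> V) (c : R).
Hypothesis dphi : punctured_diffeo phi phi'.
Hypothesis hc : c = 2 \/ c = 2^-1.
Hypothesis phiS : forall x, x != 0 -> phi (S x) = c *: conj_real (phi x).

Let phi_neq0 x : x != 0 -> phi x != 0. Proof. by have [_ _ h _] := dphi; move=> /h[]. Qed.
Let phi'_neq0 x : x != 0 -> phi' x != 0. Proof. by have [_ _ h _] := dphi; move=> /h[]. Qed.
Let phiK x : x != 0 -> phi' (phi x) = x. Proof. by have [_ _ _ h] := dphi; move=> /h[]. Qed.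
Let phiK' x : x != 0 -> phi (phi' x) = x. Proof. by have [_ _ _ h] := dphi; move=> /h[]. Qed.
Let S_neq0 x : x != 0 -> S x != 0. Proof. by move=> /(lift_neq0 L)[]. Qed.
Let c_gt0 : 0 < c. Proof. by case: hc => ->; rewrite ?invr_gt0. Qed.

Let phase_S x : x != 0 -> phase (phi (S x)) = - phase (phi x).
Proof. by move=> x0; rewrite phiS// phase_conj// phi_neq0. Qed.

Let direction_S x : x != 0 -> direction (phi (S x)) = conj_real (direction (phi x)).
Proof. by move=> x0; rewrite phiS// (log_radius_conj (phi_neq0 x0) c_gt0).2. Qed.

(** The deck generator applies [S] twice, so the sign of the phase and the conjugation of the
    direction both cancel; polar coordinates are thus constant on fibres of [P]. *)
Let polar_iter n x : x != 0 -> [/\ iter n (S \o S) x != 0,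
  phase (phi (iter n (S \o S) x)) = phase (phi x) &
  direction (phi (iter n (S \o S) x)) = direction (phi x)].
Proof.
move=> x0; elim: n => [|n [h1 h2 h3]] //=; split.
- by do 2!apply: S_neq0.
- by rewrite !phase_S ?opprK// S_neq0.
- by rewrite !direction_S ?conj_realK// S_neq0.
Qed.

Let polar_fiber x y : x != 0 -> y != 0 -> P x = P y ->
  phase (phi x) = phase (phi y) /\ direction (phi x) = direction (phi y).
Proof.
move=> x0 y0 /(lift_fiber L x0 y0)[n [<-|<-]].
  by have [_ -> ->] := polar_iter n x0.
by have [_ -> ->] := polar_iter n y0.
Qed.

Let P_SS x : x != 0 -> P (S (S x)) = P x.
Proof.
move=> x0; have SSx : S (S x) != 0 by do 2!apply: S_neq0.
by apply/esym/(lift_fiber L x0 SSx); exists 1%N; left.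
Qed.

Let phi_SS x : x != 0 -> phi (S (S x)) = c ^+ 2 *: phi x.
Proof.
by move=> x0; rewrite phiS ?S_neq0// phiS// (linear_Z _ _ (@conj_real_linear R)) conj_realK scalerA expr2.
Qed.

(** In the model the deck generator is multiplication by [c ^+ 2], which is 4 or 1/4; in the first
    case its invariance is read backwards, starting from [4^-1 *: w]. *)
Let P_quarter w : w != 0 -> P (phi' (4^-1 *: w)) = P (phi' w).
Proof.
move=> w0.
have key u : u != 0 -> P (phi' (c ^+ 2 *: u)) = P (phi' u).
  move=> u0; rewrite -[in RHS]P_SS ?phi'_neq0//; congr P.
  have e : phi (S (S (phi' u))) = c ^+ 2 *: u by rewrite phi_SS ?phi'_neq0// phiK'.
  by rewrite -e phiK//; do 2!apply: S_neq0; exact: phi'_neq0.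
case: hc key => -> key.
  have w0' : 4^-1 *: w != 0 by rewrite scaler_eq0 negb_or w0 andbT invr_eq0 pnatr_eq0.
  rewrite -key//; congr (P (phi' _)); rewrite scalerA.
  by have -> : 2 ^+ 2 * 4^-1 = 1 :> R; [field|rewrite scale1r].
rewrite -[RHS]key//; congr (P (phi' (_ *: _))); by field.
Qed.

Let P_polar t t' z : z != 0 -> cis (pi * t) = cis (pi * t') ->
  P (phi' (from_polar t z)) = P (phi' (from_polar t' z)).
Proof.
move=> z0; apply: (@cis_eq_periodic R H (fun t => P (phi' (from_polar t z)))) => s.
by rewrite from_polarD2 P_quarter// from_polar_neq0.
Qed.

Let coords1_neq0 (w : target) : sphere_coords w.2 != 0.
Proof. exact/sqnorm1_neq0/sqnorm_sphere. Qed.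

Let forward_exists : exists h : H -> target, forall z, z != 0 ->
  sphere_coords (h (P z)).1 = phase (phi z) /\ sphere_coords (h (P z)).2 = direction (phi z).
Proof.
have : forall y, exists w : target, forall z, z != 0 -> P z = y ->
    sphere_coords w.1 = phase (phi z) /\ sphere_coords w.2 = direction (phi z).
  move=> y; have [z z0 Pz] := lift_surj L y.
  exists (sphere_of (sqnorm_cis (pi * log_radius (phi z))), sphere_of (sqnorm_direction (phi_neq0 z0))).
  move=> z' z'0 Pz'; rewrite !sphere_ofK.
  by have [h1 h2] := polar_fiber z0 z'0 (etrans Pz (esym Pz')).
by move=> /choice[h hh]; exists h => z z0; apply: hh.
Qed.

(** A point of the circle has many angles; [P_polar] makes the value independent of the one chosen.
    Quantifying over all [t] lets any smooth local angle compute [k]. *)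
Let backward_exists : exists k : target -> H, forall w t,
  sphere_coords w.1 = cis (pi * t) -> k w = P (phi' (from_polar t (sphere_coords w.2))).
Proof.
have : forall w : target, exists y, forall t,
    sphere_coords w.1 = cis (pi * t) -> y = P (phi' (from_polar t (sphere_coords w.2))).
  move=> w; have [a wa] := cis_surj (sqnorm_sphere w.1).
  exists (P (phi' (from_polar (a / pi) (sphere_coords w.2)))) => t wt.
  apply: P_polar => //; rewrite -wt wa; congr cis.
  by rewrite mulrC divfK// gt_eqF// pi_gt0.
by move=> /choice[k hk]; exists k.
Qed.

(** The maps [h] and [k] come from choice but satisfy global formulas, which give bijectivity and
    equivariance. Continuity and smoothness are local: local inverses of [P] compute [h], and local
    smooth angles compute [k]. *)
Lemma lift_equivalence : equivariantly_diffeomorphic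
    (smooth_atlas H) (prod_atlas (sphere_atlas R 1) (sphere_atlas R 2)) sigma (mu R).
Proof.
have [h hE] := forward_exists; have [k kE] := backward_exists.
have [sphi sphi' _ _] := dphi.
have [atc _ _] := surf_is_atlas H.
have oP := @open_punctured R.
have hP1 z : z != 0 -> sphere_coords (h (P z)).1 = phase (phi z) by move=> /hE[].
have hP2 z : z != 0 -> sphere_coords (h (P z)).2 = direction (phi z) by move=> /hE[].
have target_eq (w w' : target) : sphere_coords w.1 = sphere_coords w'.1 ->
    sphere_coords w.2 = sphere_coords w'.2 -> w = w'.
  case: w w' => [a b] [a' b'] /= e1 e2.
  by rewrite (sphere_coords_inj e1) (sphere_coords_inj e2).
have kh y : k (h y) = y.
  have [z z0 <-] := lift_surj L y.
  rewrite (kE _ (log_radius (phi z))) ?hP1// hP2// from_polarK ?phi_neq0// phiK//.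
have hk w : h (k w) = w.
  have [a wa] := cis_surj (sqnorm_sphere w.1).
  have wt : sphere_coords w.1 = cis (pi * (a / pi)).
    by rewrite wa; congr cis; rewrite mulrC divfK// gt_eqF// pi_gt0.
  rewrite (kE _ _ wt).
  have n0 : from_polar (a / pi) (sphere_coords w.2) != 0 by exact: from_polar_neq0.
  have [e1 e2] := polar_from_polar (a / pi) (sqnorm_sphere w.2).
  apply: target_eq; rewrite ?hP1 ?hP2 ?phi'_neq0// phiK'//.
  by rewrite /phase e1.
have equi x : h (sigma x) = mu R (h x).
  have [z z0 <-] := lift_surj L x.
  rewrite -(lift_sigma L)//; apply: target_eq; rewrite ?hP1 ?hP2 ?S_neq0//.
    by rewrite phase_S// -hP1// sphere_coords_opp.
  by rewrite direction_S// -hP2// sphere_coords_bar.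
have smooth1 : Csmooth (@punctured R) (fun x => phase (phi x)).
  move=> j; apply: (@Ck_comp _ j _ _ _ (@punctured R) (@punctured R) phi (@phase R)) => //.
  exact: phase_Csmooth.
have smooth2 : Csmooth (@punctured R) (fun x => direction (phi x)).
  move=> j; apply: (@Ck_comp _ j _ _ _ (@punctured R) (@punctured R) phi (@direction R)) => //.
  exact: direction_Csmooth.
have cont (m : nat) (f : V -> 'rV[R]_m) x : Csmooth (@punctured R) f -> x != 0 -> {for x, continuous f}.
  by move=> sf x0; apply: differentiable_continuous; exact: (Ck_differentiable (sf 0%N)).
have ch : continuous h.
  move=> y; have [z z0 Pz] := lift_surj L y.
  have [U [N [l [[oU Uz Up oN Nz] lP Pl cl _]]]] := lift_section L z0.
  rewrite Pz in Nz.
  have nN : nbhs y N by exact: open_nbhs_nbhs.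
  have cl1 : {for y, continuous l}.
    by move: (cl); rewrite continuous_open_subspace// => q; apply: q; rewrite inE.
  have ly0 : l y != 0 by apply: Up; have [] := Pl _ Nz.
  have hN x : N x -> l x != 0 /\ P (l x) = x.
    by move=> Nx; have [h1 h2] := Pl _ Nx; split => //; exact: Up.
  have c1 : {for y, continuous (fun y => (h y).1)}.
    apply: sphere_continuous; apply: (@near_eq_continuous _ _ (fun x => phase (phi (l x)))).
      by apply: filterS nN => x /hN[l0 Px] /=; rewrite -hP1// Px.
    by apply: (@continuous_comp _ _ _ l (fun x => phase (phi x))); [exact: cl1|exact: cont].
  have c2 : {for y, continuous (fun y => (h y).2)}.
    apply: sphere_continuous; apply: (@near_eq_continuous _ _ (fun x => direction (phi (l x)))).
      by apply: filterS nN => x /hN[l0 Px] /=; rewrite -hP2// Px.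
    by apply: (@continuous_comp _ _ _ l (fun x => direction (phi x))); [exact: cl1|exact: cont].
  have -> : h = (fun y => ((h y).1, (h y).2)) by apply/funext => x; case: (h x).
  by apply: cvg_prod_pair; [exact: c1|exact: c2].
(* A local lift of [k] through [P], smooth on an open set of the surrounding vector space, so that
   sphere charts enter only afterwards. *)
have local_inverse t0 : exists (U : set 'rV[R]_(1 + 1)) (m : 'rV[R]_(1 + 1) * V -> V),
    [/\ open U, U (cis (pi * t0)), Csmooth [set p | U p.1 /\ p.2 != 0] m,
      (forall p, p.2 != 0 -> m p != 0) &
      forall w : target, U (sphere_coords w.1) -> k w = P (m (sphere_coords w.1, sphere_coords w.2))].
  have [U [a [oU Ut sa aE]]] := circle_angle (pi * t0).
  pose D := [set p : 'rV[R]_(1 + 1) * V | U p.1 /\ p.2 != 0].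
  have oD : open D by apply: openI; [exact: (open_fst oU)|exact: (open_snd oP)].
  exists U, (fun p => phi' (from_polar (a p.1 / pi) p.2)); split => //.
  - move=> j; apply: (@Ck_comp _ j _ _ _ D (@punctured R) (fun p => from_polar (a p.1 / pi) p.2) phi') => //.
    + by move=> p [_ p0]; exact: from_polar_neq0.
    + apply: Ck_scale_row => //; last exact: Ck_snd.
      apply: (@Ck_comp _ j _ _ _ D setT (fun p : 'rV[R]_(1 + 1) * V => - (a p.1 / pi) * ln 2) (@expR R)) => //.
        apply: CkM => //; last exact: Ck_cst.
        apply: CkN => //; apply: CkM => //; last exact: Ck_cst.
        apply: (@Ck_comp _ j _ _ _ D U fst a) => //; [by move=> p []|exact: Ck_fst].
      by apply: Ck_expR; exact: openT.
  - by move=> p p0; apply/phi'_neq0/from_polar_neq0.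
  - move=> w Uw; apply: kE => /=.
    rewrite -{1}(aE _ Uw (sqnorm_sphere _)); congr cis.
    by rewrite mulrC divfK// gt_eqF// pi_gt0.
have angle (w : target) : exists t, sphere_coords w.1 = cis (pi * t).
  have [a wa] := cis_surj (sqnorm_sphere w.1); exists (a / pi).
  by rewrite wa; congr cis; rewrite mulrC divfK// gt_eqF// pi_gt0.
have ck : continuous k.
  move=> w; have [t0 wt] := angle w.
  have [U [m [oU Ut sm m0 mE]]] := local_inverse t0.
  have cE1 : {for w, continuous (fun w : target => sphere_coords w.1)}.
    by apply: (@continuous_comp _ _ _ fst (@sphere_coords R 1)); [exact: cvg_fst|exact: sphere_coords_continuous].
  have cE2 : {for w, continuous (fun w : target => sphere_coords w.2)}.
    by apply: (@continuous_comp _ _ _ snd (@sphere_coords R 2)); [exact: cvg_snd|exact: sphere_coords_continuous].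
  apply: (@near_eq_continuous _ _ (fun w : target => P (m (sphere_coords w.1, sphere_coords w.2)))).
    have : nbhs w ((fun w : target => sphere_coords w.1) @^-1` U).
      by apply: cE1; apply: open_nbhs_nbhs; split => //; rewrite wt.
    by apply: filterS => w' Uw'; rewrite mE.
  apply: (@continuous_comp _ _ _ (fun w : target => m (sphere_coords w.1, sphere_coords w.2)) P); last first.
    apply: (lift_continuous L); apply: m0; exact: coords1_neq0.
  apply: (@continuous_comp _ _ _ (fun w : target => (sphere_coords w.1, sphere_coords w.2)) m).
    by apply: cvg_prod_pair; [exact: cE1|exact: cE2].
  apply: differentiable_continuous; apply: (Ck_differentiable (sm 0%N)) => /=.
  by split => //; rewrite wt.
exists h; split; last exact: equi.
exists k; split => //.
  split; first exact: continuous_subspaceT.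
  move=> a b [cc Acc <-] [b1 [b2 [[s1 [k1 ->]] [s2 [k2 ->]] ->]]] /=.
  have [_ _ _ [inv [_ invK]]] := atc _ Acc.
  (* [inv] inverts the chart on its domain only; elsewhere this total function has arbitrary
     values. *)
  exists (fun y => chart_fun (prod_chart (@hemisphere_chart R 1 s1 k1) (@hemisphere_chart R 2 s2 k2))
    (h (inv (complex_coords y)))); split; last first.
    by move=> x [[_ ax] _]; rewrite /= real_coordsK invK.
  apply: locally_smooth_on => _ [x [[_ ax] _] <-].
  have [z z0 Pz] := lift_surj L x.
  have [U [N [l [[oU Uz Up oN Nz] lP Pl cl lG]]]] := lift_section L z0.
  rewrite Pz in Nz.
  have [G [oI sG GE]] := lG _ Acc.
  set I := (X in open X) in oI.
  exists I, (fun y => (col' k1 (phase (phi (G y))), col' k2 (direction (phi (G y))))).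
  have IE y : I y -> exists x, [/\ N x, chart_dom cc x, y = real_coords (chart_fun cc x),
      l x != 0 & P (l x) = x].
    move=> [x' [Nx' ax'] <-]; exists x'; have [h1 h2] := Pl _ Nx'; split => //.
    exact: Up.
  have G0 y : I y -> G y != 0 by move=> /IE[x' [Nx' ax' -> l0 _]]; rewrite GE.
  split => //.
  - by exists x.
  - move=> j; apply: Ck_pair => //.
      apply: (@Ck_comp _ j _ _ _ I (@punctured R) G (fun v => col' k1 (phase (phi v)))) => //.
      apply: (@Ck_comp _ j _ _ _ (@punctured R) setT (fun v => phase (phi v)) (fun y => col' k1 y)) => //.
      by apply: (@col'_Csmooth R 1 k1); exact: openT.
    apply: (@Ck_comp _ j _ _ _ I (@punctured R) G (fun v => col' k2 (direction (phi v)))) => //.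
    apply: (@Ck_comp _ j _ _ _ (@punctured R) setT (fun v => direction (phi v)) (fun y => col' k2 y)) => //.
    by apply: (@col'_Csmooth R 2 k2); exact: openT.
  - move=> y /IE[x' [Nx' ax' -> l0 Px]] /=.
    rewrite real_coordsK invK// GE// -hP1// -hP2// Px.
    by rewrite /sphere_coords.
split; first exact: continuous_subspaceT.
move=> a b [b1 [b2 [[s1 [k1 ->]] [s2 [k2 ->]] ->]]] [cc Acc <-] /=.
pose F := ('rV[R]_(1 + 1).-1 * 'rV[R]_(2 + 2).-1)%type.
(* A total inverse of the product chart: determined on the product of the unit balls, a default
   point outside. *)
have [w hw] : exists w : F -> target, forall y, sqnorm y.1 < 1 -> sqnorm y.2 < 1 ->
    sphere_coords (w y).1 = @unhemi R 1 s1 k1 y.1 /\ sphere_coords (w y).2 = @unhemi R 2 s2 k2 y.2.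
  have v0 : (const_mx 1 : V) != 0.
    by apply/eqP => /matrixP/(_ 0 0)/eqP; rewrite !mxE oner_eq0.
  have : forall y : F, exists w : target, sqnorm y.1 < 1 -> sqnorm y.2 < 1 ->
      sphere_coords w.1 = @unhemi R 1 s1 k1 y.1 /\ sphere_coords w.2 = @unhemi R 2 s2 k2 y.2.
    move=> y; have [y1|y1] := ltP (sqnorm y.1) 1; last first.
      by exists (sphere_of (sqnorm_cis 0), sphere_of (sqnorm_direction v0)).
    have [y2|y2] := ltP (sqnorm y.2) 1; last first.
      by exists (sphere_of (sqnorm_cis 0), sphere_of (sqnorm_direction v0)).
    exists (sphere_of (@unhemiP R 1 s1 k1 _ y1).1, sphere_of (@unhemiP R 2 s2 k2 _ y2).1) => _ _.
    by rewrite !sphere_ofK.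
  by move=> /choice[w hw]; exists w.
have wK (x : target) : 0 < (-1) ^+ s1 * sphere_coords x.1 0 k1 -> 0 < (-1) ^+ s2 * sphere_coords x.2 0 k2 ->
    w (col' k1 (sphere_coords x.1), col' k2 (sphere_coords x.2)) = x.
  move=> p1 p2; have [e1 l1] := unhemiK (sqnorm_sphere x.1) p1.
  have [e2 l2] := unhemiK (sqnorm_sphere x.2) p2.
  have [h1 h2] := hw (col' k1 (sphere_coords x.1), col' k2 (sphere_coords x.2)) l1 l2.
  by apply: target_eq; rewrite ?h1 ?h2.
exists (fun y => real_coords (chart_fun cc (k (w y)))); split; last first.
  by move=> x [[_ [x1 x2]] _]; rewrite /= wK.
apply: locally_smooth_on => _ [x [[_ [/= x1 x2]] ax] <-].
have [t0 xt] := angle x.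
have [U [m [oU Ut sm m0 mE]]] := local_inverse t0.
have [e1 l1] := unhemiK (sqnorm_sphere x.1) x1.
have [e2 l2] := unhemiK (sqnorm_sphere x.2) x2.
pose z0 := m (sphere_coords x.1, sphere_coords x.2).
have Ux : U (sphere_coords x.1) by rewrite xt.
have kz : k x = P z0 by exact: mE.
have z00 : z0 != 0 by apply: m0; exact: coords1_neq0.
have [U2 [G [[oU2 Uz2 U2p] U2a sG GE]]] := lift_chart L Acc z00 (eq_ind _ (chart_dom cc) ax _ kz).
pose um (y : F) := (@unhemi R 1 s1 k1 y.1, @unhemi R 2 s2 k2 y.2).
pose B := [set y : F | sqnorm y.1 < 1] `&` [set y : F | sqnorm y.2 < 1].
have oB : open B.
  by apply: openI; [exact: (open_fst (@open_unit_ball R 1))|exact: (open_snd (@open_unit_ball R 2))].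
have sum : Csmooth B um.
  move=> j; apply: Ck_pair => //.
    apply: (@Ck_comp _ j _ _ _ B (@unit_ball R 1) fst (@unhemi R 1 s1 k1)) => //; first by move=> y [].
      exact: Ck_fst.
    exact: unhemi_Csmooth.
  apply: (@Ck_comp _ j _ _ _ B (@unit_ball R 2) snd (@unhemi R 2 s2 k2)) => //; first by move=> y [].
    exact: Ck_snd.
  exact: unhemi_Csmooth.
pose B1 := B `&` [set y | U (um y).1].
have within_open (T : normedModType R) (f : F -> T) (D : set F) (X : set T) :
    open D -> Csmooth D f -> open X -> open (D `&` f @^-1` X).
  move=> oD sf oX; apply: within_open_preimage => //.
  rewrite continuous_open_subspace// => y; rewrite inE => Dy.
  by apply: differentiable_continuous; exact: (Ck_differentiable (sf 0%N)).
have oB1 : open B1 by apply: (@within_open _ um B [set p | U p.1]) => //; exact: open_fst.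
have um0 y : B y -> (um y).2 != 0.
  by move=> [_ y2]; apply: sqnorm1_neq0; have [] := @unhemiP R 2 s2 k2 _ y2.
have sm1 : Csmooth B1 (fun y => m (um y)).
  move=> j; apply: (@Ck_comp _ j _ _ _ B1 [set p | U p.1 /\ p.2 != 0] um m) => //.
  - by move=> y [By Uy]; split => //; exact: um0.
  - by apply: (Ck_sub _ (sum j)) => y [].
pose B2 := B1 `&` [set y | U2 (m (um y))].
exists B2, (fun y => G (m (um y))); split.
- exact: (@within_open _ (fun y => m (um y)) B1 U2).
- have ume : um (col' k1 (sphere_coords x.1), col' k2 (sphere_coords x.2)) =
      (sphere_coords x.1, sphere_coords x.2) by rewrite /um /= e1 e2.
  have Ux' : U (um (col' k1 (sphere_coords x.1), col' k2 (sphere_coords x.2))).1 by rewrite ume.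
  have Uz' : U2 (m (um (col' k1 (sphere_coords x.1), col' k2 (sphere_coords x.2)))) by rewrite ume.
  by split; [split; [split|exact: Ux']|exact: Uz'].
- move=> j; apply: (@Ck_comp _ j _ _ _ B2 U2 (fun y => m (um y)) G) => //.
  - exact: (@within_open _ (fun y => m (um y)) B1 U2).
  - by move=> y [].
  - by apply: (Ck_sub _ (sm1 j)) => y [].
- move=> y [[By Uy] U2y]; rewrite GE//; congr (real_coords (chart_fun cc _)).
  have [h1 h2] := hw y By.1 By.2.
  by rewrite mE h1// h2.
Qed.

End Equivalence.

Theorem theorem5p11 (R : realType) (H : complex_surface R) (sigma : H -> H) :
  primary_Hopf_surface H ->
  Real_structure sigma ->
  odd_Real sigma ->
  equivariantly_diffeomorphic
    (smooth_atlas H)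
    (prod_atlas (sphere_atlas R 1) (sphere_atlas R 2))
    sigma (mu R).
Proof.
move=> [cH _ _] rs os.
have [S [S' [P L]]] := odd_real_lift rs os.
have [hT hT' TK T'K T0] := extend0_lift L.
have aT : smooth_auto (extend0 S) (extend0 S') by split => //; [exact: hT.1|exact: hT'.1].
have TE x : x != 0 -> S x = extend0 S x by rewrite /extend0 => /negbTE ->.
have conj2 v : 2 *: conj_real (2^-1 *: conj_real v) = v :> 'rV[R]_(2 + 2).
  rewrite (linear_Z _ _ (@conj_real_linear R)) conj_realK scalerA divff ?scale1r//.
have [abT|abT] := lift_absorbing L cH.
  have [phi [phi' [dphi phiT]]] := CR_conjugate_conj hT aT abT.
  apply: (lift_equivalence L dphi (c := 2^-1)); first by right.
  by move=> x x0; rewrite TE// phiT.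
(* Here the inverse lift attracts and becomes half of conjugation, so the lift itself becomes the
   inverse of that, twice conjugation. *)
have [phi [phi' [dphi phiT]]] := CR_conjugate_conj hT' (auto_sym aT) abT.
apply: (lift_equivalence L dphi (c := 2)); first by left.
move=> x x0; rewrite TE//.
by rewrite -{2}(TK x) phiT ?conj2// (auto_neq0 aT).
Qed.
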